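(* There are constants $\alpha_1\simeq0.081239483\cdots$ and $u_1\simeq0.039745185\cdots$ with the following properties. Let $(\mathbf f_t,\mathbf z_t)_{t\in[0,T]}$ be a rectifiable path in $\mathscr S_0\setminus\Sigma'$. Let $\mathbf x_0\in\mathscr M$ be an approximation for $\mathbf z_0$ satisfying $$\tfrac12\,\mu(\mathbf f_0,\mathbf z_0)\,\nu(\mathbf z_0)\,\|\mathbf z_0-\mathbf x_0\|_{\mathbf z_0}\le u_1 .$$ Then one can define $(\mathbf x_i)$ and $(t_i)$ recursively by $t_0=0$ and $$\mathbf x_{i+1}=\mathbf N(\mathbf f_{t_i},\mathbf x_i),$$ $$t_{i+1}=\min\Big(T,\ \inf\big\{t>t_i:\ \tfrac12\,\mu(\mathbf f_t,\mathbf x_{i+1})\,\nu(\mathbf x_{i+1})\,\|\mathbf N_{\mathbf f_t}(\mathbf x_{i+1})-\mathbf x_{i+1}\|_{\mathbf x_{i+1}}\ge\alpha_1\big\}\Big).$$ Then $t_N=T$ for some $N\le\left\lceil59\,\mathscr L\big((\mathbf f_t,\mathbf z_t);0,T\big)\right\rceil$. Moreover, the sequence $\mathbf y_0=\mathbf x_N$, $\mathbf y_{i+1}=\mathbf N_{\mathbf f_T}(\mathbf y_i)$ is well-defined and satisfies, for $i\ge1$, $$\|\mathbf y_i-\mathbf z_T\|_{\mathbf z_T}\le2^{-2^{i-1}-2}\,\|\mathbf y_0-\mathbf y_1\|_{\mathbf y_0}.$$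
   Context: Spaces. Fix $n\ge1$, finite nonempty sets $A_1,\dots,A_n\subset(\mathbb R^n)^*$ (row vectors; $A_i\subset\mathbb Z^n$ for sparse polynomials), and $\rho_{i,\mathbf a}>0$ for $\mathbf a\in A_i$. $\mathscr F_i=\mathscr F_{A_i}$ is the space of exponential sums $f_i(\mathbf x)=\sum_{\mathbf a\in A_i}f_{i,\mathbf a}\rho_{i,\mathbf a}e^{\mathbf a\mathbf x}$ on $\mathbb C^n$, with $(\rho_{i,\mathbf a}e^{\mathbf a\mathbf x})_{\mathbf a\in A_i}$ orthonormal, so $\|f_i\|^2=\sum_{\mathbf a}|f_{i,\mathbf a}|^2$. $V_i(\mathbf x)\in\mathscr F_i^*$ is evaluation at $\mathbf x$; in dual coordinates $V_i(\mathbf x)=(\rho_{i,\mathbf a}e^{\mathbf a\mathbf x})_{\mathbf a}$ and $\|V_i(\mathbf x)\|^2=K_i(\mathbf x,\mathbf x)=\sum_{\mathbf a}\rho_{i,\mathbf a}^2e^{2\mathbf a\,\mathrm{Re}(\mathbf x)}$. Let $[V]=([V_1],\dots,[V_n]):\mathbb C^n\to\mathbb P(\mathscr F_1^* )\times\cdots\times\mathbb P(\mathscr F_n^* )$, and let $\mathscr M=\mathbb C^n/[V]$ be the quotient identifying points of $\mathbb C^n$ with the same image under $[V]$. Points of $\mathscr M$ are handled through representatives in $\mathbb C^n$; sums and differences are those of $\mathbb C^n$, and in an expression such as $\|\mathbf x-\mathbf z\|_{\mathbf x}$ the representatives are chosen to minimize the norm. Throughout $\mathbf f=(f_1,\dots,f_n)$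 with each $f_i\in\mathscr F_i\setminus\{0\}$; $\mathbf f$ is also regarded as a point of $\mathbb P(\mathscr F_1)\times\cdots\times\mathbb P(\mathscr F_n)$. Momentum and local norms. $\mathbf m_i(\mathbf x)=\frac12D\log K_i(\mathbf x,\mathbf x)=\sum_{\mathbf a}p_{i,\mathbf a}(\mathbf x)\,\mathbf a$ with $p_{i,\mathbf a}(\mathbf x)=\rho_{i,\mathbf a}^2e^{2\mathbf a\mathrm{Re}(\mathbf x)}/K_i(\mathbf x,\mathbf x)$. $\langle\cdot,\cdot\rangle_{i,\mathbf x}$ is the pull-back by $[V_i]$ of the Fubini–Study metric: $\|\mathbf u\|_{i,\mathbf x}^2=\sum_{\mathbf a}p_{i,\mathbf a}(\mathbf x)|(\mathbf a-\mathbf m_i(\mathbf x))\mathbf u|^2$; $\|\mathbf u\|_{\mathbf x}^2=\sum_{i=1}^n\|\mathbf u\|_{i,\mathbf x}^2$. $T_{\mathbf x}\mathscr M$ is $\mathbb C^n$ (modulo the common kernel of these seminorms, which is $0$ when $DS_{\mathbf f,\mathbf x}(0)$ below is invertible for some $\mathbf f$). Newton operator. $S_{\mathbf f,\mathbf x}(\dot{\mathbf x})\in\mathbb C^n$ has $i$-th coordinate $\|W_i(\mathbf x)\|^{-1}W_i(\mathbf x+\dot{\mathbf x})(f_i)$, where $W_i(\mathbf y)=e^{-\mathbf m_i(\mathbf x)\mathbf y}V_i(\mathbf y)$ ($\mathbf x$ fixed), so $W_i(\mathbf y)(f_i)=e^{-\mathbf m_i(\mathbf x)\mathbf y}f_i(\mathbf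 y)$. The Newton operator is $\mathbf N(\mathbf f,\mathbf x)=\mathbf N_{\mathbf f}(\mathbf x)=\mathbf x-DS_{\mathbf f,\mathbf x}(0)^{-1}S_{\mathbf f,\mathbf x}(0)$. Condition numbers. $\mu(\mathbf f,\mathbf x)=\|DS_{\mathbf f,\mathbf x}(0)^{-1}\,\mathrm{diag}(\|f_1\|,\dots,\|f_n\|)\|_{\mathbf x}$, operator norm from $\mathbb C^n$ (canonical norm) to $(T_{\mathbf x}\mathscr M,\|\cdot\|_{\mathbf x})$, and $\mu=\infty$ if $DS_{\mathbf f,\mathbf x}(0)$ is not invertible. $\nu_i(\mathbf x)=\max_{\mathbf a\in A_i}\sup_{\|\mathbf u\|_{i,\mathbf x}\le1}|(\mathbf a-\mathbf m_i(\mathbf x))\mathbf u|$ and $\nu(\mathbf x)=\max_i\nu_i(\mathbf x)$. Solution variety and condition length. $\mathscr S_0=\{(\mathbf f,\mathbf x)\in\mathbb P(\mathscr F_1)\times\cdots\times\mathbb P(\mathscr F_n)\times\mathscr M:\mathbf f(\mathbf x)=0\}$; $\Sigma'$ is the set of pairs with $\mu(\mathbf f,\mathbf x)\nu(\mathbf x)=\infty$. For a path, $$\mathscr L((\mathbf f_t,\mathbf z_t);t_0,t_1)=\int_{t_0}^{t_1}\mu(\mathbf f_t,\mathbf z_t)\,\nu(\mathbf z_t)\sqrt{\|\dot{\mathbf f}_t\|_{\mathbf f_t}^2+\|\dot{\mathbf z}_t\|_{\mathbf z_t}^2}\,dt,$$ where $\|\cdot\|_{\mathbf f}$ is the product Fubini–Study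 norm on the tangent space of $\mathbb P(\mathscr F_1)\times\cdots\times\mathbb P(\mathscr F_n)$ at $[\mathbf f]$.
   Formalization: For a constant path with T>0 the condition length is 0 and t_0=0≠T, so the printed bound fails; there N=1 is proved instead. ''Rectifiable'' is read as absolutely continuous, since for Cantor-type paths the displayed integral is not the length and the bound fails. *)

(* Defs.v *)
(* MathComp-Analysis, over an arbitrary [R : realType], with [C = R[i]]. *)
From mathcomp Require Export all_boot all_order all_algebra finmap.
From mathcomp Require Export complex.
From mathcomp Require Export all_classical all_reals all_analysis.

Set Implicit Arguments.
Unset Strict Implicit.
Unset Printing Implicit Defensive.

Import Order.TTheory GRing.Theory Num.Theory.
Import numFieldNormedType.Exports.

Local Open Scope classical_set_scope.
Local Open Scope ring_scope.
Local Open Scope complex_scope.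

Section ComplexPrelim.
Variable R : realType.
Local Notation C := R[i].

Definition modc (z : C) : R := Normc.normc z.

Definition cexp (z : C) : C :=
  (expR (complex.Re z) * cos (complex.Im z))
  +i* (expR (complex.Re z) * sin (complex.Im z)).

Definition canonical_norm n (v : 'cV[C]_n) : R :=
  Num.sqrt (\sum_j modc (v j 0) ^+ 2).

(* The value [a u] of a real covector [a] at a complex vector [u]. *)
Definition covec n (a : 'rV[R]_n) (u : 'cV[C]_n) : C :=
  \sum_j (a 0 j)%:C * u j 0.

(* Absolute continuity on [[a, b]]: [s] lists finitely many non-overlapping
   subintervals, from left to right. *)
Definition abs_continuous (a b : R) (g : R -> C) : Prop :=
  forall e : R, 0 < e -> exists2 d : R, 0 < d &
    forall s : seq (R * R),
      all (fun I => [&& a <= I.1, I.1 <= I.2 & I.2 <= b]) s ->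
      pairwise (fun I J => I.2 <= J.1) s ->
      \sum_(I <- s) (I.2 - I.1) < d ->
      \sum_(I <- s) modc (g I.2 - g I.1) < e.

(* Derivative of a complex-valued function of a real variable. *)
Definition velocity (g : R -> C) (t : R) : C :=
  derive1 (fun s => complex.Re (g s) : R^o) t
  +i* derive1 (fun s => complex.Im (g s) : R^o) t.

Definition maxe_over (I : finType) (F : I -> \bar R) : \bar R :=
  \big[maxe/-oo%E]_i F i.

End ComplexPrelim.

Section ExponentialSums.
Variables (R : realType) (n : nat).
Local Notation C := R[i].
Variable A : 'I_n -> {fset 'rV[R]_n}.
Variable rho : forall i, A i -> R.
Arguments rho : clear implicits.

(* Coordinates [f_(i,a)] in the orthonormal basis [rho_(i,a) e^(a x)] of the
   i-th space of exponential sums; also dual coordinates. *)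
Definition coords (i : 'I_n) : Type := {ffun A i -> C}.

Definition system : Type := forall i : 'I_n, coords i.

Definition coords_norm i (v : coords i) : R :=
  Num.sqrt (\sum_a modc (v a) ^+ 2).

Definition pairing i (v g : coords i) : C := \sum_a v a * g a.

Definition hermitian i (g h : coords i) : C := \sum_a g a * conjc (h a).

Definition Veronese i (y : 'cV[C]_n) : coords i :=
  [ffun a => (rho i a)%:C * cexp (covec (val a) y)].

(* [V y = V y'] in the product of the projective spaces, i.e. [y] and [y'] are
   representatives of the same point of the quotient [M = C^n / [V]]. *)
Definition same_point (y y' : 'cV[C]_n) : Prop :=
  forall i, exists2 c : C, c != 0 &
    forall a, Veronese i y' a = c * Veronese i y a.

Definition reproducing_kernel i (x : 'cV[C]_n) : R :=
  \sum_a rho i a ^+ 2 * expR (2 * complex.Re (covec (val a) x)).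

Definition weight i (x : 'cV[C]_n) (a : A i) : R :=
  rho i a ^+ 2 * expR (2 * complex.Re (covec (val a) x))
  / reproducing_kernel i x.

Definition momentum i (x : 'cV[C]_n) : 'rV[R]_n :=
  \sum_(a : A i) weight x a *: val a.

Definition local_norm_i i (x u : 'cV[C]_n) : R :=
  Num.sqrt (\sum_(a : A i)
    weight x a * modc (covec (val a - momentum i x) u) ^+ 2).

Definition local_norm (x u : 'cV[C]_n) : R :=
  Num.sqrt (\sum_i local_norm_i i x u ^+ 2).

(* [||y - z||_x] for points of [M]: representatives minimize the norm. *)
Definition local_dist (x y z : 'cV[C]_n) : R :=
  inf [set r | exists y' z', [/\ same_point y y', same_point z z' &
                                 r = local_norm x (y' - z')]].

(* [W_i(y)] depends on the base point [x] through the momentum. *)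
Definition renormalized i (x y : 'cV[C]_n) : coords i :=
  [ffun a => cexp (- covec (momentum i x) y) * Veronese i y a].

Definition S_op (f : system) (x dx : 'cV[C]_n) : 'cV[C]_n :=
  \col_i ((coords_norm (renormalized i x x))^-1%:C
          * pairing (renormalized i x (x + dx)) (f i)).

(* The Jacobian matrix at [0] of the holomorphic map [S_op f x]; the entries are
   complex derivatives ([R[i]] as a field normed over itself). *)
Definition DS_op (f : system) (x : 'cV[C]_n) : 'M[C]_n :=
  \matrix_(i, j)
    derive1 (fun h : C => S_op f x (h *: delta_mx j 0) i 0 : C^o) 0.

(* [invmx] is total; meaningful only when [DS_op f x] is invertible. *)
Definition newton (f : system) (x : 'cV[C]_n) : 'cV[C]_n :=
  x - invmx (DS_op f x) *m S_op f x 0.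

Local Open Scope ereal_scope.

(* Infinite where the Newton operator is undefined, so that such points count as
   exceeding any threshold in a step-size rule. *)
Definition newton_step_norm (f : system) (x : 'cV[C]_n) : \bar R :=
  if DS_op f x \in unitmx then (local_dist x (newton f x) x)%:E else +oo.

Definition mu (f : system) (x : 'cV[C]_n) : \bar R :=
  if DS_op f x \in unitmx then
    ereal_sup [set (local_norm x
                      (invmx (DS_op f x)
                       *m diag_mx (\row_i (coords_norm (f i))%:C) *m v))%:E
              | v in [set v | (canonical_norm v <= 1)%R]]
  else +oo.

Definition nu_i i (x : 'cV[C]_n) : \bar R :=
  maxe_over (fun a : A i =>
    ereal_sup [set (modc (covec (val a - momentum i x)%R u))%:E
              | u in [set u | (local_norm_i i x u <= 1)%R]]).

Definition nu (x : 'cV[C]_n) : \bar R := maxe_over (fun i => nu_i i x).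

Local Close Scope ereal_scope.

Definition solution_variety (f : system) (x : 'cV[C]_n) : Prop :=
  forall i, pairing (Veronese i x) (f i) = 0.

(* The convention [0 * +oo = 0] plays no role on the solution variety: [nu] is 0
   only if every [A i] is a singleton, and then no nonzero [f] vanishes. *)
Definition Sigma' (f : system) (x : 'cV[C]_n) : Prop :=
  (mu f x * nu x = +oo)%E.

(* Paths are given by representatives: nonzero coordinates for the projective
   factors, and a lift to [C^n] for [M].  Rectifiable means absolutely
   continuous, so that the integral of the speed is the length. *)
Definition rectifiable (t0 t1 : R) (f : R -> system) (z : R -> 'cV[C]_n) :
    Prop :=
  (forall i (a : A i), abs_continuous t0 t1 (fun t => f t i a)) /\
  (forall j, abs_continuous t0 t1 (fun t => z t j 0)).

Definition system_velocity (f : R -> system) (t : R) : system :=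
  fun i => [ffun a => velocity (fun s => f s i a) t].

Definition point_velocity (z : R -> 'cV[C]_n) (t : R) : 'cV[C]_n :=
  \col_j velocity (fun s => z s j 0) t.

(* Norm of the class of [g] in the tangent space at [[h]] of the projective
   space: the part of [g] orthogonal to [h], relative to the norm of [h]. *)
Definition fubini_study i (h g : coords i) : R :=
  coords_norm [ffun a => g a - hermitian g h / hermitian h h * h a]
  / coords_norm h.

Definition FS_norm (h g : system) : R :=
  Num.sqrt (\sum_i fubini_study (h i) (g i) ^+ 2).

Definition condition_length (f : R -> system) (z : R -> 'cV[C]_n)
    (t0 t1 : R) : \bar R :=
  (\int[lebesgue_measure]_(t in `[t0, t1])
     (mu (f t) (z t) * nu (z t) *
      (Num.sqrt (FS_norm (f t) (system_velocity f t) ^+ 2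
                 + local_norm (z t) (point_velocity z t) ^+ 2))%:E))%E.

End ExponentialSums.

(* Main.v *)
(* All estimates are centered at the current iterate x. If r = nu(x) |y - x|_x
is small, the local norms, DS and nu at y compare with those at x up to factors
close to 1, so 1/2 mu nu |z - x|_x and the Newton test 1/2 mu nu |N_f(x) - x|_x
control each other, and a Newton step from x contracts the distance to z.

Write c(f, x) = 1 / mu(f, x), an infimum over the local unit sphere that is
Lipschitz in f / |f| and makes sense for singular DS, and
h(t) = 1/2 nu(x) |z_t - x|_x. While the Newton test at x stays below alpha_1,
h(t) cannot lie in (0.09 c(f_t, x), 0.0905 c(f_t, x)], so by continuity
h <= 0.09 c up to the next time step. Along such a piece of the path
ln |DS_{f_t, x} w|^2 and a real linear form of z_t are absolutely continuous
with derivatives bounded by the integrand of the condition length. If the length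
consumed is at most 1/59, integrating keeps h below 0.0725 c, and then the Newton
test is still below alpha_1. Hence every complete step consumes more than 1/59
of the length, which is finite, and T is reached.

For the error of y_1, DS (y_1 - z) has rows weighted by e^l - 1 - l with
l = (a - m)(z - x), and e^l - 1 - l - l/91 is small enough to confine y_1 - x to a
ball on which |y_1 - z| / |y_1 - x| <= 1 / sqrt 92. Later errors contract
quadratically.

Since the initial hypothesis concerns the quotient, z is first translated by a
period of [V] to bring z_0 close to x_0 in C^n. *)

Require Import Defs.
From HB Require Import structures.
From mathcomp Require Import measurable_realfun.
From mathcomp Require Import ring lra.

Set Implicit Arguments.
Unset Strict Implicit.
Unset Printing Implicit Defensive.

Import Order.TTheory GRing.Theory Num.Theory.
Import numFieldNormedType.Exports.

Local Open Scope classical_set_scope.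
Local Open Scope ring_scope.

(** * Absolutely continuous functions *)

(** Within one step the center [x] stays fixed while the system and the zero move, so [nu x] and the
    local norm are constants, and only [dn] in a fixed direction and a linear form of the zero are
    differentiated. The obstacle is that the path is merely absolutely continuous: velocities exist
    almost everywhere, and nothing is known of the integrand of the condition length on the
    exceptional null set. Its integral is treated as a lower integral, with measurable minorants and
    majorants made from densities.

    Constants, with v for half of mu nu |z - x|_x. The initial bound 1/25 at z loses a factor 9/4 in
    the passage to x, which gives 9/100. A Newton step sends v to at most 9/2 v^2, and 9/2 (9/100)^2
    < 1/25. On a piece of length at most 1/59, c shrinks by at most 21/20, so v ends below 21/20
    (1/25 + 63/40/59) < 29/400, which leaves room below 3/40. At 3/40 the value v + 134/125 v^2 is
    still below alpha_1; at 9/100 the value v - 134/125 v^2 is already above it. *)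

Section AbsolutelyContinuous.
Variable R : realType.
Implicit Types (a b : R) (g : R -> R) (s : seq (R * R)).

Definition ordered_intervals s := pairwise (fun I J : R * R => I.2 <= J.1) s.

(** Real-valued counterpart of [abs_continuous]; [real_coord] reduces the complex coordinates of the
    path to it. *)
Definition ac a b g := forall e : R, 0 < e -> exists2 d : R, 0 < d &
  forall s, all (fun I => [&& a <= I.1, I.1 <= I.2 & I.2 <= b]) s ->
    ordered_intervals s -> \sum_(I <- s) (I.2 - I.1) < d ->
    \sum_(I <- s) `|g I.2 - g I.1| < e.

Lemma acD a b g h : ac a b g -> ac a b h -> ac a b (fun t => g t + h t).
Proof.
move=> ag ah e e0; have e20 : 0 < e / 2 by rewrite divr_gt0.
have [d1 d10 H1] := ag _ e20; have [d2 d20 H2] := ah _ e20.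
exists (Num.min d1 d2); first by rewrite lt_min d10.
move=> s sab os; rewrite lt_min => /andP[s1 s2].
apply: (@le_lt_trans _ _ (\sum_(I <- s) `|g I.2 - g I.1|
  + \sum_(I <- s) `|h I.2 - h I.1|)).
  rewrite -big_split/=; apply: ler_sum => I _.
  by rewrite opprD addrACA ler_normD.
by rewrite [e]splitr ltrD ?H1 ?H2.
Qed.

Lemma ac_le a b K g h : 0 <= K -> ac a b g ->
  (forall x y, a <= x -> x <= y -> y <= b -> `|h y - h x| <= K * `|g y - g x|) ->
  ac a b h.
Proof.
move=> K0 ag hg e e0; have K1 : 0 < K + 1 by rewrite ltr_wpDl.
have [d d0 H] := ag (e / (K + 1)) (divr_gt0 e0 K1).
exists d => // s sab os sd; have := H _ sab os sd.
rewrite ltr_pdivlMr//; apply: le_lt_trans; rewrite mulr_suml.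
rewrite big_seq [leRHS]big_seq; apply: ler_sum => I Is.
have /and3P[aI II Ib] := allP sab _ Is.
by rewrite (le_trans (hg _ _ aI II Ib))// mulrC ler_wpM2l// lerDl.
Qed.

Lemma acN a b g : ac a b g -> ac a b (fun t => - g t).
Proof.
by move/(ac_le ler01); apply=> x y _ _ _; rewrite -opprD normrN mul1r.
Qed.

Lemma ac_subitv a b c d g : a <= c -> d <= b -> ac a b g -> ac c d g.
Proof.
move=> ac db H e e0; have [D D0 HD] := H _ e0; exists D => // s scd os sD.
apply: HD => //; apply: sub_all scd => I /and3P[cI -> Id].
by rewrite (le_trans ac cI) (le_trans Id db).
Qed.

Lemma ac_unif_continuous a b g : ac a b g -> forall e, 0 < e ->
  exists2 d, 0 < d & forall x y, a <= x <= b -> a <= y <= b -> `|x - y| < d ->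
    `|g x - g y| < e.
Proof.
move=> ag e e0; have [d d0 H] := ag _ e0; exists d => //.
move=> x y; wlog xy : x y / x <= y.
  move=> W xab yab xyd; have [xy|/ltW yx] := leP x y; first exact: W.
  by rewrite distrC; apply: W => //; rewrite distrC.
move=> /andP[ax xb] /andP[ay yb] xyd.
have := H [:: (x, y)]; rewrite !big_seq1/= distrC; apply => //.
- by rewrite ax xy yb.
- by rewrite -(ger0_norm (_ : 0 <= y - x)) ?subr_ge0// distrC.
Qed.

Lemma pieces_partition a (s : seq R) : path <%O a s ->
  [/\ all (fun I => [&& a <= I.1, I.1 <= I.2 & I.2 <= last a s]) (zip (a :: s) s),
      ordered_intervals (zip (a :: s) s)
    & \sum_(I <- zip (a :: s) s) (I.2 - I.1) = last a s - a].
Proof.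
elim: s a => [a _|x s IH a /= /andP[ax xs]]; first by rewrite big_nil subrr.
have [H1 H2 H3] := IH _ xs.
have xl : x <= last x s.
  elim: s x xs {ax IH H1 H2 H3} => //= y s IH x /andP[/ltW xy ys].
  exact: (le_trans xy (IH _ ys)).
rewrite lexx (ltW ax) xl /=; split.
- apply: sub_all H1 => I /and3P[xI -> ->]; rewrite (le_trans (ltW ax) xI)//.
- by rewrite /ordered_intervals/= -/(ordered_intervals _) H2 andbT;
    apply: sub_all H1 => I /and3P[].
- by rewrite big_cons H3/= addrC addrA subrK.
Qed.

End AbsolutelyContinuous.

Section TotalVariation.
Variable R : realType.
Implicit Types (a b : R) (g : R -> R) (s : seq (R * R)).
Notation TV := total_variation.

Lemma variation_pieces a b g (s : seq R) : itv_partition a b s ->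
  variation a b g s = \sum_(I <- zip (a :: s) s) `|g I.2 - g I.1|.
Proof.
move=> abs; rewrite (variation_zip _ abs).
elim: s a {b abs} => [a|x s IH a]; first by rewrite !big_nil.
by rewrite /= !big_cons -IH.
Qed.

(** A partition of [[x, y]] is one admissible family of total length [y - x], so all variation sums
    are bounded at once. *)
Lemma ac_TV_small a b g : ac a b g -> forall e, 0 < e ->
  exists2 d, 0 < d & forall x y, a <= x -> x <= y -> y <= b -> y - x < d ->
    (TV x y g <= e%:E)%E.
Proof.
move=> ag e e0; have [d d0 H] := ag _ e0; exists d => // x y ax xy yb xyd.
apply: ge_ereal_sup => _ [_ [s xys <-] <-]; rewrite lee_fin.
rewrite (variation_pieces _ xys); case: xys => xs /eqP sy.
have [H1 H2 H3] := pieces_partition xs; apply/ltW/H => //.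
  by apply: sub_all H1 => I /and3P[xI -> Iy]; rewrite (le_trans ax xI)/=
    (le_trans Iy)// sy.
by rewrite H3 sy.
Qed.

(** Total variation is additive and at most 1 on short intervals; the induction counts the steps of
    length [d / 2] from [a] to [x]. *)
Lemma ac_bounded_variation a b g : a <= b -> ac a b g -> bounded_variation a b g.
Proof.
move=> ab ag; apply/(bounded_variationP _ ab).
have [d d0 H] := ac_TV_small ag ltr01.
suff K (n : nat) : forall x, a <= x -> x <= b -> x - a < n%:R * (d / 2) ->
    TV a x g \is a fin_num.
  apply: (K (Num.bound ((b - a) / (d / 2)))) => //.
  by rewrite -ltr_pdivrMr ?divr_gt0// archi_boundP// !divr_ge0 ?subr_ge0// ltW.
elim: n => [x ax _|n IH x ax xb xd]; first by rewrite mul0r subr_lt0 ltNge ax.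
have [xad|xad] := leP x (a + d / 2).
  rewrite ge0_fin_numE ?total_variation_ge0//.
  apply: (le_lt_trans (H _ _ (lexx a) ax xb _)); last exact: ltry.
  by lra.
pose y := x - d / 2; have ay : a <= y by rewrite /y; lra.
have yx : y <= x by rewrite /y; lra.
rewrite (total_variationD _ ay yx) fin_numD (IH y ay (le_trans yx xb)) /=.
  rewrite ge0_fin_numE ?total_variation_ge0//.
  apply: (le_lt_trans (H _ _ ay yx xb _)); last exact: ltry.
  by rewrite /y; lra.
by move: xd; rewrite -[n.+1]addn1 natrD mulrDl /y; lra.
Qed.

Section VariationFunction.
Variables (a b : R) (g : R -> R).
Hypotheses (ab : a <= b) (ag : ac a b g).
Let V x := fine (TV a x g).

Let TV_fin x y : a <= x -> x <= y -> y <= b -> TV x y g \is a fin_num.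
Proof.
move=> ax xy yb; apply/(bounded_variationP _ xy).
by apply: ac_bounded_variation => //; apply: ac_subitv ag.
Qed.

Let V_TV x y : a <= x -> x <= y -> y <= b -> (V y - V x)%:E = TV x y g.
Proof.
move=> ax xy yb; rewrite /V (total_variationD _ ax xy) fineD ?TV_fin//.
  by rewrite addrC addKr fineK// TV_fin.
by rewrite (le_trans xy).
Qed.

Lemma variation_function_le x y : a <= x -> x <= y -> y <= b ->
  `|g y - g x| <= V y - V x.
Proof.
by move=> ax xy yb; rewrite -lee_fin V_TV// total_variation_ge.
Qed.

(** Each interval is replaced by a partition that realizes its total variation up to [e], so
    increments of [V] are bounded by increments of [g] over a family of the same total length. The
    third clause keeps the concatenated family ordered in the induction. *)
Let refine (e : R) s : 0 < e ->
    all (fun I => [&& a <= I.1, I.1 <= I.2 & I.2 <= b]) s ->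
    ordered_intervals s ->
  exists s', [/\ all (fun I => [&& a <= I.1, I.1 <= I.2 & I.2 <= b]) s',
    ordered_intervals s',
    forall c, all (fun I => c <= I.1) s -> all (fun I => c <= I.1) s',
    \sum_(I <- s') (I.2 - I.1) = \sum_(I <- s) (I.2 - I.1)
    & \sum_(I <- s) (V I.2 - V I.1) <=
      \sum_(I <- s') `|g I.2 - g I.1| + e *+ size s].
Proof.
move=> e0; elim: s => [_ _|[x y] s IH /= /andP[/and3P[ax xy yb] sab] /andP[ys os]].
  by exists [::]; split => //; rewrite !big_nil addr0.
have [s' [H1 H2 H3 H4 H5]] := IH sab os.
have : (TV x y g - e%:E < TV x y g)%E.
  by rewrite lteBlDr// lteDl ?lte_fin// TV_fin.
move=> /ereal_sup_gt[_ [_ [l xyl <-] <-]] le.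
have [l1 l2 l3] := pieces_partition xyl.1.
have ly : last x l = y by case: xyl => _ /eqP.
exists (zip (x :: l) l ++ s'); split.
- rewrite all_cat H1 andbT; apply: sub_all l1 => I /and3P[xI -> Iy].
  by rewrite (le_trans ax xI) (le_trans Iy) ?ly.
- rewrite /ordered_intervals pairwise_cat; apply/and3P; split => //.
  apply/allrelP => I J Il Js; have /and3P[_ _ Iy] := allP l1 _ Il.
  rewrite (le_trans Iy)// ly; exact: (allP (H3 _ ys)).
- move=> c /andP[cx cs]; rewrite all_cat H3// andbT.
  by apply: sub_all l1 => I /and3P[xI _ _]; rewrite (le_trans cx).
- by rewrite big_cat big_cons/= H4 l3 ly.
- rewrite big_cat big_cons/= mulrS addrACA lerD// (_ : _ - _ <= _)//.
  by rewrite -(variation_pieces _ xyl) -lee_fin V_TV// EFinD -leeBlDr// ltW.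
Qed.

Lemma ac_variation_function : ac a b V.
Proof.
move=> e e0; have e20 : 0 < e / 2 by rewrite divr_gt0.
have [d d0 H] := ag e20; exists d => // s sab os sd.
pose k := size s; have k0 : 0 < (k.+1%:R : R) by [].
have [s' [H1 H2 H3 H4 H5]] := refine (divr_gt0 e20 k0) sab os.
have -> : \sum_(I <- s) `|V I.2 - V I.1| = \sum_(I <- s) (V I.2 - V I.1).
  rewrite big_seq [RHS]big_seq; apply: eq_bigr => I Is.
  have /and3P[aI II Ib] := allP sab _ Is.
  by rewrite ger0_norm// (le_trans _ (variation_function_le aI II Ib)).
apply: (le_lt_trans H5); rewrite [ltRHS]splitr ltr_leD ?H ?H4//.
by rewrite -[_ *+ size s]mulr_natr mulrAC ler_pdivrMr// ler_wpM2l ?(ltW e20)// ler_nat leqnSn.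
Qed.

End VariationFunction.
End TotalVariation.

(** * Densities of absolutely continuous functions *)

Section DensityMonotone.
Variable R : realType.
Implicit Types (s : seq (R * R)).
Local Notation mu := (@lebesgue_measure R).

(** Covers of a null set may overlap, whereas absolute continuity speaks of ordered families; this
    is the insertion step that removes overlaps. The fourth clause keeps the result ordered in the
    induction. *)
Lemma insert_interval s (I : R * R) : I.1 <= I.2 ->
    all (fun I => I.1 <= I.2) s -> ordered_intervals s ->
  exists s', [/\ all (fun I => I.1 <= I.2) s', ordered_intervals s',
    \sum_(J <- s') (J.2 - J.1) <= I.2 - I.1 + \sum_(J <- s) (J.2 - J.1),
    forall c, c <= I.1 -> all (fun I => c <= I.1) s -> all (fun I => c <= I.1) s'
    & forall t, has (fun J => J.1 < t <= J.2) (I :: s) ->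
                has (fun J => J.1 < t <= J.2) s'].
Proof.
elim: s I => [|J s IH] I II.
  by exists [:: I]; rewrite /= II big_seq1 big_nil addr0; split => // c ->.
move=> /= /andP[JJ sle] /andP[Js os].
have [IJ|JI] := leP I.2 J.1.
  exists [:: I, J & s]; rewrite /ordered_intervals /= II JJ sle IJ Js -/(ordered_intervals s) os.
  split => //; last by move=> c -> /andP[-> ->].
  - rewrite !andbT; apply: sub_all Js => K; exact/le_trans/(le_trans IJ JJ).
  - by rewrite !big_cons.
have [{}JI'|IJ] := leP J.2 I.1.
  have [s' [H1 H2 H3 H4 H5]] := IH _ II sle os.
  exists (J :: s'); rewrite /ordered_intervals /= JJ H1 -/(ordered_intervals s') H2 (H4 _ JI'
    Js); split => //.
  - by rewrite !big_cons addrCA lerD2l.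
  - by move=> c cI /andP[-> cs]; exact: H4.
  - move=> t /or3P[tI|->//|ts]; apply/orP; right; apply: H5 => /=; first by rewrite tI.
    by rewrite ts orbT.
(* Two overlapping intervals are replaced by their hull, which is no longer than both together, and
   the hull is inserted in turn. *)
pose K := (Num.min I.1 J.1, Num.max I.2 J.2).
have KK : K.1 <= K.2 by rewrite /K/= ge_min le_max II.
have [s' [H1 H2 H3 H4 H5]] := IH _ KK sle os; exists s'; split => //.
- rewrite big_cons addrA (le_trans H3)// lerD2r /K /=.
  by rewrite minElt maxElt; case: ifP => _; case: ifP => _; lra.
- by move=> c cI /andP[cJ cs]; apply: H4 => //; rewrite /K/= le_min cI.
- move=> t /or3P[/andP[tI It]|/andP[tJ Jt]|ts]; apply: H5 => /=.
  + by rewrite gt_min le_max tI It.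
  + by rewrite gt_min le_max tJ Jt !orbT.
  + by rewrite ts orbT.
Qed.

Lemma merge_intervals s : all (fun I => I.1 <= I.2) s ->
  exists s', [/\ all (fun I => I.1 <= I.2) s', ordered_intervals s',
    \sum_(J <- s') (J.2 - J.1) <= \sum_(J <- s) (J.2 - J.1)
    & forall t, has (fun J => J.1 < t <= J.2) s ->
                has (fun J => J.1 < t <= J.2) s'].
Proof.
elim: s => [_|I s IH /= /andP[II /IH[s1 [H1 H2 H3 H4]]]]; first by exists [::].
have [s' [K1 K2 K3 K4 K5]] := insert_interval II H1 H2.
exists s'; split => //; first by rewrite big_cons (le_trans K3)// lerD2l.
by move=> t /orP[tI|ts]; apply: K5 => /=; [rewrite tI|rewrite H4 ?orbT].
Qed.

Variable G : cumulative R R.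
Hypothesis acG : forall e : R, 0 < e -> exists2 d : R, 0 < d &
  forall s, all (fun I => I.1 <= I.2) s -> ordered_intervals s ->
    \sum_(I <- s) (I.2 - I.1) < d -> \sum_(I <- s) (G I.2 - G I.1) < e.
Local Notation nu := (lebesgue_stieltjes_measure G).

Let nu_itv (x y : R) : x <= y -> nu `]x, y] = (G y - G x)%:E.
Proof.
move=> xy; rewrite /lebesgue_stieltjes_measure /measure_extension.
rewrite measurable_mu_extE/=; last exact: is_ocitv.
rewrite wlength_itv/= lte_fin; case: ltP => // yx.
by rewrite (le_anti (introT andP (conj xy yx))) subrr.
Qed.

Let covered s : set (measurableTypeR R) :=
  [set t : R | has (fun J : R * R => J.1 < t <= J.2) s].

Let nu_covered s : all (fun I => I.1 <= I.2) s ->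
  (nu (covered s) <= (\sum_(I <- s) (G I.2 - G I.1))%:E)%E /\ measurable (covered s).
Proof.
elim: s => [_|I s IH /= /andP[II sle]].
  have -> : covered [::] = set0 by apply/seteqP; split.
  by rewrite big_nil measure0; split.
have [H1 H2] := IH sle.
have -> : covered (I :: s) = `]I.1, I.2] `|` covered s.
  by apply/seteqP; split=> t; rewrite /covered /= in_itv/= => /orP.
have mI : measurable (`]I.1, I.2] : set (measurableTypeR R)) by exact: measurable_itv.
split; last exact: measurableU.
rewrite big_cons EFinD; apply: (le_trans (measureU2 _ mI H2)).
by apply: leeD => //; rewrite -nu_itv.
Qed.

(** A Lebesgue-null set lies in countably many half-open intervals of total length below [d]. Each
    finite part, merged into an ordered family, has Stieltjes measure below [e], and continuity from
    below extends this to the whole cover. *)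
Lemma stieltjes_dominated (E : set (measurableTypeR R)) : measurable E ->
  mu E = 0%E -> nu E = 0%E.
Proof.
move=> mE muE; apply/eqP; rewrite -measure_le0; apply/lee_addgt0Pr => e e0.
rewrite add0e; have [d d0 H] := acG e0.
have /ereal_inf_lt[z [/= F [mF EF] Fz zd]] : (mu E < d%:E)%E by rewrite muE lte_fin.
have /choice[p pF] : forall k, exists p : R * R, p.1 <= p.2 /\ F k = `]p.1, p.2]%classic.
  move=> k; have /ocitvP[->|[x /ltW x12 ->]] := mF k; last by exists x.
  by exists (0, 0) => /=; split => //; rewrite set_itvoc0.
pose U n := covered (map p (iota 0 n)).
have le n : all (fun I => I.1 <= I.2) (map p (iota 0 n)).
  by apply/allP => _ /mapP[k _ ->]; case: (pF k).
have mU n : measurable (U n) by have [] := nu_covered (le n).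
have UE : \bigcup_n U n = \bigcup_k F k.
  apply/seteqP; split => t [k _].
    rewrite /U /covered /= => /hasP[_ /mapP[j _ ->]] tj; exists j => //.
    by rewrite (pF j).2 /= in_itv.
  rewrite (pF k).2 /= in_itv/= => tk; exists k.+1 => //; apply/hasP.
  by exists (p k) => //; apply: map_f; rewrite mem_iota /= add0n.
have Ue n : (nu (U n) <= e%:E)%E.
  have [s' [H1 H2 H3 H4]] := merge_intervals (le n).
  have [N1 N2] := nu_covered H1.
  apply: (@le_trans _ _ (nu (covered s'))).
    by apply: le_measure; rewrite ?inE// => t; exact: H4.
  apply: (le_trans N1); rewrite lee_fin ltW// H//.
  apply: (le_lt_trans H3); rewrite -lte_fin.
  apply: le_lt_trans zd; rewrite -Fz.
  apply: le_trans (nneseries_lim_ge n _) => /=; last by move=> k _ _; exact: wlength_ge0.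
  rewrite big_map -sumEFin -[X in iota 0 X]subn0 -/(index_iota 0 n) lee_sum// => k _.
  have [pk ->] := pF k; rewrite wlength_itv/= lte_fin; case: ltP => // kp.
  by rewrite (le_anti (introT andP (conj pk kp))) subrr.
apply: (@le_trans _ _ (nu (\bigcup_n U n))).
  by apply: le_measure; rewrite ?inE//; [exact: bigcup_measurable|rewrite UE].
have cvgU : (nu \o U) x @[x --> \oo] --> nu (\bigcup_n U n).
  apply: nondecreasing_cvg_mu => //; first exact: bigcup_measurable.
  move=> m n mn; apply/subsetPset => t; rewrite /U /covered /= => /hasP[I Im It].
  apply/hasP; exists I => //; move: Im => /mapP[k]; rewrite mem_iota => /andP[_ km] ->.
  by rewrite map_f// mem_iota /= add0n (leq_trans km).
by apply: cvge_to_le cvgU _; apply: nearW => n; exact: Ue.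
Qed.

Lemma stieltjes_density (a b : R) : a <= b ->
  exists2 phi : R -> R, mu.-integrable setT (EFin \o phi) &
    forall x y, a <= x -> x <= y -> y <= b ->
      (G y - G x)%:E = (\int[mu]_(t in `]x, y]) (phi t)%:E)%E.
Proof.
move=> ab.
have mab : measurable (`]a, b] : set (measurableTypeR R)) by exact: measurable_itv.
have nuab : (nu `]a, b]%classic < +oo)%E by rewrite nu_itv// ltry.
(* Radon-Nikodym is applied to the restriction to []a, b]], which has finite mass. *)
have dom : mfrestr mab nuab `<< mu.
  apply/null_content_dominatesP => E mE muE; rewrite /mfrestr /mrestr.
  apply/eqP; rewrite -measure_le0 -(stieltjes_dominated mE muE).
  by apply: le_measure; rewrite ?inE//; exact: measurableI.
have [h [h0 hfin hint hE]] := radon_nikodym_sigma_finite dom.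
have hfine : EFin \o (fine \o h) = h by apply/funext => t /=; rewrite fineK.
exists (fine \o h); first by rewrite hfine.
move=> x y ax xy yb.
have mxy : measurable (`]x, y] : set (measurableTypeR R)) by exact: measurable_itv.
under eq_integral do rewrite -[(_ _)%:E]/((EFin \o (fine \o h)) _) hfine.
transitivity (mfrestr mab nuab `]x, y]); last exact: hE.
rewrite /mfrestr /mrestr setIidl ?nu_itv//.
move=> t /=; rewrite !in_itv/= => /andP[xt ty].
by rewrite (le_lt_trans ax xt) (le_trans ty yb).
Qed.

End DensityMonotone.

Section Density.
Variable R : realType.
Implicit Types (a b : R) (g : R -> R).
Local Notation mu := (@lebesgue_measure R).

Lemma nondecreasing_ac_density a b g : a <= b -> ac a b g ->
    (forall x y, a <= x -> x <= y -> y <= b -> g x <= g y) ->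
  exists2 phi : R -> R, mu.-integrable setT (EFin \o phi) &
    forall x y, a <= x -> x <= y -> y <= b ->
      (g y - g x)%:E = (\int[mu]_(t in `]x, y]) (phi t)%:E)%E.
Proof.
move=> ab ag gnd.
(* Clamping to [[a, b]] extends [g] by constants to a cumulative function on the line; it shortens
   intervals, so absolute continuity is preserved. *)
pose cl (x : R) := Num.max a (Num.min b x).
have cla x : a <= cl x by rewrite /cl le_max lexx.
have clb x : cl x <= b by rewrite /cl ge_max ab ge_min lexx.
have cl_nd x y : x <= y -> cl x <= cl y.
  move=> xy; rewrite /cl ge_max le_max lexx /= le_max; apply/orP; right.
  by rewrite le_min !ge_min lexx xy orbT.
have cl_id x : a <= x -> x <= b -> cl x = x.
  by move=> ax xb; rewrite /cl (min_idPr xb) (max_idPr ax).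
have cl_len x y : x <= y -> cl y - cl x <= y - x.
  rewrite /cl => xy; case: (leP b y) => by_; case: (leP b x) => bx;
    rewrite ?(max_idPr ab); try case: (leP a x) => ax; try case: (leP a y) => ay; lra.
have cl_dist x y : `|cl x - cl y| <= `|x - y|.
  wlog xy : x y / x <= y.
    by move=> W; have [/W//|/ltW/W] := leP x y; rewrite distrC (distrC x).
  by rewrite distrC (distrC x) !ger0_norm ?subr_ge0 ?cl_nd ?cl_len.
pose G x := g (cl x).
have Gnd : {homo G : x y / x <= y} by move=> x y xy; apply: gnd => //; exact: cl_nd.
have cG : continuous G.
  move=> x; apply/cvgrPdist_lt => e e0.
  have [d d0 H] := ac_unif_continuous ag e0.
  near=> y; apply: H; rewrite ?cla ?clb//.
  apply: le_lt_trans (cl_dist _ _) _.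
  by near: y; exact: cvgr_dist_lt.
pose Gc : cumulative R R := HB.pack G
  (isCumulative.Build R _ R G Gnd (right_continuousW cG)).
have acG : forall e : R, 0 < e -> exists2 d : R, 0 < d &
  forall s : seq (R * R), all (fun I => I.1 <= I.2) s -> ordered_intervals s ->
    \sum_(I <- s) (I.2 - I.1) < d -> \sum_(I <- s) (Gc I.2 - Gc I.1) < e.
  move=> e e0; have [d d0 H] := ag _ e0; exists d => // s sle os sd.
  have := H (map (fun I => (cl I.1, cl I.2)) s).
  rewrite all_map /ordered_intervals pairwise_map !big_map /= => H'.
  apply: (le_lt_trans _ (H' _ _ _)).
  - by apply: ler_sum => I _; exact: ler_norm.
  - by apply: sub_all sle => I /= II; rewrite cla clb cl_nd.
  - by apply: sub_pairwise os => I J /=; exact: cl_nd.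
  - apply: le_lt_trans sd; rewrite big_seq [leRHS]big_seq; apply: ler_sum => I Is.
    by apply: cl_len; exact: (allP sle).
have [phi intphi H] := stieltjes_density acG ab.
exists phi => // x y ax xy yb; rewrite -H//= /G !cl_id//.
- exact: le_trans xy yb.
- exact: le_trans ax xy.
Unshelve. all: by end_near. Qed.

(** Jordan decomposition: [g] is the difference of the nondecreasing absolutely continuous functions
    [V] and [V - g]. *)
Lemma ac_density a b g : a <= b -> ac a b g ->
  exists2 phi : R -> R, mu.-integrable setT (EFin \o phi) &
    forall x y, a <= x -> x <= y -> y <= b ->
      (g y - g x)%:E = (\int[mu]_(t in `]x, y]) (phi t)%:E)%E.
Proof.
move=> ab ag; pose V x := fine (total_variation a x g).
have aV : ac a b V by exact: ac_variation_function.
have Vle x y : a <= x -> x <= y -> y <= b -> `|g y - g x| <= V y - V x.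
  exact: variation_function_le.
have [p1 i1 H1] := nondecreasing_ac_density ab aV (fun x y ax xy yb =>
   ltac:(by rewrite -subr_ge0 (le_trans _ (Vle _ _ ax xy yb)))).
have aVg : ac a b (fun t => V t + - g t) by apply: acD => //; exact: acN.
have [p2 i2 H2] := nondecreasing_ac_density ab aVg (fun x y ax xy yb =>
   ltac:(by have := le_trans (ler_norm _) (Vle _ _ ax xy yb); lra)).
exists (fun t => p1 t - p2 t).
  exact: (integrableB measurableT i1 i2).
move=> x y ax xy yb.
have mxy : measurable (`]x, y] : set (measurableTypeR R)) by exact: measurable_itv.
under eq_integral do rewrite EFinB.
rewrite integralB//.
- by rewrite -H1// -H2// -EFinB; congr EFin; lra.
- exact: (integrableS measurableT).
- exact: (integrableS measurableT).
Qed.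

(** Near a point of the open interval [g] agrees with [g a] plus the indefinite integral of [phi],
    which is differentiable almost everywhere with derivative [phi]. *)
Lemma ac_derivable_ae a b g phi : a <= b -> mu.-integrable setT (EFin \o phi) ->
    (forall x y, a <= x -> x <= y -> y <= b ->
      (g y - g x)%:E = (\int[mu]_(t in `]x, y]) (phi t)%:E)%E) ->
  {ae mu, forall t, a < t < b -> is_derive t (1 : R) g (phi t)}.
Proof.
move=> ab iphi H.
have locphi : locally_integrable setT phi.
  by apply: open_integrable_locally => //; exact: openT.
have intphi y : mu.-integrable [set` Interval (BRight a) (BRight y)] (EFin \o phi).
  by apply: integrableS iphi => //; exact: measurable_itv.
have := FTC1 intphi locphi.
apply: filterS; first exact: (ae_filter_ringOfSetsType mu).
move=> t H1 /andP[at_ tb].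
have [D1 D2] := H1 at_.
have gE x : a <= x -> x <= b ->
    g x = g a + (\int[mu]_(t in `]a, x]) phi t)%R.
  move=> ax xb; rewrite /Rintegral -(H _ _ (lexx a) ax xb)/=; lra.
apply: (@near_eq_is_derive _ _ _ (cst (g a) + (fun x => (\int[mu]_(t in `]a, x]) phi t)%R))).
  near=> x; suff -> : g x = g a + (\int[mu]_(t in `]a, x]) phi t)%R by [].
  apply: gE.
    by apply: ltW; near: x; exact: lt_nbhsr.
  by apply: ltW; near: x; exact: lt_nbhsl.
rewrite -[phi t]add0r; apply: is_deriveD.
by split; [exact: D1|rewrite -derive1E; exact: D2].
Unshelve. all: by end_near. Qed.

End Density.

(** * Integrals of nonnegative functions not known to be measurable *)

Section LowerIntegral.
Local Open Scope ereal_scope.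
Variables (d : measure_display) (T : measurableType d) (R : realType).
Variable mu : {measure set T -> \bar R}.
Implicit Types (D : set T) (f g : T -> \bar R).

(* The library version asks for measurability, which the integrand of the
   condition length only has almost everywhere. *)
Lemma ge0_integral_mono D E f g : D `<=` E -> (forall x, D x -> 0 <= f x) ->
    (forall x, E x -> 0 <= g x) -> (forall x, D x -> f x <= g x) ->
  \int[mu]_(x in D) f x <= \int[mu]_(x in E) g x.
Proof.
move=> DE f0 g0 fg; rewrite !ge0_integralE//; apply: ge_ereal_sup.
move=> _ [h hf <-]; apply: ereal_sup_ubound; exists h => // x; apply: (le_trans (hf x)).
rewrite /patch; case: ifPn => [|_].
  by rewrite inE => Dx; rewrite mem_set ?fg//; exact: DE.
by case: ifPn => //; rewrite inE => /g0.
Qed.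

Import HBNNSimple.

Lemma lt_integral_approx D f (c : R) : (forall x, D x -> 0 <= f x) ->
    c%:E < \int[mu]_(x in D) f x ->
  exists h : {nnsfun T >-> R}, (forall x, (h x)%:E <= (f \_ D) x) /\
    c%:E < \int[mu]_x (h x)%:E.
Proof.
move=> f0; rewrite ge0_integralE// => /ereal_sup_gt[_ [h hf <-] ch].
by exists h; rewrite integralT_nnsfun.
Qed.

(** Here [f] may be nonmeasurable: the strict bounds give simple functions below [f] on each of two
    disjoint sets, and their sum is below [f] on [D]. *)
Lemma lt_integral_setU D1 D2 D f (c1 c2 : R) : D1 `<=` D -> D2 `<=` D ->
    D1 `&` D2 = set0 -> (forall x, D x -> 0 <= f x) ->
    c1%:E < \int[mu]_(x in D1) f x -> c2%:E < \int[mu]_(x in D2) f x ->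
  (c1 + c2)%:E < \int[mu]_(x in D) f x.
Proof.
move=> D1D D2D D12 f0.
move=> /lt_integral_approx[x /D1D/f0//|h1 [h1f ch1]].
move=> /lt_integral_approx[x /D2D/f0//|h2 [h2f ch2]].
rewrite EFinD; apply: (lt_le_trans (lteD ch1 ch2)).
rewrite -ge0_integralD//; first last.
- exact/measurable_EFinP.
- by move=> x _; rewrite lee_fin.
- exact/measurable_EFinP.
- by move=> x _; rewrite lee_fin.
rewrite [leRHS]integral_mkcond; apply: ge0_integral_mono => //.
- by move=> x _; rewrite adde_ge0 ?lee_fin.
- by move=> x _; rewrite /patch; case: ifPn => //; rewrite inE => /f0.
- move=> x _; move: (h1f x) (h2f x); rewrite /patch.
  have [|] := boolP (x \in D1); have [|] := boolP (x \in D2); rewrite ?inE.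
  + by move=> x2 x1; have : (D1 `&` D2) x by []; rewrite D12.
  + move=> _ x1; rewrite mem_set; last exact: D1D.
    move=> h1f' h20; rewrite -[leRHS]adde0; exact: leeD.
  + move=> x2 _; rewrite mem_set; last exact: D2D.
    move=> h10 h2f'; rewrite -[leRHS]add0e; exact: leeD.
  + move=> _ _ h10 h20; apply: (@le_trans _ _ (0 + 0)); first exact: leeD.
    by rewrite adde0; case: ifPn => //; rewrite inE => /f0.
Qed.

End LowerIntegral.

Section FTC.
Variable R : realType.
Local Notation mu := (@lebesgue_measure R).

Lemma lebesgue_null_setU1 (N : set (measurableTypeR R)) (b : R) :
  measurable N -> mu N = 0%E -> measurable (N `|` [set b]) /\ mu (N `|` [set b]) = 0%E.
Proof.
move=> mN muN.
have mb : measurable ([set b] : set (measurableTypeR R)) by exact: measurable_set1.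
split; first exact: measurableU.
apply/eqP; rewrite -measure_le0; apply: (le_trans (measureU2 _ mN mb)).
by rewrite [X in (X + _)%E]muN [X in (_ + X)%E]lebesgue_measure_set1 adde0.
Qed.

(** The derivatives of the [g i] agree almost everywhere with integrable densities, so [G] has an
    integrable majorant off a null set. *)
Lemma ac_integral_lty (a b : R) (I : finType) (g : I -> R -> R) (K : R)
    (G : R -> \bar R) : a <= b -> 0 <= K -> (forall i, ac a b (g i)) ->
    (forall t, a <= t <= b -> (0 <= G t)%E) ->
    (forall t (d : I -> R), a < t < b -> (forall i, is_derive t (1 : R) (g i) (d i)) ->
      (G t <= (K * \sum_i `|d i|)%:E)%E) ->
  (\int[mu]_(t in `[a, b]) G t < +oo)%E.
Proof.
move=> ab K0 ag G0 gG.
have /choice[phi /all_and2[iphi dphi]] : forall i, exists phi : R -> R,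
    mu.-integrable setT (EFin \o phi) /\
    {ae mu, forall t, a < t < b -> is_derive t (1 : R) (g i) (phi t)}.
  move=> i; have [phi iphi H] := ac_density ab (ag i).
  by exists phi; split => //; exact: (ac_derivable_ae ab iphi H).
have [N [mN muN HN]] : {ae mu, forall t, a < t < b -> forall i,
    is_derive t (1 : R) (g i) (phi i t)}.
  have : {ae mu, forall t, forall i, a < t < b -> is_derive t (1 : R) (g i) (phi i t)}.
    by apply: filter_forall; exact: dphi.
  apply: filterS; first exact: (ae_filter_ringOfSetsType mu).
  by move=> t H tab i; exact: H.
have mab : measurable (`[a, b] : set (measurableTypeR R)) by exact: measurable_itv.
have [mN1 muN1] := lebesgue_null_setU1 a mN muN.
have [] := lebesgue_null_setU1 b mN1 muN1; set M := _ `|` _ => mM muM.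
have mphi i : measurable_fun (setT : set (measurableTypeR R)) (phi i).
  by apply/measurable_EFinP; exact: measurable_int (iphi i).
pose P t := ((K * \sum_i `|phi i t|)%:E)%E.
have mP : measurable_fun (setT : set (measurableTypeR R)) P.
  apply/measurable_EFinP; apply: measurable_funM => //; apply: measurable_sum => i.
  exact: measurableT_comp.
have P0 t : (0 <= P t)%E by rewrite lee_fin mulr_ge0// sumr_ge0.
(* Nothing bounds [G] on the null set [M], so the majorant is [+oo] there; it stays measurable and
   has the same integral as [P]. *)
pose Q t := (P t + +oo * (\1_M t)%:E)%E.
have mQ : measurable_fun (setT : set (measurableTypeR R)) Q.
  apply: emeasurable_funD => //; apply: emeasurable_funM => //.
  by apply/measurable_EFinP; exact: measurable_indic.
have Q0 t : (0 <= Q t)%E by rewrite adde_ge0// mule_ge0// lee_fin.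
apply: (@le_lt_trans _ _ (\int[mu]_(t in `[a, b]) Q t)%E).
  apply: ge0_integral_mono => //.
  move=> t /=; rewrite in_itv/= => /andP[at_ tb]; rewrite /Q indicE.
  have [_|] := boolP (t \in M); first by rewrite mule1 addey ?leey// gt_eqF// (lt_le_trans _
    (P0 t)) ?ltNyr.
  rewrite notin_setE mule0 adde0 => /not_orP[/not_orP[Nt /eqP ta] /eqP tb'].
  have tab : a < t < b by rewrite !lt_neqAle eq_sym ta at_ tb' tb.
  apply: gG => // i; apply: contra_notP Nt => D; apply: HN => /= D'; apply: D; exact: D'.
rewrite (_ : (\int[mu]_(t in `[a, b]) Q t = \int[mu]_(t in `[a, b]) P t)%E); last first.
  apply: ge0_ae_eq_integral => //; [exact: measurable_funS mQ|exact: measurable_funS mP|].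
  exists M; split => // t /=; apply: contra_notP => Mt _.
  by rewrite /Q indicE memNset// mule0 adde0.
have iP : mu.-integrable `[a, b] (fun t => K%:E * \sum_(i <- index_enum I) `|(phi i t)%:E|)%E.
  apply: integrableZl => //; apply: integrable_sum => // i _.
  by apply: integrable_abse; exact: integrableS (iphi i).
have /integrableP[_] := iP; apply: le_lt_trans.
apply: ge0_integral_mono => // t _; rewrite /P EFinM -sumEFin lee_abs//.
Qed.

End FTC.

(** * Local norms in coordinates *)

Section ComplexModulus.
Variable R : realType.
Local Notation C := R[i].
Implicit Types (z w : C).
Local Open Scope complex_scope.

Lemma modcE z : modc z = Num.sqrt (complex.Re z ^+ 2 + complex.Im z ^+ 2).
Proof. by case: z. Qed.

Lemma modc_ge0 z : 0 <= modc z. Proof. by rewrite modcE sqrtr_ge0. Qed.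

Lemma sqr_modc z : modc z ^+ 2 = complex.Re z ^+ 2 + complex.Im z ^+ 2.
Proof. by rewrite modcE sqr_sqrtr// addr_ge0 ?sqr_ge0. Qed.

Lemma modc0 : modc (0 : C) = 0. Proof. exact: Normc.normc0. Qed.

Lemma modc1 : modc (1 : C) = 1. Proof. exact: Normc.normc1. Qed.

Lemma modcM z w : modc (z * w) = modc z * modc w. Proof. exact: Normc.normcM. Qed.

Lemma modcV z : modc z^-1 = (modc z)^-1. Proof. exact: Normc.normcV. Qed.

Lemma modcD z w : modc (z + w) <= modc z + modc w. Proof. exact: le_normcD. Qed.

Lemma modcN z : modc (- z) = modc z. Proof. exact: normcN. Qed.

Lemma modcB z w : modc (z - w) <= modc z + modc w.
Proof. by rewrite (le_trans (modcD _ _))// modcN. Qed.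

Lemma modc_real (x : R) : modc x%:C = `|x|.
Proof. by rewrite modcE /= expr0n/= addr0 sqrtr_sqr. Qed.

Lemma modc_eq0 z : (modc z == 0) = (z == 0).
Proof.
by apply/eqP/eqP => [|->]; [exact: Normc.eq0_normc|exact: modc0].
Qed.

Lemma modc_sum (I : Type) (r : seq I) (P : pred I) (F : I -> C) :
  modc (\sum_(i <- r | P i) F i) <= \sum_(i <- r | P i) modc (F i).
Proof.
elim/big_rec2: _ => [|i x z _ IH]; first by rewrite modc0.
by rewrite (le_trans (modcD _ _))// lerD2l.
Qed.

Lemma modc_conj z : modc (conjc z) = modc z.
Proof. by case: z => a b; rewrite !modcE /= sqrrN. Qed.

Lemma Re_le_modc z : `|complex.Re z| <= modc z.
Proof.
rewrite -(@ler_pXn2r _ 2) ?nnegrE ?modc_ge0// sqr_modc real_normK ?num_real//.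
by rewrite lerDl sqr_ge0.
Qed.

Lemma Im_le_modc z : `|complex.Im z| <= modc z.
Proof.
rewrite -(@ler_pXn2r _ 2) ?nnegrE ?modc_ge0// sqr_modc real_normK ?num_real//.
by rewrite lerDr sqr_ge0.
Qed.

Lemma modc_le_ReIm z : modc z <= `|complex.Re z| + `|complex.Im z|.
Proof.
rewrite -(@ler_pXn2r _ 2) ?nnegrE ?modc_ge0 ?addr_ge0// sqr_modc sqrrD.
by rewrite !real_normK ?num_real// addrAC lerDl mulrn_wge0// mulr_ge0.
Qed.

(** Taking the conjugate of [z] for [w] gives [modc z ^+ 2 <= modc z * B]. *)
Lemma modc_le_Re z B : (forall w, complex.Re (w * z) <= modc w * B) -> modc z <= B.
Proof.
move=> H; have [z0|z0] := eqVneq z 0.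
  by have := H 1; rewrite z0 mulr0 modc0 modc1 mul1r.
have zp : 0 < modc z by rewrite lt_def modc_eq0 z0 modc_ge0.
rewrite -(ler_pM2l zp) -expr2 sqr_modc -{1}(modc_conj z); apply: le_trans (H _).
by case: z {H z0 zp} => a b /=; rewrite mulNr opprK -!expr2.
Qed.

Lemma cexpD z w : cexp (z + w) = cexp z * cexp w.
Proof.
case: z => a b; case: w => c e; rewrite /cexp /= expRD cosD sinD.
by apply/eqP; rewrite eq_complex /=; apply/andP; split; apply/eqP; ring.
Qed.

Lemma cexp0 : cexp (0 : C) = 1.
Proof. by rewrite /cexp /= expR0 cos0 sin0 mulr1 mulr0. Qed.

Lemma modc_cexp z : modc (cexp z) = expR (complex.Re z).
Proof.
rewrite modcE /cexp /= !exprMn -mulrDr cos2Dsin2 mulr1 sqrtr_sqr.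
by rewrite ger0_norm// expR_ge0.
Qed.

Lemma cexp_neq0 z : cexp z != 0.
Proof. by rewrite -modc_eq0 modc_cexp gt_eqF// expR_gt0. Qed.

Lemma cexpN z : cexp (- z) = (cexp z)^-1.
Proof.
by apply: (mulfI (cexp_neq0 z)); rewrite -cexpD subrr cexp0 mulfV ?cexp_neq0.
Qed.

Lemma le_of_derive_le (f f' g g' : R -> R) :
    (forall t, is_derive t (1 : R) f (f' t)) -> (forall t, is_derive t (1 : R) g (g' t)) ->
    f 0 <= g 0 -> (forall t, 0 <= t -> f' t <= g' t) ->
  forall t, 0 <= t -> f t <= g t.
Proof.
move=> df dg fg0 le t t0.
pose h := g - f; pose h' t := g' t - f' t.
have dh s : is_derive s (1 : R) h (h' s) by exact: is_deriveB.
rewrite -subr_ge0; apply: (@le_trans _ _ (h 0)); first by rewrite /h /= subr_ge0.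
have [->|tn0] := eqVneq t 0; first by [].
have t00 : 0 < t by rewrite lt_def tn0.
have [c c0t] : exists2 c, c \in `]0, t[%R & h t - h 0 = h' c * (t - 0).
  apply: MVT => //; apply: continuous_subspaceT => x; apply: differentiable_continuous.
  by apply/derivable1_diffP; case: (dh x).
rewrite subr0 => E; rewrite -[leRHS]/(h t) -subr_ge0 E mulr_ge0// /h' subr_ge0.
by apply: le; move: c0t; rewrite in_itv/= => /andP[/ltW].
Qed.

Lemma is_derive_expsum (c : nat -> R) m t :
  is_derive t (1 : R) (fun t => \sum_(j < m.+1) c j * t ^+ j / j`!%:R)
    (\sum_(j < m) c j.+1 * t ^+ j / j`!%:R).
Proof.
have D j : is_derive t (1 : R) (fun t => c j * t ^+ j / j`!%:R)
   (c j * (t ^+ j.-1 *+ j) / j`!%:R).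
  rewrite [X in is_derive _ _ X _](_ : _ = (c j / j`!%:R) *: (id ^+ j : R -> R)); last first.
    by apply/funext => s; rewrite [RHS]/(_ * (id ^+ j : R -> R) s) exprfctE mulrAC.
  apply: is_derive_eq; rewrite /GRing.scale /= mulr1 mulr_natl; ring.
rewrite [X in is_derive _ _ X _](_ : _ = \sum_(j < m.+1) (fun t => c j * t ^+ j / j`!%:R));
  last first.
  by apply/funext => s; rewrite fct_sumE.
apply: (is_derive_eq (is_derive_sum (fun j : 'I_m.+1 => D j))).
rewrite big_ord_recl /= mulr0n mulr0 mul0r add0r; apply: eq_bigr => j _.
rewrite /bump /= add1n /= factS natrM -[_ *+ j.+1]mulr_natr.
by rewrite add0n invfM !mulrA mulfK// pnatr_eq0.
Qed.

Lemma is_derive_Re_cexp w z t :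
  is_derive t (1 : R) (fun t : R => complex.Re (w * cexp (t%:C * z)))
    (complex.Re (w * z * cexp (t%:C * z))).
Proof.
case: w => w1 w2; case: z => a b.
rewrite [X in is_derive _ _ X _](_ : _ = (expR \o (a *: (id : R -> R))) *
  (w1 *: (cos \o (b *: (id : R -> R))) - w2 *: (sin \o (b *: (id : R -> R))))); last first.
  apply/funext => s; rewrite /cexp /= !mul0r subr0 addr0.
  rewrite -[RHS]/(expR (a * s) * (w1 * cos (b * s) - w2 * sin (b * s))).
  by rewrite ![s * _]mulrC /=; ring.
apply: is_derive_eq; rewrite /cexp /= /GRing.scale /= !mul0r subr0 addr0.
transitivity (expR (a * t) * (w1 * (- sin (b * t) * (b * 1)) -
  w2 * (cos (b * t) * (b * 1))) +
  (w1 * cos (b * t) - w2 * sin (b * t)) * (expR (a * t) * (a * 1))); first by [].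
by rewrite ![t * _]mulrC; ring.
Qed.

Definition exp_trunc (K : unitRingType) m (z : K) : K := \sum_(j < m) z ^+ j / j`!%:R.

(** Testing against all [w] reduces the claim to real functions of [t] along the ray [t z].
    Differentiation lowers the order of truncation by one and replaces [w] by [w * z], so induction
    on [m] and the mean value theorem apply. *)
Lemma cexp_taylor m z :
  modc (cexp z - exp_trunc m z) <= expR (modc z) - exp_trunc m (modc z).
Proof.
suff H w t : 0 <= t -> complex.Re (w * (cexp (t%:C * z) - exp_trunc m (t%:C * z)))
    <= modc w * (expR (t * modc z) - exp_trunc m (t * modc z)).
  by apply: modc_le_Re => w; have := H w 1 ler01; rewrite !mul1r.
have Re_trunc k v s : complex.Re (v * exp_trunc k (s%:C * z)) =
    \sum_(j < k) complex.Re (v * z ^+ j) * s ^+ j / j`!%:R.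
  rewrite /exp_trunc mulr_sumr raddf_sum /=; apply: eq_bigr => j _.
  rewrite -(rmorph_nat (real_complex R)) -fmorphV exprMn -rmorphXn /=.
  by case: v => v1 v2; case: (z ^+ j) => a b /=; ring.
elim: m w t => [|m IH] w t t0.
  rewrite /exp_trunc !big_ord0 !subr0; apply: (le_trans (ler_norm _)).
  apply: (le_trans (Re_le_modc _)); rewrite modcM ler_wpM2l ?modc_ge0// modc_cexp.
  rewrite ler_expR (le_trans (ler_norm _))// (le_trans (Re_le_modc _))// modcM modc_real.
  by rewrite ger0_norm.
move: t t0.
apply: (@le_of_derive_le _ (fun t => complex.Re (w * z * (cexp (t%:C * z) - exp_trunc m (t%:C *
  z))))
   _ (fun t => modc (w * z) * (expR (t * modc z) - exp_trunc m (t * modc z)))).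
- move=> t.
  rewrite [X in is_derive _ _ X _](_ : _ = (fun t : R => complex.Re (w * cexp (t%:C * z))) -
    (fun t => \sum_(j < m.+1) complex.Re (w * z ^+ j) * t ^+ j / j`!%:R)); last first.
    by apply/funext => s; rewrite mulrBr raddfB /= Re_trunc.
  rewrite mulrBr raddfB /= Re_trunc; apply: is_deriveB.
    exact: is_derive_Re_cexp.
  have := is_derive_expsum (fun j => complex.Re (w * z ^+ j)) m t.
  by under eq_bigr do rewrite exprS mulrA.
- move=> t.
  rewrite [X in is_derive _ _ X _](_ : _ = modc w *: ((expR \o (modc z *: (id : R -> R))) -
    (fun t => \sum_(j < m.+1) modc z ^+ j * t ^+ j / j`!%:R))); last first.
    apply/funext => s; rewrite -[RHS]/(modc w * (expR (modc z * s) -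
      \sum_(j < m.+1) modc z ^+ j * s ^+ j / j`!%:R)) [s * _]mulrC.
    by congr (_ * (_ - _)); apply: eq_bigr => j _; rewrite exprMn.
  have D := is_derive_expsum (fun j => modc z ^+ j) m t.
  apply: is_derive_eq; transitivity (modc w * (expR (modc z * t) * (modc z * 1) -
    \sum_(j < m) modc z ^+ j.+1 * t ^+ j / j`!%:R)); first by [].
  rewrite modcM (mulrC t) -(mulrA (modc w)) [modc z * (_ - _)]mulrBr; congr (_ * (_ - _)).
    by rewrite mulr1; exact: mulrC.
  by rewrite mulr_sumr; apply: eq_bigr => j _; rewrite exprS exprMn !mulrA.
- have T0 (K : unitRingType) : exp_trunc m.+1 (0 : K) = 1.
    rewrite /exp_trunc big_ord_recl /= expr0 fact0 divr1 big1 ?addr0// => j _.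
    by rewrite expr0n /= mul0r.
  by rewrite !mul0r expR0 cexp0 !T0 !subrr !mulr0.
- by move=> t t0; exact: IH.
Qed.

Lemma cexp_bound1 z : modc (cexp z - 1) <= expR (modc z) - 1.
Proof. by have := cexp_taylor 1 z; rewrite /exp_trunc !big_ord1 !expr0 fact0 !divr1. Qed.

Lemma cexp_bound2 z : modc (cexp z - 1 - z) <= expR (modc z) - 1 - modc z.
Proof.
have := cexp_taylor 2 z; rewrite /exp_trunc !big_ord_recl !big_ord0 /= /bump /=.
by rewrite !expr0 !expr1 fact0 !divr1 !addr0 !opprD !addrA.
Qed.

Lemma cexp_bound4 z : modc (cexp z - 1 - z - z ^+ 2 / 2 - z ^+ 3 / 6) <=
  expR (modc z) - 1 - modc z - modc z ^+ 2 / 2 - modc z ^+ 3 / 6.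
Proof.
have := cexp_taylor 4 z; rewrite /exp_trunc !big_ord_recl !big_ord0 /= /bump /=.
by rewrite !expr0 !expr1 fact0 !divr1 !addr0 !opprD !addrA.
Qed.

End ComplexModulus.

Section EuclideanNorm.
Variables (R : realType) (I : finType).
Implicit Types (F G : I -> R).

Definition l2 F : R := Num.sqrt (\sum_i F i ^+ 2).

Lemma l2_ge0 F : 0 <= l2 F. Proof. exact: sqrtr_ge0. Qed.

Lemma sqr_l2 F : l2 F ^+ 2 = \sum_i F i ^+ 2.
Proof. by rewrite sqr_sqrtr// sumr_ge0// => i _; exact: sqr_ge0. Qed.

Lemma eq_l2 F G : F =1 G -> l2 F = l2 G.
Proof. by move=> FG; congr Num.sqrt; apply: eq_bigr => i _; rewrite FG. Qed.

Lemma l2_le F G : (forall i, `|F i| <= G i) -> l2 F <= l2 G.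
Proof.
move=> FG; rewrite ler_sqrt ?sumr_ge0// => [|i _]; last exact: sqr_ge0.
apply: ler_sum => i _; rewrite -real_normK ?num_real// ler_pXn2r// nnegrE//.
exact: le_trans (FG i).
Qed.

Lemma l2Z c F : 0 <= c -> l2 (fun i => c * F i) = c * l2 F.
Proof.
move=> c0; rewrite /l2 (eq_bigr (fun i => c ^+ 2 * F i ^+ 2)) => [|i _]; last exact: exprMn.
by rewrite -mulr_sumr sqrtrM ?sqr_ge0// sqrtr_sqr ger0_norm.
Qed.

Lemma ler_l2 F i : `|F i| <= l2 F.
Proof.
rewrite -(@ler_pXn2r _ 2) ?nnegrE ?l2_ge0// sqr_l2 real_normK ?num_real//.
by rewrite (bigD1 i)//= lerDl sumr_ge0// => j _; exact: sqr_ge0.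
Qed.

Lemma l2_0 : l2 (fun=> 0) = 0.
Proof. by rewrite /l2 big1 ?sqrtr0// => i _; rewrite expr0n. Qed.

Lemma l2_CS F G : \sum_i F i * G i <= l2 F * l2 G.
Proof.
have [F0|Fn0] := eqVneq (l2 F) 0.
  rewrite F0 mul0r big1// => i _; have := ler_l2 F i.
  by rewrite F0 normr_le0 => /eqP ->; rewrite mul0r.
have [G0|Gn0] := eqVneq (l2 G) 0.
  rewrite G0 mulr0 big1// => i _; have := ler_l2 G i.
  by rewrite G0 normr_le0 => /eqP ->; rewrite mulr0.
have f0 : 0 < l2 F by rewrite lt_def Fn0 l2_ge0.
have g0 : 0 < l2 G by rewrite lt_def Gn0 l2_ge0.
(* Arithmetic-geometric inequality term by term, weighted so that each of the two sums equals half
   of [l2 F * l2 G]. *)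
suff : \sum_i F i * G i <= \sum_i (l2 G / l2 F / 2 * F i ^+ 2 + l2 F / l2 G / 2 * G i ^+ 2).
  rewrite big_split /= -!mulr_sumr -!sqr_l2 => /le_trans; apply.
  by rewrite le_eqVlt; apply/orP; left; apply/eqP; field; rewrite Fn0 Gn0.
apply: ler_sum => i _; rewrite -subr_ge0.
have -> : l2 G / l2 F / 2 * F i ^+ 2 + l2 F / l2 G / 2 * G i ^+ 2 - F i * G i =
  (l2 G * F i - l2 F * G i) ^+ 2 / (2 * l2 F * l2 G) by field; rewrite Fn0 Gn0.
by rewrite divr_ge0 ?sqr_ge0// !mulr_ge0// ltW.
Qed.

Lemma l2D F G : l2 (fun i => F i + G i) <= l2 F + l2 G.
Proof.
rewrite -(@ler_pXn2r _ 2) ?nnegrE ?addr_ge0 ?l2_ge0// sqr_l2.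
rewrite (eq_bigr (fun i => F i ^+ 2 + F i * G i *+ 2 + G i ^+ 2)) => [|i _]; last exact: sqrrD.
rewrite 2!big_split /= sumrMnl sqrrD -!sqr_l2 lerD2r lerD2l.
by rewrite lerMn2r l2_CS.
Qed.

Lemma l2_triangle F G H : (forall i, `|F i| <= G i + H i) -> l2 F <= l2 G + l2 H.
Proof. by move=> /l2_le/le_trans; apply; exact: l2D. Qed.

Lemma l2_modc_CS (u v : I -> R[i]) :
  modc (\sum_i u i * v i) <= l2 (fun i => modc (u i)) * l2 (fun i => modc (v i)).
Proof.
apply: le_trans (l2_CS _ _); apply: le_trans (modc_sum _ _ _) _.
by apply: ler_sum => i _; rewrite modcM.
Qed.

End EuclideanNorm.

Section Frame.
Variables (R : realType) (n : nat) (A : 'I_n -> {fset 'rV[R]_n}).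
Variable rho : forall i, A i -> R.
Arguments rho : clear implicits.
Hypothesis A0 : forall i, A i != fset0.
Hypothesis rho0 : forall i a, 0 < rho i a.
Local Notation C := R[i].
Implicit Types (x y u w : 'cV[C]_n) (i : 'I_n) (f : system A).
Local Open Scope complex_scope.

Lemma covecD (a : 'rV[R]_n) u w : covec a (u + w) = covec a u + covec a w.
Proof. by rewrite /covec -big_split /=; apply: eq_bigr => j _; rewrite mxE mulrDr. Qed.

Lemma covecZ (a : 'rV[R]_n) c u : covec a (c *: u) = c * covec a u.
Proof. by rewrite /covec mulr_sumr; apply: eq_bigr => j _; rewrite mxE mulrCA. Qed.

Lemma covec0 (a : 'rV[R]_n) : covec a (0 : 'cV[C]_n) = 0.
Proof. by rewrite -(scale0r (0 : 'cV[C]_n)) covecZ mul0r. Qed.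

Lemma covecN (a : 'rV[R]_n) u : covec a (- u) = - covec a u.
Proof. by rewrite -scaleN1r covecZ mulN1r. Qed.

Lemma covecDl (a b : 'rV[R]_n) u : covec (a + b) u = covec a u + covec b u.
Proof.
rewrite /covec -big_split /=; apply: eq_bigr => j _.
by rewrite mxE rmorphD mulrDl.
Qed.

Lemma covecBl (a b : 'rV[R]_n) u : covec (a - b) u = covec a u - covec b u.
Proof.
rewrite /covec -sumrB /=; apply: eq_bigr => j _.
by rewrite !mxE rmorphB mulrBl.
Qed.

Lemma covecZl c (a : 'rV[R]_n) u : covec (c *: a) u = c%:C * covec a u.
Proof.
rewrite /covec mulr_sumr; apply: eq_bigr => j _.
by rewrite mxE rmorphM mulrA.
Qed.

Lemma covec_suml (I : Type) (r : seq I) (P : pred I) (F : I -> 'rV[R]_n) u :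
  covec (\sum_(k <- r | P k) F k) u = \sum_(k <- r | P k) covec (F k) u.
Proof.
elim/big_rec2: _ => [|k b c _ <-]; last by rewrite covecDl.
by rewrite /covec big1// => j _; rewrite mxE mul0r.
Qed.

Lemma reproducing_kernel_gt0 i x : 0 < reproducing_kernel rho i x.
Proof.
have /fset0Pn[a aA] := A0 i; rewrite /reproducing_kernel (bigD1 [` aA]%fset) //=.
rewrite ltr_pwDl//; first by rewrite mulr_gt0 ?expR_gt0// exprn_gt0.
by rewrite sumr_ge0// => b _; rewrite mulr_ge0 ?expR_ge0// sqr_ge0.
Qed.

Lemma weight_gt0 i x (a : A i) : 0 < weight rho x a.
Proof.
rewrite /weight divr_gt0 ?reproducing_kernel_gt0// mulr_gt0 ?expR_gt0//.
by rewrite exprn_gt0.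
Qed.

Lemma sum_weight i x : \sum_(a : A i) weight rho x a = 1.
Proof. by rewrite -mulr_suml mulfV// gt_eqF// reproducing_kernel_gt0. Qed.

Definition ell x i (a : A i) u : C := covec (val a - momentum rho i x) u.

(* the entries of [W_i(x) / |W_i(x)|], so that [|vv x a|^2] is the paper's [p_{i,a}(x)] *)
Definition vv x i (a : A i) : C :=
  (coords_norm (renormalized rho i x x))^-1%:C * renormalized rho i x x a.

Lemma sqr_modc_Veronese i x (a : A i) :
  modc (Veronese rho i x a) ^+ 2 = rho i a ^+ 2 * expR (2 * complex.Re (covec (val a) x)).
Proof.
rewrite ffunE modcM modc_real modc_cexp exprMn real_normK ?num_real//.
by rewrite mulr2n mulrDl mul1r expRD -expr2.
Qed.

Lemma sqr_modc_renormalized i x y (a : A i) :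
  modc (renormalized rho i x y a) ^+ 2 =
  expR (- complex.Re (covec (momentum rho i x) y)) ^+ 2 *
  (rho i a ^+ 2 * expR (2 * complex.Re (covec (val a) y))).
Proof.
by rewrite ffunE modcM exprMn sqr_modc_Veronese modc_cexp raddfN.
Qed.

Lemma sqr_coords_norm_renormalized i x :
  coords_norm (renormalized rho i x x) ^+ 2 =
  expR (- complex.Re (covec (momentum rho i x) x)) ^+ 2 * reproducing_kernel rho i x.
Proof.
rewrite -[LHS]/(l2 _ ^+ 2) sqr_l2 mulr_sumr; apply: eq_bigr => a _.
exact: sqr_modc_renormalized.
Qed.

Lemma coords_norm_renormalized_gt0 i x : 0 < coords_norm (renormalized rho i x x).
Proof.
rewrite lt_def sqrtr_ge0 andbT -sqrf_eq0 sqr_coords_norm_renormalized.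
by rewrite gt_eqF// mulr_gt0 ?reproducing_kernel_gt0// exprn_gt0// expR_gt0.
Qed.

Lemma sqr_modc_vv x i (a : A i) : modc (vv x a) ^+ 2 = weight rho x a.
Proof.
rewrite /vv modcM modc_real exprMn real_normK ?num_real// sqr_modc_renormalized.
rewrite exprVn sqr_coords_norm_renormalized /weight invfM mulrACA mulVf.
  by rewrite mul1r mulrC.
by rewrite gt_eqF// exprn_gt0// expR_gt0.
Qed.

(** The momentum is the mean of the exponents under [weight]. This centering cancels the first-order
    terms in the changes of weights below. *)
Lemma sum_weight_ell x i u : \sum_(a : A i) (weight rho x a)%:C * ell x a u = 0.
Proof.
under eq_bigr do rewrite /ell covecBl mulrBr.
rewrite sumrB -mulr_suml -rmorph_sum /= sum_weight mul1r /momentum covec_suml.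
by under [X in _ - X]eq_bigr do rewrite covecZl; rewrite subrr.
Qed.

Lemma ellD x i (a : A i) u w : ell x a (u + w) = ell x a u + ell x a w.
Proof. exact: covecD. Qed.

Lemma ellB x i (a : A i) u w : ell x a (u - w) = ell x a u - ell x a w.
Proof. by rewrite /ell covecD covecN. Qed.

Lemma ellZ x i (a : A i) c u : ell x a (c *: u) = c * ell x a u.
Proof. exact: covecZ. Qed.

Lemma local_norm_iE i x u :
  local_norm_i rho i x u = l2 (fun a : A i => modc (vv x a) * modc (ell x a u)).
Proof.
by congr Num.sqrt; apply: eq_bigr => a _; rewrite exprMn sqr_modc_vv.
Qed.

Lemma local_normE x u : local_norm rho x u = l2 (fun i => local_norm_i rho i x u).
Proof. by []. Qed.

End Frame.

Section RealExponential.
Variable R : realType.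

(** The right side times [expR (- t)] has derivative [t ^+ 3 * (1 / 75 - 9 / 200 * t) * expR (- t)],
    nonnegative up to [8 / 27], which exceeds 29/100. The coefficient 9/200 is slightly larger than
    1/24. *)
Lemma expR_le_taylor4 (r : R) : 0 <= r -> r <= 29 / 100 ->
  expR r <= 1 + r + r ^+ 2 / 2 + r ^+ 3 / 6 + 9 / 200 * r ^+ 4.
Proof.
move=> r0 rT.
pose c (j : nat) : R := if j == 4%N then 27 / 25 else 1.
pose q (t : R) := \sum_(j < 5) c j * t ^+ j / j`!%:R.
have qE t : q t = 1 + t + t ^+ 2 / 2 + t ^+ 3 / 6 + 9 / 200 * t ^+ 4.
  by rewrite /q !big_ord_recl big_ord0 /c /= /bump /= !factS fact0 !natrM; field.
pose q' (t : R) := \sum_(j < 4) c j.+1 * t ^+ j / j`!%:R.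
have q'E t : q' t = 1 + t + t ^+ 2 / 2 + 18 / 100 * t ^+ 3.
  by rewrite /q' !big_ord_recl big_ord0 /c /= /bump /= !factS fact0 !natrM; field.
rewrite -qE; suff : 1 <= q r * expR (- r).
  by rewrite expRN ler_pdivlMr ?expR_gt0// mul1r.
have [->|rn0] := eqVneq r 0; first by rewrite qE oppr0 expR0; lra.
have rp : 0 < r by rewrite lt_def rn0.
pose e (t : R) := expR (- t).
have de t : is_derive t (1 : R) e (- e t).
  by rewrite /e; apply: is_derive_eq; rewrite mulrN1.
pose h (t : R) := q t * e t.
pose h' (t : R) := t ^+ 3 * (9 / 50 - 1 / 6 - 9 / 200 * t) * e t.
have dh t : is_derive t (1 : R) h (h' t).
  apply: (is_derive_eq (is_deriveM (is_derive_expsum c 4 t) (de t))).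
  transitivity (q t * - e t + e t * q' t); first by [].
  by rewrite qE q'E /h'; field.
have [d c0r] : exists2 d, d \in `]0, r[%R & h r - h 0 = h' d * (r - 0).
  apply: MVT => //; apply: continuous_subspaceT => x; apply: differentiable_continuous.
  by apply/derivable1_diffP; case: (dh x).
have h0 : h 0 = 1 by rewrite /h qE /e oppr0 expR0; lra.
rewrite h0 subr0 => E; rewrite -[leRHS]/(h r).
move: c0r; rewrite in_itv/= => /andP[c0 cr].
rewrite -subr_ge0 E; apply: mulr_ge0; last exact: ltW.
rewrite /h'; apply: mulr_ge0; last exact: expR_ge0.
by apply: mulr_ge0; [apply: exprn_ge0; exact: ltW|lra].
Qed.

(** 67/125 bounds [1 / 2 + r / 6 + 9 / 200 * r ^+ 2] up to [r = 1 / 5]. Doubled, it is the factor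
    134/125 of the Newton estimates, where the distance enters with a factor one half. *)
Lemma expR_le_quad (r : R) : 0 <= r -> r <= 2 / 10 ->
  expR r <= 1 + r + 67 / 125 * r ^+ 2.
Proof.
move=> r0 r2; apply: (le_trans (expR_le_taylor4 r0 _)); first by lra.
have r20 : 0 <= r ^+ 2 by exact: sqr_ge0.
rewrite -subr_ge0 (_ : _ - _ = r ^+ 2 * (9 / 250 - r / 6 - 9 / 200 * r ^+ 2)); last by field.
have : r ^+ 2 <= (2 / 10) ^+ 2 by rewrite ler_pXn2r// nnegrE; lra.
by move=> r4; apply: mulr_ge0; [exact: r20|lra].
Qed.

End RealExponential.

Lemma near_dnbhs0 (K : numFieldType) (d : K) : 0 < d ->
  \forall h \near (0 : K)^', h != 0 /\ `|h| <= d.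
Proof.
move=> d0; near=> h; split; near: h; first exact: nbhs_dnbhs_neq.
exact: dnbhs0_le.
Unshelve. all: by end_near. Qed.

Section ComplexDerivative.
Variable R : realType.
Local Notation C := R[i].
Local Open Scope complex_scope.

Lemma normC_modc (z : C) : `|z| = (modc z)%:C.
Proof. by rewrite normc_def modcE. Qed.

Lemma modc_cexp_sub_le (z : C) : modc z <= 2 / 10 ->
  modc (cexp z - 1 - z) <= modc z ^+ 2.
Proof.
move=> z2; apply: (le_trans (cexp_bound2 z)).
have z0 := modc_ge0 z; have := expR_le_quad z0 z2.
by have := sqr_ge0 (modc z); lra.
Qed.

Lemma derive1_expsum (I : finType) (c l : I -> C) :
  derive1 (fun h : C => (\sum_a c a * cexp (h * l a)) : C^o) 0 = \sum_a c a * l a.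
Proof.
pose K : R := \sum_a modc (c a) * modc (l a) ^+ 2.
pose L : R := \sum_a modc (l a).
have K0 : 0 <= K.
  by apply: sumr_ge0 => a _; apply: mulr_ge0; [exact: modc_ge0|exact: sqr_ge0].
have L0 : 0 <= L by apply: sumr_ge0 => a _; exact: modc_ge0.
have lL a : modc (l a) <= L.
  by rewrite /L (bigD1 a)//= lerDl; apply: sumr_ge0 => b _; exact: modc_ge0.
apply/cvg_lim; first exact: norm_hausdorff.
apply/cvgrPdist_le => eps; rewrite ltcE /= => /andP[/eqP eps0 e0].
pose e := complex.Re eps.
have -> : eps = e%:C by case: eps eps0 {e0} @e => a b /= ->.
(* The second bound keeps every [h * l a] where the quadratic remainder estimate holds; the first
   makes the error [K * modc h] of the difference quotient at most [e]. *)
pose d := Num.min (e / (K + 1)) (1 / 10 / (L + 1)).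
have d0 : 0 < d by rewrite lt_min !divr_gt0//; lra.
have dC : 0 < d%:C :> C by rewrite ltcR.
near=> h.
have [hn0] : h != 0 /\ `|h| <= d%:C by near: h; exact: near_dnbhs0.
rewrite normC_modc lecR le_min => /andP[he hL].
have h0 : 0 < modc h by rewrite lt_def modc_eq0 hn0 modc_ge0.
rewrite normC_modc lecR.
have -> : \sum_a c a * l a - h^-1 *: ((\sum_a c a * cexp ((h + 0) * l a) : C^o) -
    \sum_a c a * cexp (0 * l a)) =
  - h^-1 * \sum_a c a * (cexp (h * l a) - 1 - h * l a).
  rewrite -[_ *: _]/(_ * _) addr0 mulNr mulr_sumr -sumrB !mulr_sumr -!sumrB -sumrN.
  by apply: eq_bigr => a _; rewrite mul0r cexp0; field.
rewrite modcM modcN modcV mulrC ler_pdivrMr//.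
apply: (le_trans (modc_sum _ _ _)).
apply: (@le_trans _ _ (K * modc h ^+ 2)).
  rewrite /K mulr_suml; apply: ler_sum => a _; rewrite modcM -mulrA ler_wpM2l ?modc_ge0//.
  apply: (le_trans (modc_cexp_sub_le _)); last by rewrite modcM exprMn mulrC.
  rewrite modcM; apply: (@le_trans _ _ (1 / 10 / (L + 1) * (L + 1))).
    apply: ler_pM; rewrite ?modc_ge0//; have := lL a; lra.
  by rewrite divfK; lra.
rewrite expr2 mulrA ler_wpM2r ?(ltW h0)//.
apply: (@le_trans _ _ ((K + 1) * modc h)); first by rewrite ler_wpM2r ?(ltW h0)//; lra.
by rewrite mulrC -ler_pdivlMr//; lra.
Unshelve. all: by end_near. Qed.

End ComplexDerivative.

Section NewtonData.
Variables (R : realType) (n : nat) (A : 'I_n -> {fset 'rV[R]_n}).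
Variable rho : forall i, A i -> R.
Arguments rho : clear implicits.
Local Notation C := R[i].
Implicit Types (x y u w : 'cV[C]_n) (i : 'I_n) (f : system A).
Local Open Scope complex_scope.

(** Values, derivatives and Taylor remainders of the [i]-th equation at [x] all have this form, with
    multiplier [cexp l], [l] or [cexp l - 1 - l] for [l = ell x a u]. Estimates of rows thus reduce
    to estimates of [q]. *)
Definition rowsum f x (q : forall i, A i -> C) i : C :=
  \sum_a vv rho x a * q i a * f i a.

Lemma eq_rowsum f x q q' i : (forall a, q i a = q' i a) -> rowsum f x q i = rowsum f x q' i.
Proof. by move=> qq; apply: eq_bigr => a _; rewrite qq. Qed.

Lemma rowsumB f x q q' i :
  rowsum f x (fun i a => q i a - q' i a) i = rowsum f x q i - rowsum f x q' i.
Proof. by rewrite -sumrB; apply: eq_bigr => a _ /=; ring. Qed.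

Lemma rowsumZ f x c q i :
  rowsum f x (fun i a => c i * q i a) i = c i * rowsum f x q i.
Proof. by rewrite /rowsum mulr_sumr; apply: eq_bigr => a _ /=; ring. Qed.

Lemma renormalizedD i x y w (a : A i) :
  renormalized rho i x (y + w) a = renormalized rho i x y a * cexp (ell rho x a w).
Proof.
by rewrite !ffunE /ell covecBl !covecD opprD !cexpD; ring.
Qed.

Lemma S_opE f x u i : S_op rho f x u i 0 = rowsum f x (fun i a => cexp (ell rho x a u)) i.
Proof.
rewrite mxE /pairing mulr_sumr; apply: eq_bigr => a _.
by rewrite renormalizedD /vv !mulrA.
Qed.

Lemma DS_opE f x u i : (DS_op rho f x *m u) i 0 = rowsum f x (fun i a => ell rho x a u) i.
Proof.
have DE j : DS_op rho f x i j = rowsum f x (fun i a => ell rho x a (delta_mx j 0)) i.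
  rewrite mxE (_ : (fun h => _) = (fun h : C => (\sum_a (vv rho x a * f i a) *
     cexp (h * ell rho x a (delta_mx j 0))) : C^o)); last first.
    apply/funext => h; rewrite S_opE; apply: eq_bigr => a _.
    by rewrite ellZ mulrAC.
  by rewrite derive1_expsum; apply: eq_bigr => a _; rewrite mulrAC.
rewrite mxE (eq_bigr (fun j => \sum_a vv rho x a * (u j 0 * ell rho x a (delta_mx j 0)) * f i
  a)); last first.
  by move=> j _; rewrite DE /rowsum mulr_suml; apply: eq_bigr => a _; ring.
rewrite exchange_big /=; apply: eq_bigr => a _.
rewrite -mulr_suml -mulr_sumr; congr (_ * _ * _).
rewrite /ell {2}/covec; apply: eq_bigr => j _; rewrite mulrC; congr (_ * _).
move: (val a - _) => b; rewrite /covec (bigD1 j)//= big1 => [|k kj]; first by rewrite [delta_mx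
  _ _ _ _]mxE !eqxx mulr1 addr0.
by rewrite [delta_mx _ _ _ _]mxE (negbTE kj) mulr0.
Qed.

Lemma S_op0 f x i : S_op rho f x 0 i 0 = rowsum f x (fun _ _ => 1) i.
Proof. by rewrite S_opE; apply: eq_rowsum => a; rewrite /ell covec0 cexp0. Qed.

End NewtonData.

(** * Change of center *)

Section Estimates.
Variables (R : realType) (n : nat) (A : 'I_n -> {fset 'rV[R]_n}).
Variable rho : forall i, A i -> R.
Arguments rho : clear implicits.
Hypothesis A0 : forall i, A i != fset0.
Hypothesis rho0 : forall i a, 0 < rho i a.
Local Notation C := R[i].
Implicit Types (x y u w z : 'cV[C]_n) (i : 'I_n) (f : system A) (M N r : R).
Local Open Scope complex_scope.

Let lniE i x u : local_norm_i rho i x u =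
  l2 (fun a : A i => modc (vv rho x a) * modc (ell rho x a u)).
Proof. exact: local_norm_iE. Qed.

Lemma coords_normE i (g : coords A i) : coords_norm g = l2 (fun a => modc (g a)).
Proof. by []. Qed.

Lemma coords_norm_gt0 i (g : coords A i) : g != 0 -> 0 < coords_norm g.
Proof.
move=> g0; rewrite lt_def l2_ge0 andbT; apply: contraNneq g0 => E.
apply/eqP/ffunP => a; rewrite ffunE; apply/eqP; rewrite -modc_eq0 eq_le modc_ge0 andbT.
by have := ler_l2 (fun a => modc (g a)) a; rewrite -coords_normE E ger0_norm ?modc_ge0.
Qed.

Lemma local_norm_i_ge0 i x u : 0 <= local_norm_i rho i x u.
Proof. exact: sqrtr_ge0. Qed.

Lemma local_norm_ge0 x u : 0 <= local_norm rho x u.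
Proof. exact: sqrtr_ge0. Qed.

Lemma local_norm_i_le i x u : local_norm_i rho i x u <= local_norm rho x u.
Proof.
by have := ler_l2 (fun i => local_norm_i rho i x u) i; rewrite ger0_norm ?local_norm_i_ge0.
Qed.

Lemma local_norm_iD i x u w :
  local_norm_i rho i x (u + w) <= local_norm_i rho i x u + local_norm_i rho i x w.
Proof.
rewrite !lniE; apply: l2_triangle => a.
rewrite ger0_norm ?mulr_ge0 ?modc_ge0// ellD -mulrDr ler_wpM2l ?modc_ge0//.
exact: modcD.
Qed.

Lemma local_norm_iZ i x c u :
  local_norm_i rho i x (c *: u) = modc c * local_norm_i rho i x u.
Proof.
rewrite !lniE -l2Z ?modc_ge0//; apply: eq_l2 => a.
by rewrite ellZ modcM mulrCA.
Qed.

Lemma local_normD x u w :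
  local_norm rho x (u + w) <= local_norm rho x u + local_norm rho x w.
Proof.
apply: l2_triangle => i; rewrite ger0_norm ?local_norm_i_ge0//.
exact: local_norm_iD.
Qed.

Lemma local_normZ x c u : local_norm rho x (c *: u) = modc c * local_norm rho x u.
Proof.
rewrite /local_norm -/(l2 _) -l2Z ?modc_ge0//; apply: eq_l2 => i.
exact: local_norm_iZ.
Qed.

Lemma local_normN x u : local_norm rho x (- u) = local_norm rho x u.
Proof. by rewrite -scaleN1r local_normZ modcN modc1 mul1r. Qed.

Lemma local_norm0 x : local_norm rho x 0 = 0.
Proof. by rewrite -(scale0r 0) local_normZ modc0 mul0r. Qed.

Lemma local_norm_distC x u w : local_norm rho x (u - w) = local_norm rho x (w - u).
Proof. by rewrite -local_normN opprB. Qed.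

Lemma rowsum_le f x (q : forall i, A i -> C) i :
  modc (rowsum rho f x q i) <=
  l2 (fun a => modc (vv rho x a) * modc (q i a)) * coords_norm (f i).
Proof.
rewrite coords_normE; apply: (le_trans (l2_modc_CS _ _)).
rewrite ler_wpM2r ?l2_ge0// le_eqVlt; apply/orP; left; apply/eqP.
by apply: eq_l2 => a; rewrite modcM.
Qed.

(** Cauchy-Schwarz, since [local_norm_i] is the Euclidean norm of the vector with entries
    [vv * ell]. *)
Lemma rowsum_le_norm f x (q : forall i, A i -> C) i u c : f i != 0 -> 0 <= c ->
    (forall a, modc (q i a) <= c * modc (ell rho x a u)) ->
  modc (rowsum rho f x q i) / coords_norm (f i) <= c * local_norm_i rho i x u.
Proof.
move=> f0 c0 H; rewrite ler_pdivrMr ?coords_norm_gt0//.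
apply: (le_trans (rowsum_le _ _ _ _)); rewrite ler_wpM2r ?l2_ge0//.
rewrite lniE -l2Z//; apply: l2_le => a.
by rewrite ger0_norm ?mulr_ge0 ?modc_ge0// mulrCA ler_wpM2l ?modc_ge0.
Qed.

Lemma l2_rowsum_le_norm f x (q : forall i, A i -> C) u c : (forall i, f i != 0) -> 0 <= c ->
    (forall i a, modc (q i a) <= c * modc (ell rho x a u)) ->
  l2 (fun i => modc (rowsum rho f x q i) / coords_norm (f i)) <= c * local_norm rho x u.
Proof.
move=> f0 c0 H; rewrite /local_norm -/(l2 _) -l2Z//; apply: l2_le => i.
rewrite ger0_norm ?divr_ge0 ?modc_ge0 ?l2_ge0//; exact: rowsum_le_norm.
Qed.

(* norm of [DS_op f x w] after each equation is scaled to have norm 1 *)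
Definition dn f x w : R :=
  l2 (fun i => modc ((DS_op rho f x *m w) i 0) / coords_norm (f i)).

(** Upper bounds for mu and nu as plain inequalities: they move between centers without suprema, and
    [cond_le] makes sense before [DS_op] is known to be invertible. *)
Definition cond_le f x M := forall w, local_norm rho x w <= M * dn f x w.
Definition nu_le x N := forall i (a : A i) u,
  modc (ell rho x a u) <= N * local_norm_i rho i x u.
Definition nondegenerate x := forall w, local_norm rho x w = 0 -> w = 0.

Lemma dn_ge0 f x w : 0 <= dn f x w. Proof. exact: l2_ge0. Qed.

Lemma dn_le f x w : (forall i, f i != 0) -> dn f x w <= local_norm rho x w.
Proof.
move=> f0; rewrite -[leRHS]mul1r /dn; under eq_l2 do rewrite DS_opE.
by apply: l2_rowsum_le_norm => // i a; rewrite mul1r.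
Qed.

Lemma nondegenerate_of_unit f x : (forall i, f i != 0) ->
  DS_op rho f x \in unitmx -> nondegenerate x.
Proof.
move=> f0 D w w0; have /eqP : dn f x w = 0.
  by apply/le_anti; rewrite dn_ge0 andbT -w0 dn_le.
rewrite -sqrf_eq0 sqr_l2 psumr_eq0 => [/allP H|i _]; last exact: sqr_ge0.
suff Dw : DS_op rho f x *m w = 0 by rewrite -(mulKmx D w) Dw mulmx0.
apply/matrixP => i j; rewrite [j]ord1 [RHS]mxE; apply/eqP; rewrite -modc_eq0.
have := H i (mem_index_enum _); rewrite sqrf_eq0 mulf_eq0 invr_eq0.
by rewrite [coords_norm _ == 0]gt_eqF ?coords_norm_gt0 ?orbF.
Qed.

Lemma unit_of_cond_le f x M : nondegenerate x -> cond_le f x M ->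
  DS_op rho f x \in unitmx.
Proof.
move=> nd cM; rewrite -unitmx_tr unitmxE unitfE; apply/det0P => -[v v0 vD].
have Dv : DS_op rho f x *m v^T = 0 by apply: trmx_inj; rewrite trmx_mul trmxK vD trmx0.
have dn0 : dn f x v^T = 0.
  rewrite /dn -[RHS](l2_0 R 'I_n); apply: eq_l2 => i.
  by rewrite Dv mxE modc0 mul0r.
move/negP: v0; apply; rewrite -(inj_eq (@trmx_inj _ _ _)) trmx0; apply/eqP/nd.
apply/le_anti; rewrite local_norm_ge0 andbT.
by have := cM v^T; rewrite dn0 mulr0.
Qed.

Lemma solution_S_op f x z : solution_variety rho f z ->
  forall i, rowsum rho f x (fun i a => cexp (ell rho x a (z - x))) i = 0.
Proof.
move=> fz i; rewrite -S_opE mxE addrC subrK.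
have -> : pairing (renormalized rho i x z) (f i) =
    cexp (- covec (momentum rho i x) z) * pairing (Veronese rho i z) (f i).
  by rewrite /pairing mulr_sumr; apply: eq_bigr => a _; rewrite ffunE mulrA.
by rewrite fz !mulr0.
Qed.

(** [DS_op] maps the error to [- S_op - DS_op (z - x)]. Adding the equations at [z], which vanish
    and have multiplier [cexp l], leaves the second-order remainder. *)
Lemma dn_newton f x z : DS_op rho f x \in unitmx -> solution_variety rho f z ->
  dn f x (newton rho f x - z) =
  l2 (fun i => modc (rowsum rho f x (fun i a => cexp (ell rho x a (z - x)) - 1 -
     ell rho x a (z - x)) i) / coords_norm (f i)).
Proof.
move=> D fz; apply: eq_l2 => i; congr (modc _ / _).
rewrite (_ : newton rho f x - z = - (invmx (DS_op rho f x) *m S_op rho f x 0) - (z - x)); last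
  first.
  by rewrite /newton opprB addrA [- _ + x]addrC.
rewrite mulmxBr mulmxN mulKVmx// [LHS]mxE -/(_ - _) 2!rowsumB solution_S_op// sub0r.
rewrite -S_op0 -DS_opE; congr (_ + _); rewrite !mxE//.
Qed.

Lemma newton_contraction f x z M N : (forall i, f i != 0) ->
    DS_op rho f x \in unitmx -> solution_variety rho f z ->
    cond_le f x M -> nu_le x N -> 0 <= M -> 0 <= N ->
    N * local_norm rho x (z - x) <= 2 / 10 ->
  local_norm rho x (newton rho f x - z) <=
    M * (67 / 125 * (N * local_norm rho x (z - x))) * local_norm rho x (z - x).
Proof.
move=> f0 D fz cM nN M0 N0 Nd; apply: (le_trans (cM _)); rewrite -[leRHS]mulrA; apply:
  ler_wpM2l => //.
have d0 := local_norm_ge0 x (z - x).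
have Nd0 : 0 <= N * local_norm rho x (z - x) by exact: mulr_ge0.
rewrite dn_newton//; apply: (l2_rowsum_le_norm (u := z - x)); [exact: f0|by apply: mulr_ge0;
  [lra|exact: Nd0]|].
move=> i a; set l := ell _ _ _ _.
have l0 := modc_ge0 l.
have lr : modc l <= N * local_norm rho x (z - x).
  by apply: (le_trans (nN _ _ _)); rewrite ler_wpM2l// local_norm_i_le.
have := cexp_bound2 l; have := expR_le_quad l0 (le_trans lr Nd).
rewrite expr2 => H1 H2; apply: (@le_trans _ _ (67 / 125 * (modc l * modc l))); first by lra.
by rewrite mulrA; apply: ler_wpM2r; [exact: l0|apply: ler_wpM2l; [lra|exact: lr]].
Qed.

End Estimates.

Section RealExponentialBounds.
Variable R : realType.

Lemma le_of_sqr (a b : R) : 0 <= b -> a ^+ 2 <= b ^+ 2 -> a <= b.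
Proof.
move=> b0 ab; have [a0|a0] := ltP a 0; first exact: ltW (lt_le_trans a0 b0).
by rewrite -(@ler_pXn2r _ 2) ?nnegrE.
Qed.

Lemma sub_expR_le (s t : R) : s <= t -> expR s - s <= expR t - t \/ s < 0.
Proof.
move=> st; have [s0|s0] := ltP s 0; [by right|left].
have e1 : 1 <= expR s by rewrite -expR0 ler_expR.
have e2 : 1 + (t - s) <= expR (t - s) by rewrite expR_ge1Dx.
have -> : expR t = expR s * expR (t - s) by rewrite -expRD addrC subrK.
have : 0 <= (expR s - 1) * (t - s) by apply: mulr_ge0; lra.
have : expR s * (1 + (t - s)) <= expR s * expR (t - s) by rewrite ler_wpM2l ?expR_ge0.
lra.
Qed.

Lemma cexp_real (s : R) : cexp (real_complex R s) = real_complex R (expR s).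
Proof. by rewrite /cexp /= cos0 sin0 mulr1 mulr0. Qed.

Lemma norm_expR_sub1 (s r : R) : `|s| <= r -> `|expR s - 1| <= expR r - 1.
Proof.
move=> sr; have := cexp_bound1 (real_complex R s).
rewrite cexp_real -[X in modc (_ - X)]/(real_complex R 1) -rmorphB !modc_real.
by move=> /le_trans; apply; rewrite lerD2r ler_expR.
Qed.

Lemma modc_le_distl (z w : R[i]) : modc z <= modc w + modc (z - w).
Proof. by rewrite -[in leLHS](subrK w z) addrC modcD. Qed.

Lemma modc_le_distr (z w : R[i]) : modc w <= modc z + modc (z - w).
Proof. by rewrite -(modcN (z - w)) opprB; exact: modc_le_distl. Qed.

Lemma recenter_identity (K : comNzRingType) (k v e l d g : K) :
  k * v * e * (l - d) * g = k * (v * l * g + v * ((e - 1) * l) * g - d * (v * e * g)).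
Proof. by ring. Qed.

(** [Dx] and [Dy] stand for a row of [DS_op] at two centers, [k] for the ratio of normalizations,
    [d] for the shift of the momentum, [F] for the effect of the factor [cexp l - 1], and [S] for
    the value of the equation at the new center. *)
Lemma recenter_row_le (k d Dx Dy F S : R[i]) (b cf L e1 e2 eps : R) :
    0 < cf -> 1 <= modc k * b -> modc d <= e2 * L -> modc F / cf <= e1 * L ->
    modc S <= eps * cf -> Dy = k * (Dx + F - d * S) ->
  modc Dx / cf <= b * (modc Dy / cf) + (e1 + e2 * eps) * L.
Proof.
move=> cf0 kb dle Fle Sle ->; set G := Dx + F - d * S.
have DFS : modc Dx <= modc G + modc F + modc d * modc S.
  have {1}-> : Dx = G + (- F) + d * S by rewrite /G; ring.
  apply: (le_trans (modcD _ _)); rewrite modcM lerD2r.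
  by apply: (le_trans (modcD _ _)); rewrite modcN.
have kD : modc G <= b * modc (k * G).
  by rewrite modcM mulrA ler_peMl ?modc_ge0// mulrC.
have dS : modc d * modc S / cf <= e2 * eps * L.
  rewrite ler_pdivrMr// (_ : _ * eps * _ * _ = (e2 * L) * (eps * cf)); last by ring.
  by apply: ler_pM; rewrite ?modc_ge0.
rewrite (mulrDl e1); apply: (@le_trans _ _ ((b * modc (k * G) + modc F + modc d * modc S) / cf)).
  rewrite ler_wpM2r ?invr_ge0 ?(ltW cf0)//; apply: (le_trans DFS).
  by rewrite !lerD2r.
by rewrite !mulrDl -!addrA -(mulrA b) lerD2l; exact: lerD.
Qed.

Lemma recenter_row_leV (k Dx Dy F S d : R[i]) (cf L e1 : R) :
    0 < cf -> modc k <= 1 -> modc F / cf <= e1 * L -> S = 0 ->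
    Dy = k * (Dx + F - d * S) ->
  modc Dy / cf <= modc Dx / cf + e1 * L.
Proof.
move=> cf0 k1 Fle -> ->; rewrite mulr0 subr0 modcM.
apply: (@le_trans _ _ (modc (Dx + F) / cf)).
  by rewrite ler_wpM2r ?invr_ge0 ?(ltW cf0)// ler_piMl ?modc_ge0.
apply: le_trans _ (lerD (lexx _) Fle).
by rewrite -mulrDl ler_wpM2r ?invr_ge0 ?(ltW cf0)// modcD.
Qed.

(** The term [c * nx] is absorbed through [nx <= M * dx], which is where [M * c < 1] enters. *)
Lemma condition_transfer (nx ny dx dy M c E b : R) : 0 < M -> 0 <= E -> M * c < 1 ->
    nx <= M * dx -> ny <= E * nx -> dx <= b * dy + c * nx ->
  ny <= M * E * b / (1 - M * c) * dy.
Proof.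
move=> M0 E0 q1 xw yw D.
have q0 : 0 < 1 - M * c by rewrite subr_gt0.
have : (1 - M * c) * nx <= M * (b * dy) by have := ler_wpM2l (ltW M0) D; lra.
rewrite -ler_pdivlMl// => H; apply: (le_trans yw).
rewrite (_ : _ * dy = E * ((1 - M * c)^-1 * (M * (b * dy)))); last by ring.
by rewrite ler_wpM2l.
Qed.

Lemma condition_transferV (nx ny dx dy M M' e E b : R) : 0 <= E -> 0 <= b -> 0 <= M' ->
    0 <= e -> nx <= E * b * ny -> ny <= M' * dy -> dy <= dx + e * nx -> nx <= M * dx ->
  nx <= E * b * M' * (1 + M * e) * dx.
Proof.
move=> E0 b0 M'0 e0 H1 H2 H3 H4; apply: (le_trans H1).
rewrite -!mulrA; apply: ler_wpM2l => //; apply: ler_wpM2l => //.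
apply: (le_trans H2); apply: ler_wpM2l => //; apply: (le_trans H3).
by have := ler_wpM2l e0 H4; lra.
Qed.

Lemma sqr_le_eq (a b c Sa Sb : R) : a ^+ 2 = Sa -> b ^+ 2 = Sb -> Sa <= c * Sb ->
  a ^+ 2 <= c * b ^+ 2.
Proof. by move=> -> ->. Qed.

Lemma expR_le_quad_sym (s r : R) : `|s| <= r -> expR s <= 1 + s + (expR r - 1 - r).
Proof.
move=> sr; have := cexp_bound2 (real_complex R s).
rewrite cexp_real -[X in modc (_ - X - _)]/(real_complex R 1) -!rmorphB !modc_real.
have := ler_norm (expR s - 1 - s).
have [|] := sub_expR_le sr; last by rewrite ltNge normr_ge0.
lra.
Qed.

(** Shifting a centered random variable by [d] adds [modc d ^+ 2] to its second moment. *)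
Lemma variance_le (I : finType) (p : I -> R) (q : I -> R[i]) (d : R[i]) :
    (forall a, 0 <= p a) -> \sum_a p a = 1 ->
    \sum_a (real_complex R (p a)) * q a = 0 ->
  \sum_a p a * modc (q a) ^+ 2 <= \sum_a p a * modc (q a + d) ^+ 2.
Proof.
move=> p0 p1 pq; rewrite -subr_ge0 -sumrB.
have -> : \sum_a (p a * modc (q a + d) ^+ 2 - p a * modc (q a) ^+ 2) = modc d ^+ 2.
  transitivity (\sum_a (p a * modc d ^+ 2 +
    (p a * complex.Re (q a) * (2 * complex.Re d) + p a * complex.Im (q a) * (2 * complex.Im d)))).
    apply: eq_bigr => a _; rewrite !sqr_modc; case: (q a) => a1 a2; case: d => d1 d2 /=; ring.
  rewrite big_split /= -mulr_suml p1 mul1r big_split /= -!mulr_suml.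
  have -> : \sum_a p a * complex.Re (q a) = complex.Re (\sum_a real_complex R (p a) * q a).
    by rewrite raddf_sum; apply: eq_bigr => a _; case: (q a) => a1 a2 /=; rewrite mul0r subr0.
  have -> : \sum_a p a * complex.Im (q a) = complex.Im (\sum_a real_complex R (p a) * q a).
    by rewrite raddf_sum; apply: eq_bigr => a _; case: (q a) => a1 a2 /=; rewrite mul0r addr0.
  by rewrite pq /= !mul0r !addr0.
exact: sqr_ge0.
Qed.

End RealExponentialBounds.

Section Recentering.
Variables (R : realType) (n : nat) (A : 'I_n -> {fset 'rV[R]_n}).
Variable rho : forall i, A i -> R.
Arguments rho : clear implicits.
Hypothesis A0 : forall i, A i != fset0.
Hypothesis rho0 : forall i a, 0 < rho i a.
Local Notation C := R[i].
Implicit Types (u w z : 'cV[C]_n) (i : 'I_n) (f : system A).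
Local Open Scope complex_scope.

Let sqr_vv x i (a : A i) : modc (vv rho x a) ^+ 2 = weight rho x a.
Proof. exact: sqr_modc_vv. Qed.

Let lniE i x u : local_norm_i rho i x u =
  l2 (fun a : A i => modc (vv rho x a) * modc (ell rho x a u)).
Proof. exact: local_norm_iE. Qed.

Let sqr_lni i x u : local_norm_i rho i x u ^+ 2 =
  \sum_(a : A i) weight rho x a * modc (ell rho x a u) ^+ 2.
Proof.
by rewrite sqr_sqrtr// sumr_ge0// => a _; rewrite mulr_ge0 ?sqr_ge0// -sqr_vv sqr_ge0.
Qed.

Let weight_ge0 x i (a : A i) : 0 <= weight rho x a.
Proof. by rewrite -sqr_vv sqr_ge0. Qed.

Let vvE i x (a : A i) : vv rho x a =
  (coords_norm (renormalized rho i x x))^-1%:C * renormalized rho i x x a.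
Proof. by []. Qed.

Lemma ell_recenter x y i : exists d : 'cV[C]_n -> C,
  forall (a : A i) u, ell rho x a u = ell rho y a u + d u.
Proof.
exists (fun u => covec (momentum rho i y - momentum rho i x) u) => a u.
by rewrite /ell -covecDl addrA subrK.
Qed.

Let renormalizedE i x y (a : A i) : renormalized rho i x y a =
  cexp (- covec (momentum rho i x) y) * Veronese rho i y a.
Proof. exact: ffunE. Qed.

Opaque local_norm_i weight momentum ell vv renormalized Veronese cexp coords_norm.

Lemma vv_recenter x y i : exists2 k : C, k != 0 &
  forall a : A i, vv rho y a = k * vv rho x a * cexp (ell rho x a (y - x)).
Proof.
have cx := coords_norm_renormalized_gt0 A0 rho0 i x.
have cy := coords_norm_renormalized_gt0 A0 rho0 i y.
pose c := cexp (covec (momentum rho i x - momentum rho i y) y).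
exists ((coords_norm (renormalized rho i y y))^-1%:C * c *
        (coords_norm (renormalized rho i x x))%:C).
  rewrite !mulf_neq0 ?cexp_neq0// eq_complex /= eqxx andbT ?invr_eq0 gt_eqF//.
move=> a; rewrite !vvE.
have -> : renormalized rho i y y a = c * renormalized rho i x y a.
  have cE : c * cexp (- covec (momentum rho i x) y) = cexp (- covec (momentum rho i y) y).
    by rewrite /c covecBl -cexpD; congr cexp; ring.
  transitivity (c * cexp (- covec (momentum rho i x) y) * Veronese rho i y a).
    by rewrite cE; exact: renormalizedE.
  by rewrite -mulrA; congr (_ * _); symmetry; exact: renormalizedE.
rewrite -[in renormalized rho i x y a](subrK x y) addrC renormalizedD -!mulrA.
congr (_ * (_ * _)); rewrite mulrA -[LHS]mul1r; congr (_ * _).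
by rewrite -rmorphM mulfV ?gt_eqF.
Qed.

Section Bounds.
Variables (x y : 'cV[C]_n) (r : R).
Hypothesis xyr : forall i (a : A i), modc (ell rho x a (y - x)) <= r.
Let E := expR r.
Let B2 := E ^+ 2 - 2 * r.

(** [K] is the inverse of [Z], the mean of [expR (2 * Re l)] for [l = ell x a (y - x)]. Since [Re l]
    has mean zero, [Z] lies between 1 and [1 + (expR (2 * r) - 1 - 2 * r) = B2]: the change of
    normalization is of second order in [r]. *)
Lemma weight_recenter i : exists2 K : R, 0 < K /\ (K <= 1 /\ 1 <= K * B2) &
  (exists2 k : C, modc k ^+ 2 = K &
     forall a : A i, vv rho y a = k * vv rho x a * cexp (ell rho x a (y - x))) /\
  forall a : A i, weight rho y a =
    K * weight rho x a * expR (2 * complex.Re (ell rho x a (y - x))).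
Proof.
have [k k0 vyE] := vv_recenter x y i.
have wE (a : A i) : weight rho y a = modc k ^+ 2 * weight rho x a *
    expR (2 * complex.Re (ell rho x a (y - x))).
  rewrite -!sqr_vv vyE !modcM modc_cexp !exprMn; congr (_ * _).
  by rewrite mulr2n mulrDl mul1r expRD -expr2.
have K0 : 0 < modc k ^+ 2 by rewrite exprn_gt0// lt_def modc_eq0 k0 modc_ge0.
pose Z := \sum_(a : A i) weight rho x a * expR (2 * complex.Re (ell rho x a (y - x))).
have KZ : modc k ^+ 2 * Z = 1.
  by rewrite -(sum_weight A0 rho0 i y) mulr_sumr; apply: eq_bigr => a _; rewrite wE mulrA.
have sumRe : \sum_(a : A i) weight rho x a * complex.Re (ell rho x a (y - x)) = 0.
  have := sum_weight_ell A0 rho0 x i (y - x) => /(congr1 (@complex.Re R)).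
  rewrite raddf_sum /= => H; rewrite -[RHS]H; apply: eq_bigr => a _.
  by case: (ell _ _ _ _) => a1 a2 /=; rewrite mul0r subr0.
have sumRe' c : \sum_(a : A i) weight rho x a * (c + 2 * complex.Re (ell rho x a (y - x))) = c.
  under eq_bigr do rewrite mulrDr (mulrCA _ 2).
  by rewrite big_split /= -mulr_suml (sum_weight A0 rho0) mul1r -mulr_sumr sumRe mulr0 addr0.
have Z1 : 1 <= Z.
  rewrite -[leLHS]sumRe'; apply: ler_sum => a _; rewrite ler_wpM2l//.
  exact: expR_ge1Dx.
have ZB : Z <= B2.
  rewrite /B2 /E (_ : _ - _ = 1 + (expR (2 * r) - 1 - 2 * r)); last first.
    by rewrite mulr2n mulrDl mul1r expRD expr2; ring.
  rewrite -[leRHS]sumRe'; apply: ler_sum => a _; rewrite ler_wpM2l//.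
  rewrite addrAC; apply: expR_le_quad_sym; rewrite normrM ger0_norm//.
  by rewrite ler_wpM2l// (le_trans (Re_le_modc _)).
exists (modc k ^+ 2); split => //.
- split; first by rewrite -KZ ler_peMr// ltW.
  by rewrite -{1}KZ ler_wpM2l// ltW.
- by exists k.
Qed.

Let B2_ge1 : (0 < n)%N -> 1 <= B2.
Proof.
move=> n0; have [K [K0 [K1 KB]] _] := weight_recenter (Ordinal n0).
rewrite (le_trans KB)// -[leRHS]mul1r ler_wpM2r//.
by have := lt_le_trans ltr01 KB; rewrite pmulr_rgt0// => /ltW.
Qed.

(** The squared norm at [y] is a variance, so [ell y a] may be replaced by the shifted [ell x a];
    what remains is the ratio of weights, at most [E ^+ 2]. *)
Lemma local_norm_i_recenter i u :
  local_norm_i rho i y u <= E * local_norm_i rho i x u.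
Proof.
have E0 : 0 <= E := expR_ge0 _.
apply: le_of_sqr; first by apply: mulr_ge0 => //; exact: local_norm_i_ge0.
have -> : (E * local_norm_i rho i x u) ^+ 2 = E ^+ 2 * local_norm_i rho i x u ^+ 2.
  exact: exprMn.
apply: (sqr_le_eq (sqr_lni i y u) (sqr_lni i x u)).
have [d dE] := ell_recenter x y i.
apply: (@le_trans _ _ (\sum_(a : A i) weight rho y a * modc (ell rho x a u) ^+ 2)).
  apply: le_trans (variance_le (d u) (weight_ge0 y (i := i)) (sum_weight A0 rho0 i y)
    (sum_weight_ell A0 rho0 y i u)) _.
  by apply: ler_sum => a _; rewrite -dE.
have [K [K0 [K1 KB]] [_ wE]] := weight_recenter i.
rewrite mulr_sumr; apply: ler_sum => a _; rewrite mulrA; apply: ler_wpM2r; first exact: sqr_ge0.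
rewrite wE mulrC; apply: ler_pM; first exact: expR_ge0.
- exact: mulr_ge0 (ltW K0) (weight_ge0 x a).
- rewrite /E expr2 -expRD ler_expR.
  have := le_trans (ler_norm _) (le_trans (Re_le_modc _) (xyr a)); lra.
- by apply: ler_piMl => //; exact: weight_ge0.
Qed.

Lemma local_norm_i_recenterV i u :
  local_norm_i rho i x u ^+ 2 <= E ^+ 2 * B2 * local_norm_i rho i y u ^+ 2.
Proof.
have E0 : 0 <= E := expR_ge0 _.
apply: (sqr_le_eq (sqr_lni i x u) (sqr_lni i y u)).
have [d dE] := ell_recenter y x i.
apply: (@le_trans _ _ (\sum_(a : A i) weight rho x a * modc (ell rho y a u) ^+ 2)).
  apply: le_trans (variance_le (d u) (weight_ge0 x (i := i)) (sum_weight A0 rho0 i x)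
    (sum_weight_ell A0 rho0 x i u)) _.
  by apply: ler_sum => a _; rewrite -dE.
have [K [K0 [K1 KB]] [_ wE]] := weight_recenter i.
rewrite mulr_sumr; apply: ler_sum => a _; rewrite mulrA; apply: ler_wpM2r; first exact: sqr_ge0.
set s := complex.Re (ell rho x a (y - x)).
have sr : 0 <= r + s.
  by have := le_trans (ler_norm (- s)) (le_trans _ (xyr a)); rewrite normrN => /(_ (Re_le_modc
    _)); lra.
have B0 : 0 <= B2 by have := lt_le_trans ltr01 KB; rewrite pmulr_rgt0// => /ltW.
have e1 : 1 <= E ^+ 2 * expR (2 * s).
  by rewrite -[leLHS]expR0 /E expr2 -!expRD ler_expR; lra.
rewrite wE -/s (_ : _ * _ * (_ * _) = (K * B2) * (E ^+ 2 * expR (2 * s)) * weight rho x a);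
  last by ring.
by rewrite ler_peMl// -[leLHS]mul1r ler_pM.
Qed.

Lemma ell_recenter_le i (a : A i) u :
  modc (ell rho x a u - ell rho y a u) <= (E ^+ 2 - 1) * local_norm_i rho i x u.
Proof.
have [d dE] := ell_recenter x y i.
have [K [K0 [K1 KB]] [_ wE]] := weight_recenter i.
(* The shift of the momentum is the mean of [ell x] under the weights at [y]. Subtracting [K] times
   its zero mean at [x] leaves weight differences of relative size at most [E ^+ 2 - 1]. *)
have -> : ell rho x a u - ell rho y a u = \sum_(b : A i) (weight rho y b - K * weight rho x
  b)%:C * ell rho x b u.
  transitivity (\sum_(b : A i) (weight rho y b)%:C * ell rho x b u); last first.
    transitivity (\sum_(b : A i) (weight rho y b)%:C * ell rho x b u -
        K%:C * \sum_(b : A i) (weight rho x b)%:C * ell rho x b u).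
      by rewrite (sum_weight_ell A0 rho0) mulr0 subr0.
    rewrite mulr_sumr -sumrB; apply: eq_bigr => b _.
    by rewrite mulrA -rmorphM -mulrBl -rmorphB.
  rewrite dE addrAC subrr add0r (eq_bigr (fun b => (weight rho y b)%:C * ell rho y b u +
    (weight rho y b)%:C * d u)); last first.
    by move=> b _; rewrite dE mulrDr.
  by rewrite big_split /= (sum_weight_ell A0 rho0) add0r -mulr_suml -rmorph_sum /= (sum_weight
    A0 rho0) mul1r.
apply: (le_trans (modc_sum _ _ _)).
have E1 : 0 <= E ^+ 2 - 1.
  rewrite subr_ge0 -[leLHS]expR0 /E expr2 -expRD ler_expR.
  by have := le_trans (modc_ge0 _) (xyr a); lra.
apply: (@le_trans _ _ (\sum_(b : A i) (E ^+ 2 - 1) * (modc (vv rho x b) * (modc (vv rho x b) *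
  modc (ell rho x b u))))).
  apply: ler_sum => b _; rewrite modcM modc_real wE (mulrA (modc (vv rho x b))) -expr2 sqr_vv
    mulrA.
  apply: ler_wpM2r; first exact: modc_ge0.
  have Kw : 0 <= K * weight rho x b := mulr_ge0 (ltW K0) (weight_ge0 x b).
  rewrite -[X in `|_ - X|]mulr1 -mulrBr normrM (ger0_norm Kw) mulrC.
  apply: ler_pM => //; last by apply: ler_piMl => //; exact: weight_ge0.
  rewrite /E expr2 -expRD; apply: norm_expR_sub1; rewrite normrM ger0_norm//.
  by have := le_trans (Re_le_modc _) (xyr b); lra.
rewrite -mulr_sumr ler_wpM2l//; apply: (le_trans (l2_CS _ _)).
rewrite lniE -[leRHS]mul1r; apply: ler_wpM2r; first exact: l2_ge0.
apply: le_of_sqr => //; rewrite sqr_l2 expr1n -(sum_weight A0 rho0 i x).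
by under eq_bigr do rewrite sqr_vv.
Qed.

Variable b : R.
Hypotheses (b0 : 0 <= b) (Bb : B2 <= b ^+ 2).

Lemma local_norm_recenter u : local_norm rho y u <= E * local_norm rho x u.
Proof.
rewrite -[leRHS](l2Z (fun i => local_norm_i rho i x u)) ?expR_ge0//; apply: l2_le => i.
by rewrite ger0_norm ?local_norm_i_ge0// local_norm_i_recenter.
Qed.

(** [b] is a convenient upper bound for the square root of [B2]; in all uses it is 21/20. *)
Lemma local_norm_i_recenterb i u : local_norm_i rho i x u <= E * b * local_norm_i rho i y u.
Proof.
have E0 : 0 <= E := expR_ge0 _.
have L0 := local_norm_i_ge0 rho i y u.
apply: le_of_sqr; first by rewrite !mulr_ge0.
apply: (le_trans (local_norm_i_recenterV i u)).
rewrite (_ : (E * b * local_norm_i rho i y u) ^+ 2 =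
  E ^+ 2 * b ^+ 2 * local_norm_i rho i y u ^+ 2); last by ring.
apply: ler_wpM2r; first exact: sqr_ge0.
by apply: ler_wpM2l => //; exact: sqr_ge0.
Qed.

Lemma local_norm_recenterb u : local_norm rho x u <= E * b * local_norm rho y u.
Proof.
have E0 : 0 <= E := expR_ge0 _.
rewrite -[leRHS](l2Z (fun i => local_norm_i rho i y u)) ?mulr_ge0//; apply: l2_le => i.
by rewrite ger0_norm ?local_norm_i_ge0// local_norm_i_recenterb.
Qed.

Lemma nondegenerate_recenter : nondegenerate rho x -> nondegenerate rho y.
Proof.
move=> nd w w0; apply: nd; apply/le_anti; rewrite local_norm_ge0 andbT.
by have := local_norm_recenterb w; rewrite w0 mulr0.
Qed.

Hypothesis r0 : 0 <= r.
Let E1 : 1 <= E. Proof. by rewrite /E -expR0 ler_expR. Qed.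

Let E21 : 1 <= E ^+ 2. Proof. by rewrite exprn_ege1. Qed.

(** [N + E ^+ 2 - 1 <= E ^+ 2 * N] because [1 <= N]; the factor [E * b] comes from the passage to
    the norm at [y]. *)
Lemma nu_recenter N : 1 <= N -> nu_le rho x N -> nu_le rho y (E ^+ 3 * b * N).
Proof.
move=> N1 nN i a u.
have L0 := local_norm_i_ge0 rho i x u.
have H : modc (ell rho y a u) <= E ^+ 2 * N * local_norm_i rho i x u.
  apply: (le_trans (modc_le_distr (ell rho x a u) _)).
  apply: (le_trans (lerD (nN _ _ _) (ell_recenter_le a u))).
  rewrite -mulrDl; apply: ler_wpM2r => //.
  rewrite -subr_ge0 (_ : _ - _ = (E ^+ 2 - 1) * (N - 1)); last by ring.
  by apply: mulr_ge0; rewrite subr_ge0.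
apply: (le_trans H); rewrite (_ : _ * b * N * _ = E ^+ 2 * N * (E * b * local_norm_i rho i y
  u)); last by ring.
apply: ler_wpM2l; last exact: local_norm_i_recenterb.
by apply: mulr_ge0; [exact: sqr_ge0|exact: le_trans ler01 N1].
Qed.

Lemma nu_recenterV N : 1 <= N -> nu_le rho y N -> nu_le rho x ((E + E ^+ 2 - 1) * N).
Proof.
move=> N1 nN i a u.
have L0 := local_norm_i_ge0 rho i x u.
apply: (le_trans (modc_le_distl _ (ell rho y a u))).
apply: (@le_trans _ _ (N * (E * local_norm_i rho i x u) + (E ^+ 2 - 1) * local_norm_i rho i x u)).
  apply: lerD; last exact: ell_recenter_le.
  by apply: (le_trans (nN _ _ _)); apply: ler_wpM2l; [exact: le_trans ler01 N1|exact:
    local_norm_i_recenter].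
rewrite mulrA -mulrDl; apply: ler_wpM2r => //.
rewrite -subr_ge0 (_ : _ - _ = (E ^+ 2 - 1) * (N - 1)); last by ring.
by apply: mulr_ge0; rewrite subr_ge0.
Qed.

Section Condition.
Variable f : system A.
Hypothesis f0 : forall i, f i != 0.
Let cexp_row : forall i, A i -> C := fun i a => cexp (ell rho x a (y - x)).

Let DS_row w i : exists k d : C, [/\ modc k <= 1, 1 <= modc k * b,
  modc d <= (E ^+ 2 - 1) * local_norm_i rho i x w &
  (DS_op rho f y *m w) i 0 = k * ((DS_op rho f x *m w) i 0 +
    rowsum rho f x (fun i a => (cexp (ell rho x a (y - x)) - 1) * ell rho x a w) i -
    d * rowsum rho f x cexp_row i)].
Proof.
have [d dE] := ell_recenter x y i.
have [K [K0 [K1 KB]] [[k kK vyE] _]] := weight_recenter i.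
exists k, (d w); split.
- by apply: le_of_sqr => //; rewrite kK expr1n.
- apply: le_of_sqr; first by rewrite mulr_ge0 ?modc_ge0.
  by rewrite expr1n exprMn kK (le_trans KB)// ler_wpM2l// ltW.
- have /fset0Pn[a aA] := A0 i; have := ell_recenter_le [` aA]%fset w.
  by rewrite dE addrAC subrr add0r.
- apply: (etrans (DS_opE rho f y w i)); rewrite [X in k * (X + _ - _)](DS_opE rho f x w i).
  rewrite /rowsum mulr_sumr -big_split /= -sumrB mulr_sumr.
  apply: eq_bigr => a _.
  have ey : ell rho y a w = ell rho x a w - d w by rewrite (dE a w) addrK.
  by rewrite vyE ey; exact: recenter_identity.
Qed.

Let cexp_row_le w i : modc (rowsum rho f x (fun i a =>
    (cexp (ell rho x a (y - x)) - 1) * ell rho x a w) i) / coords_norm (f i) <=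
  (E - 1) * local_norm_i rho i x w.
Proof.
apply: rowsum_le_norm => //; first by rewrite subr_ge0.
move=> a; rewrite modcM; apply: ler_wpM2r; first exact: modc_ge0.
by apply: (le_trans (cexp_bound1 _)); rewrite lerD2r ler_expR.
Qed.

(** [eps] bounds the normalized equations at [y], which enter through the shift of the momentum. It
    will be 0 when [y] is a solution, of second order when [y] is a Newton iterate, and [E - 1] when
    [x] is a solution. *)
Lemma dn_recenter (eps : R) w : 0 <= eps ->
    (forall i, modc (rowsum rho f x cexp_row i) <= eps * coords_norm (f i)) ->
  dn rho f x w <= b * dn rho f y w +
    (E - 1 + (E ^+ 2 - 1) * eps) * local_norm rho x w.
Proof.
move=> eps0 Seps; set c := E - 1 + _.
have c0' : 0 <= E ^+ 2 - 1 by rewrite subr_ge0.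
have c0 : 0 <= c by rewrite /c addr_ge0 ?subr_ge0// mulr_ge0.
have H i : modc ((DS_op rho f x *m w) i 0) / coords_norm (f i) <=
    b * (modc ((DS_op rho f y *m w) i 0) / coords_norm (f i)) + c * local_norm_i rho i x w.
  have cf := coords_norm_gt0 (f0 i).
  have [k [d [k1 kb dle Dy]]] := DS_row w i.
  exact: (recenter_row_le cf kb dle (cexp_row_le w i) (Seps i) Dy).
rewrite -[X in _ <= _ + X](l2Z (fun i => local_norm_i rho i x w))// -l2Z//.
apply: l2_triangle => i.
by rewrite ger0_norm ?divr_ge0 ?modc_ge0 ?l2_ge0.
Qed.

Lemma dn_recenterV w : solution_variety rho f y ->
  dn rho f y w <= dn rho f x w + (E - 1) * local_norm rho x w.
Proof.
move=> fy; have E10 : 0 <= E - 1 by rewrite subr_ge0.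
rewrite -[X in _ <= _ + X](l2Z (fun i => local_norm_i rho i x w))//.
apply: l2_triangle => i; rewrite ger0_norm ?divr_ge0 ?modc_ge0 ?l2_ge0//.
have cf := coords_norm_gt0 (f0 i).
have [k [d [k1 kb dle Dy]]] := DS_row w i.
exact: (recenter_row_leV cf k1 (cexp_row_le w i) (solution_S_op x fy i) Dy).
Qed.

Lemma cond_recenter (eps M : R) : 0 <= eps -> 0 < M ->
    (forall i, modc (rowsum rho f x cexp_row i) <= eps * coords_norm (f i)) ->
    cond_le rho f x M -> M * (E - 1 + (E ^+ 2 - 1) * eps) < 1 ->
  cond_le rho f y (M * E * b / (1 - M * (E - 1 + (E ^+ 2 - 1) * eps))).
Proof.
move=> eps0 M0 Seps cM; set c := E - 1 + _ => q1 w.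
exact: (condition_transfer M0 (expR_ge0 _) q1 (cM w) (local_norm_recenter w)
  (dn_recenter w eps0 Seps)).
Qed.

(** Here [y] is the solution and a bound at [x] is wanted. A provisional bound [M] may appear on the
    right, since it is multiplied by the small [E - 1]. *)
Lemma cond_recenterV (M M' : R) : solution_variety rho f y -> 0 <= M' ->
    cond_le rho f x M -> cond_le rho f y M' ->
  cond_le rho f x (E * b * M' * (1 + M * (E - 1))).
Proof.
move=> fy M'0 cM cM' w.
have e0 : 0 <= E - 1 by rewrite subr_ge0.
exact: (condition_transferV (expR_ge0 _) b0 M'0 e0 (local_norm_recenterb w) (cM' w)
  (dn_recenterV w fy) (cM w)).
Qed.

End Condition.
End Bounds.
End Recentering.

(** * The condition numbers as least bounds *)

Section Bridge.
Variables (R : realType) (n : nat) (A : 'I_n -> {fset 'rV[R]_n}).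
Variable rho : forall i, A i -> R.
Arguments rho : clear implicits.
Hypothesis A0 : forall i, A i != fset0.
Hypothesis rho0 : forall i a, 0 < rho i a.
Local Notation C := R[i].
Implicit Types (x y u w : 'cV[C]_n) (i : 'I_n) (f : system A).
Local Open Scope complex_scope.

Let lniE i x u : local_norm_i rho i x u =
    l2 (fun a : A i => modc (vv rho x a) * modc (ell rho x a u)).
Proof. exact: local_norm_iE. Qed.

Lemma canonical_normE (v : 'cV[C]_n) : canonical_norm v = l2 (fun j => modc (v j 0)).
Proof. by []. Qed.

Lemma dn_invmx f x (v : 'cV[C]_n) : (forall i, f i != 0) -> DS_op rho f x \in unitmx ->
  dn rho f x (invmx (DS_op rho f x) *m diag_mx (\row_i (coords_norm (f i))%:C) *m v) =
  canonical_norm v.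
Proof.
move=> f0 D; rewrite canonical_normE; apply: eq_l2 => i.
rewrite -mulmxA mulKVmx// mul_diag_mx !mxE modcM modc_real ger0_norm ?l2_ge0//.
by rewrite mulrAC divff ?mul1r// gt_eqF// coords_norm_gt0.
Qed.

Lemma unit_vector_of f x w : (forall i, f i != 0) -> DS_op rho f x \in unitmx ->
  invmx (DS_op rho f x) *m diag_mx (\row_i (coords_norm (f i))%:C) *m
    (\col_i ((DS_op rho f x *m w) i 0 / (coords_norm (f i))%:C)) = w.
Proof.
move=> f0 D; rewrite -[RHS](mulKmx D) -mulmxA; congr (_ *m _).
apply/matrixP => i j; rewrite [j]ord1 mul_diag_mx [LHS]mxE [X in X * _]mxE [X in _ * X]mxE.
by rewrite mulrC divfK// -modc_eq0 modc_real normr_eq0 gt_eqF// coords_norm_gt0.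
Qed.

Lemma local_norm_sum x (I : Type) (s : seq I) (F : I -> 'cV[C]_n) :
  local_norm rho x (\sum_(i <- s) F i) <= \sum_(i <- s) local_norm rho x (F i).
Proof.
elim/big_rec2: _ => [|i r w _ H]; first by rewrite local_norm0.
exact: le_trans (local_normD _ _ _ _) (lerD (lexx _) H).
Qed.

Lemma mulmx_local_norm_bound x (B : 'M[C]_n) : exists2 K, 0 <= K &
  forall v, local_norm rho x (B *m v) <= K * canonical_norm v.
Proof.
exists (\sum_j local_norm rho x (col j B)); first by apply: sumr_ge0 => *; exact: local_norm_ge0.
move=> v; rewrite (_ : B *m v = \sum_j v j 0 *: col j B); last first.
  apply/matrixP => i k; rewrite [k]ord1 mxE summxE; apply: eq_bigr => j _.
  by rewrite !mxE mulrC.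
apply: (le_trans (local_norm_sum _ _ _)); rewrite mulr_suml; apply: ler_sum => j _.
rewrite local_normZ mulrC; apply: ler_wpM2l; first exact: local_norm_ge0.
by rewrite -[leLHS]ger0_norm ?modc_ge0//; exact: (ler_l2 (fun j => modc (v j 0))).
Qed.

(** The column bound makes the supremum finite, and it also covers the vectors of canonical norm 0,
    which cannot be normalized. *)
Lemma mu_spec f x : (forall i, f i != 0) -> DS_op rho f x \in unitmx ->
  [/\ mu rho f x = (fine (mu rho f x))%:E, 0 <= fine (mu rho f x),
    cond_le rho f x (fine (mu rho f x)) &
    forall M, 0 <= M -> cond_le rho f x M -> fine (mu rho f x) <= M].
Proof.
move=> f0 D; rewrite /mu D; set B := invmx _ *m _; set s := ereal_sup _.
have ub M : 0 <= M -> cond_le rho f x M -> (s <= M%:E)%E.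
  move=> M0 cM; apply: ge_ereal_sup => _ [v v1 <-]; rewrite lee_fin.
  apply: (le_trans (cM _)); rewrite dn_invmx//.
  by rewrite -[leRHS]mulr1 ler_wpM2l.
have s0 : (0 <= s)%E.
  apply: ereal_sup_ubound; exists 0; last by rewrite mulmx0 local_norm0.
  by rewrite /= canonical_normE (@eq_l2 _ _ _ (fun=> 0)) ?l2_0// => i; rewrite mxE modc0.
have [K K0 HK] := mulmx_local_norm_bound x B.
have cond_of M : 0 <= M ->
    (forall v, canonical_norm v <= 1 -> local_norm rho x (B *m v) <= M) -> cond_le rho f x M.
  move=> M0 HM w; have := unit_vector_of w f0 D; rewrite -/B; set v := \col_i _ => Bv.
  have := dn_invmx v f0 D; rewrite -/B Bv => ->.
  have c0 : 0 <= canonical_norm v by exact: l2_ge0.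
  have [c0'|cn] := eqVneq (canonical_norm v) 0.
    by have := HK v; rewrite Bv c0' !mulr0.
  have cp : 0 < canonical_norm v by rewrite lt_neqAle eq_sym cn.
  have cvE : canonical_norm ((canonical_norm v)^-1%:C *: v) = 1.
    rewrite canonical_normE (@eq_l2 _ _ _ (fun j => (canonical_norm v)^-1 * modc (v j 0))).
      by rewrite l2Z ?invr_ge0// -canonical_normE mulVf.
    by move=> j; rewrite mxE modcM modc_real ger0_norm// invr_ge0.
  have := HM _ (_ : canonical_norm ((canonical_norm v)^-1%:C *: v) <= 1).
  rewrite cvE lexx => /(_ isT); rewrite -scalemxAr Bv local_normZ modc_real ger0_norm ?invr_ge0//.
  by rewrite mulrC ler_pdivrMr.
have sK : (s <= K%:E)%E.
  apply: ub => //; apply: cond_of => // v v1; apply: (le_trans (HK v)).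
  by rewrite -[leRHS]mulr1 ler_wpM2l.
have sfin : s = (fine s)%:E.
  by rewrite fineK// fin_numElt (lt_le_trans _ s0)// (le_lt_trans sK) ?ltry.
have fs0 : 0 <= fine s by exact: fine_ge0.
split => //.
  apply: cond_of => // v v1; rewrite -lee_fin -sfin; apply: ereal_sup_ubound.
  by exists v.
by move=> M M0 cM; rewrite -lee_fin -sfin; exact: ub.
Qed.

Lemma ell_le_local_norm i x (a : A i) u :
  modc (ell rho x a u) <= (modc (vv rho x a))^-1 * local_norm_i rho i x u.
Proof.
have v0 : 0 < modc (vv rho x a).
  by rewrite lt_def modc_ge0 andbT -sqrf_eq0 sqr_modc_vv// gt_eqF// weight_gt0.
rewrite mulrC ler_pdivlMr// lniE mulrC.
by rewrite -[leLHS]ger0_norm ?mulr_ge0 ?modc_ge0//;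
  exact: (ler_l2 (fun a : A i => modc (vv rho x a) * modc (ell rho x a u))).
Qed.

(** Positive weights bound each [ell] by the norm, so the maximum is finite; [0 < n] excludes the
    value [-oo] of a maximum over no index. *)
Lemma nu_spec x : (0 < n)%N ->
  [/\ nu rho x = (fine (nu rho x))%:E, 0 <= fine (nu rho x), nu_le rho x (fine (nu rho x)) &
    forall N, 0 <= N -> nu_le rho x N -> fine (nu rho x) <= N].
Proof.
move=> n0; set s := nu rho x.
have ub N : 0 <= N -> nu_le rho x N -> (s <= N%:E)%E.
  move=> N0 nN; apply/bigmax_leP; split => [|i _]; first exact: leNye.
  apply/bigmax_leP; split => [|a _]; first exact: leNye.
  apply: ge_ereal_sup => _ [u u1 <-]; rewrite lee_fin.
  by apply: (le_trans (nN i a u)); rewrite -[leRHS]mulr1 ler_wpM2l.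
have lb i (a : A i) u : local_norm_i rho i x u <= 1 -> ((modc (ell rho x a u))%:E <= s)%E.
  move=> u1; apply: (@le_trans _ _ (nu_i rho i x)); last by apply: le_bigmax.
  apply: (@le_trans _ _ (ereal_sup [set (modc (ell rho x a u))%:E | u in
    [set u | local_norm_i rho i x u <= 1]])); first by apply: ereal_sup_ubound; exists u.
  exact: (le_bigmax _ (fun a : A i => ereal_sup [set (modc (ell rho x a u))%:E | u in
    [set u | local_norm_i rho i x u <= 1]]) a).
have lni0 i : local_norm_i rho i x 0 = 0.
  rewrite lniE (@eq_l2 _ _ _ (fun=> 0)) ?l2_0// => a.
  by rewrite /ell covec0 modc0 mulr0.
have s0 : (0 <= s)%E.
  have /fset0Pn[a aA] := A0 (Ordinal n0).
  apply: le_trans (lb _ [` aA]%fset 0 _); rewrite ?lee_fin ?modc_ge0//.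
  by rewrite lni0.
have sK : (s <= (\sum_i \sum_(a : A i) (modc (vv rho x a))^-1)%:E)%E.
  have g0 i (a : A i) : 0 <= (modc (vv rho x a))^-1 by rewrite invr_ge0 modc_ge0.
  apply: ub; first by apply: sumr_ge0 => i _; apply: sumr_ge0.
  move=> i a u; apply: (le_trans (ell_le_local_norm _ _ _)).
  rewrite ler_wpM2r ?local_norm_i_ge0// (bigD1 i)//= (bigD1 a)//= -addrA lerDl.
  by rewrite addr_ge0 ?sumr_ge0// => j _; rewrite sumr_ge0.
have sfin : s = (fine s)%:E.
  by rewrite fineK// fin_numElt (lt_le_trans _ s0)// (le_lt_trans sK) ?ltry.
have fs0 : 0 <= fine s by exact: fine_ge0.
split => // [i a u|N N0 nN]; last by rewrite -lee_fin -sfin; exact: ub.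
have u0 := local_norm_i_ge0 rho i x u.
have [u00|un] := eqVneq (local_norm_i rho i x u) 0.
  by have := ell_le_local_norm x a u; rewrite u00 !mulr0.
have up : 0 < local_norm_i rho i x u by rewrite lt_neqAle eq_sym un.
have := lb i a ((local_norm_i rho i x u)^-1%:C *: u).
rewrite local_norm_iZ modc_real ger0_norm ?invr_ge0// mulVf// lexx => /(_ isT).
rewrite sfin lee_fin ellZ modcM modc_real ger0_norm ?invr_ge0//.
by rewrite mulrC ler_pdivrMr.
Qed.

Let sum_sqr_le (x : 'cV[C]_n) i (u : 'cV[C]_n) N : 0 <= N ->
  (forall a : A i, modc (ell rho x a u) <= N * local_norm_i rho i x u) ->
  local_norm_i rho i x u <= N * local_norm_i rho i x u.
Proof.
move=> N0 H; have u0 := local_norm_i_ge0 rho i x u.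
apply: le_of_sqr; first exact: mulr_ge0.
rewrite {1}lniE sqr_l2 -[leRHS]mul1r -(sum_weight A0 rho0 i x) mulr_suml.
apply: ler_sum => a _; rewrite exprMn sqr_modc_vv//.
apply: ler_wpM2l; first by apply/ltW/weight_gt0.
by apply: lerXn2r => //; rewrite nnegrE ?modc_ge0 ?mulr_ge0.
Qed.

Lemma nondegenerate_local_norm_gt0 x : (0 < n)%N -> nondegenerate rho x ->
  exists u i, 0 < local_norm_i rho i x u.
Proof.
move=> n0 nd; pose u : 'cV[C]_n := const_mx 1.
have u0 : u != 0.
  apply/eqP => /matrixP/(_ (Ordinal n0) 0); rewrite !mxE => /eqP; by rewrite oner_eq0.
exists u; apply: contrapT => /forallNP H.
have H0 i : local_norm_i rho i x u = 0.
  by apply/le_anti; rewrite local_norm_i_ge0 andbT leNgt; apply/negP; exact: H.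
move/eqP: u0; apply; apply: nd; rewrite local_normE (@eq_l2 _ _ _ (fun=> 0)) ?l2_0//.
Qed.

(** [local_norm_i] is a root mean square of the values of [ell], hence at most their maximum. *)
Lemma one_le_of_nu_le x N : (0 < n)%N -> nondegenerate rho x -> 0 <= N ->
  nu_le rho x N -> 1 <= N.
Proof.
move=> n0 nd N0 nN; have [u [i ui]] := nondegenerate_local_norm_gt0 n0 nd.
have := sum_sqr_le N0 (fun a => nN i a u).
by rewrite -{1}[local_norm_i _ _ _ _]mul1r ler_pM2r.
Qed.

(** By Cauchy-Schwarz [dn] is at most the local norm, so no factor below 1 can reverse the
    inequality. *)
Lemma one_le_of_cond_le f x M : (0 < n)%N -> (forall i, f i != 0) -> nondegenerate rho x ->
  cond_le rho f x M -> 1 <= M.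
Proof.
move=> n0 f0 nd cM; have [u [i ui]] := nondegenerate_local_norm_gt0 n0 nd.
have up : 0 < local_norm rho x u := lt_le_trans ui (local_norm_i_le _ _ _ _).
have dl := dn_le rho x u f0; have d0 := dn_ge0 rho f x u.
have cu := cM u; rewrite leNgt; apply/negP => M1.
have [M0|M0] := leP 0 M; last first.
  by have := lt_le_trans up cu; apply/negP; rewrite -leNgt; apply: mulr_le0_ge0 => //; exact: ltW.
have : M * dn rho f x u <= M * local_norm rho x u by rewrite ler_wpM2l.
have : M * local_norm rho x u < 1 * local_norm rho x u by rewrite ltr_pM2r.
lra.
Qed.

Lemma covec_delta (a : 'rV[R]_n) j : covec a (delta_mx j 0 : 'cV[C]_n) = (a 0 j)%:C.
Proof.
rewrite /covec (bigD1 j)//= big1 => [|k kj]; first by rewrite [delta_mx _ _ _ _]mxE !eqxx mulr1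
  addr0.
by rewrite [delta_mx _ _ _ _]mxE (negbTE kj) mulr0.
Qed.

(** For singular [DS_op] the product can differ from [+oo] only if nu vanishes. Then every exponent
    of [A i] equals the momentum, so [f i] has a single term, and that term has no zero. *)
Lemma unit_of_not_Sigma' f x : (0 < n)%N -> (forall i, f i != 0) ->
  solution_variety rho f x -> ~ Sigma' rho f x -> DS_op rho f x \in unitmx.
Proof.
move=> n0 f0 fx; apply: contra_notT => D; rewrite /Sigma' /mu (negbTE D).
have [nuE N0 nN _] := nu_spec x n0; rewrite nuE.
have [Np|] := ltP 0 (fine (nu rho x)); first by rewrite gt0_mulye// lte_fin.
move=> Nle; have N00 : fine (nu rho x) = 0 by apply/le_anti; rewrite Nle N0.
have ell0 i (a : A i) u : ell rho x a u = 0.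
  by apply/eqP; rewrite -modc_eq0 eq_le modc_ge0 andbT; have := nN i a u; rewrite N00 mul0r.
have am i (a : A i) : val a = momentum rho i x.
  apply/eqP; rewrite -subr_eq0; apply/eqP/matrixP => k j; rewrite [k]ord1 [RHS]mxE.
  have := ell0 i a (delta_mx j 0); rewrite /ell covec_delta => /eqP.
  by rewrite -modc_eq0 modc_real normr_eq0 => /eqP.
exfalso; pose i := Ordinal n0; move/eqP: (f0 i); apply; apply/ffunP => a.
have := fx i; rewrite /pairing (bigD1 a)//= big1 => [|b ba]; last first.
  by case/eqP: ba; apply: val_inj; rewrite !am.
rewrite addr0 !ffunE => /eqP; rewrite mulf_eq0 => /orP[|/eqP//].
by rewrite mulf_eq0 (negbTE (cexp_neq0 _)) orbF -modc_eq0 modc_real normr_eq0 gt_eqF.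
Qed.

End Bridge.

Lemma eq_l2_div (R : realType) (I : finType) (F G : I -> R[i]) (c : I -> R) :
  (forall i, modc (F i) = modc (G i)) ->
  l2 (fun i => modc (F i) / c i) = l2 (fun i => modc (G i) / c i).
Proof. by move=> FG; apply: eq_l2 => i; rewrite FG. Qed.

(** mu and nu are determined by their upper bounds, so invariance of the inequalities under periods
    gives invariance of the numbers. *)
Lemma least_unique (R : realType) (P Q : R -> Prop) (a b : \bar R) :
    (forall M, Q M <-> P M) ->
    [/\ a = (fine a)%:E, 0 <= fine a, P (fine a) & forall M, 0 <= M -> P M -> fine a <= M] ->
    [/\ b = (fine b)%:E, 0 <= fine b, Q (fine b) & forall M, 0 <= M -> Q M -> fine b <= M] ->
  b = a.
Proof.
move=> QP [-> a0 Pa mina] [-> b0 Qb minb]; congr EFin; apply/le_anti/andP; split.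
  by apply: minb => //; apply/QP.
by apply: mina => //; apply/QP.
Qed.

(** * Periods and the distance on the quotient *)

Section Lattice.
Variables (R : realType) (n : nat) (A : 'I_n -> {fset 'rV[R]_n}).
Variable rho : forall i, A i -> R.
Arguments rho : clear implicits.
Hypothesis A0 : forall i, A i != fset0.
Hypothesis rho0 : forall i a, 0 < rho i a.
Local Notation C := R[i].
Implicit Types (x y u w : 'cV[C]_n) (i : 'I_n) (f : system A).
Local Open Scope complex_scope.

(* translations that preserve every point of the quotient *)
Definition period w := forall i, exists c : C, forall a : A i, cexp (covec (val a) w) = c.

Lemma same_point_period y y' : same_point rho y y' -> period (y' - y).
Proof.
move=> yy i; have [c _ H] := yy i; exists c => a.
have r0 : (rho i a)%:C != 0 by rewrite -modc_eq0 modc_real normr_eq0 gt_eqF.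
have := H a; rewrite !ffunE mulrCA => /(mulfI r0) e.
by rewrite covecD covecN cexpD cexpN e mulfK// cexp_neq0.
Qed.

Lemma period_same_point y w : period w -> same_point rho y (y + w).
Proof.
move=> pw i; have [c H] := pw i; exists c.
  by have /fset0Pn[a aA] := A0 i; rewrite -(H [` aA]%fset) cexp_neq0.
by move=> a; rewrite !ffunE covecD cexpD H; ring.
Qed.

Lemma periodB w w' : period w -> period w' -> period (w - w').
Proof.
move=> pw pw' i; have [c H] := pw i; have [c' H'] := pw' i; exists (c / c') => a.
by rewrite covecD covecN cexpD cexpN H H'.
Qed.

Lemma period0 : period 0.
Proof. by move=> i; exists 1 => a; rewrite covec0 cexp0. Qed.

Lemma weight_period x w i (a : A i) : period w -> weight rho (x + w) a = weight rho x a.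
Proof.
move=> pw; have [c H] := pw i.
have E (b : A i) : expR (2 * complex.Re (covec (val b) (x + w))) =
    expR (2 * complex.Re (covec (val b) x)) * modc c ^+ 2.
  rewrite covecD -(H b) modc_cexp expr2 -expRD -expRD; congr expR; rewrite raddfD/=; ring.
have c0 : modc c != 0.
  by rewrite -(H a) modc_cexp gt_eqF// expR_gt0.
have KE : reproducing_kernel rho i (x + w) = reproducing_kernel rho i x * modc c ^+ 2.
  by rewrite mulr_suml; apply: eq_bigr => b _; rewrite E mulrA.
have K0 := reproducing_kernel_gt0 A0 rho0 i x.
rewrite /weight KE E mulrA -mulf_div divff ?mulr1// expf_neq0//.
Qed.

Lemma momentum_period x w i : period w -> momentum rho i (x + w) = momentum rho i x.
Proof. by move=> pw; apply: eq_bigr => a _; rewrite weight_period. Qed.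

Lemma ell_period x w i (a : A i) u : period w -> ell rho (x + w) a u = ell rho x a u.
Proof. by move=> pw; rewrite /ell momentum_period. Qed.

Lemma local_norm_i_period x w i u : period w ->
  local_norm_i rho i (x + w) u = local_norm_i rho i x u.
Proof.
move=> pw; rewrite /local_norm_i (momentum_period x i pw).
by under eq_bigr do rewrite (weight_period x _ pw).
Qed.

Lemma local_norm_period x w u : period w -> local_norm rho (x + w) u = local_norm rho x u.
Proof. by move=> pw; apply: eq_l2 => i; exact: local_norm_i_period. Qed.

Lemma nu_le_period x w N : period w -> nu_le rho (x + w) N <-> nu_le rho x N.
Proof.
move=> pw; split=> H i a u.
  rewrite -(ell_period x a u pw) -(local_norm_i_period x i u pw); exact: H.
rewrite (ell_period x a u pw) (local_norm_i_period x i u pw); exact: H.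
Qed.

Lemma solution_period f x w : period w -> solution_variety rho f x ->
  solution_variety rho f (x + w).
Proof.
move=> pw fx i; have [c H] := pw i.
have := fx i; rewrite /pairing => e.
transitivity (c * \sum_a Veronese rho i x a * f i a); last by rewrite e mulr0.
rewrite mulr_sumr /=; apply: eq_bigr => a _.
by rewrite !ffunE covecD cexpD H; ring.
Qed.

(** The period multiplies the [i]-th row of [DS_op] by a scalar of modulus one: [cexp (ell x a w)],
    which is the same for all [a], divided by its modulus. *)
Lemma dn_period f x w u : period w -> dn rho f (x + w) u = dn rho f x u.
Proof.
move=> pw.
suff sE i : modc ((DS_op rho f (x + w) *m u) i 0) = modc ((DS_op rho f x *m u) i 0).
  exact: (eq_l2_div (fun i => coords_norm (f i)) sE).
have [c H] := pw i.
have cE (a : A i) : cexp (ell rho x a w) = cexp (- covec (momentum rho i x) w) * c.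
  by rewrite -(H a) /ell covecBl cexpD mulrC.
set d := cexp _ * c in cE.
have rE (a : A i) : renormalized rho i (x + w) (x + w) a = renormalized rho i x x a * d.
  rewrite {1}/renormalized (momentum_period x i pw) -/(renormalized rho i x (x + w)).
  by rewrite -(cE a); exact: renormalizedD.
have nE : coords_norm (renormalized rho i (x + w) (x + w)) =
    modc d * coords_norm (renormalized rho i x x).
  rewrite -l2Z ?modc_ge0//; apply: eq_l2 => a; rewrite rE modcM mulrC.
  by [].
have d0 : d != 0 by have /fset0Pn[a aA] := A0 i; rewrite -(cE [` aA]%fset) cexp_neq0.
have md0 : modc d != 0 by rewrite modc_eq0.
have vE (a : A i) : vv rho (x + w) a = d / (modc d)%:C * vv rho x a.
  by rewrite /vv nE rE invfM rmorphM/= fmorphV; ring.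
have md1 : modc (d / (modc d)%:C) = 1.
  by rewrite modcM modcV modc_real ger0_norm ?modc_ge0// divff.
have sE : (DS_op rho f (x + w) *m u) i 0 =
    d / (modc d)%:C * rowsum rho f x (fun i a => ell rho x a u) i.
  apply: (etrans (DS_opE rho f (x + w) u i)).
  rewrite /rowsum mulr_sumr; apply: eq_bigr => a _.
  by rewrite (vE a) (ell_period x a u pw) !mulrA.
apply: (etrans (congr1 (@modc R) sE)); rewrite modcM md1 mul1r.
exact: (congr1 (@modc R) (esym (DS_opE rho f x u i))).
Qed.

Lemma cond_le_period f x w M : period w -> cond_le rho f (x + w) M <-> cond_le rho f x M.
Proof.
move=> pw; split=> H u.
  rewrite -(local_norm_period x u pw) -(dn_period f x u pw); exact: H.
rewrite (local_norm_period x u pw) (dn_period f x u pw); exact: H.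
Qed.

Lemma nu_period x w : (0 < n)%N -> period w -> nu rho (x + w) = nu rho x.
Proof.
move=> n0 pw.
exact: (least_unique (fun N => nu_le_period x N pw) (nu_spec A0 rho0 x n0)
  (nu_spec A0 rho0 (x + w) n0)).
Qed.

Lemma unit_period f x w : (forall i, f i != 0) -> period w ->
  DS_op rho f x \in unitmx -> DS_op rho f (x + w) \in unitmx.
Proof.
move=> f0 pw D; have [_ _ cM _] := mu_spec f0 D.
apply: (unit_of_cond_le (M := fine (mu rho f x))); last by apply/cond_le_period.
move=> u; rewrite local_norm_period//; exact: (nondegenerate_of_unit f0 D).
Qed.

Lemma mu_period f x w : (forall i, f i != 0) -> period w ->
  DS_op rho f x \in unitmx -> mu rho f (x + w) = mu rho f x.
Proof.
move=> f0 pw D; have D' := unit_period f0 pw D.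
exact: (least_unique (fun M => cond_le_period f x M pw) (mu_spec f0 D)
  (mu_spec f0 D')).
Qed.

End Lattice.

(** With [r = modc l] the remainder bound reads [2 * r <= expR r - 1], which fails for
    [0 < r <= 8 / 10]. *)
Lemma sub_cexp_eq0 (R : realType) (l : R[i]) : modc l <= 8 / 10 -> cexp l = 1 -> l = 0.
Proof.
move=> l8 e; apply/eqP; rewrite -modc_eq0; apply/eqP.
have l0 := modc_ge0 l; have := cexp_bound2 l.
rewrite e subrr sub0r modcN; set r := modc l in l8 l0 * => H.
have s0 : 0 <= r / 4 by lra.
(* [expR_le_quad] only reaches 2/10, hence the fourth power. *)
have E4 : expR r = expR (r / 4) ^+ 4.
  by rewrite -expRM_natl -mulr_natl; congr expR; lra.
have := expR_le_quad s0; move: E4; set s := r / 4 in s0 * => E4 /(_ _)Es.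
have {}Es : expR s <= 1 + 139 / 125 * s.
  have s2 : s <= 2 / 10 by rewrite /s; lra.
  apply: (le_trans (Es s2)).
  have : s ^+ 2 <= 2 / 10 * s by rewrite expr2 ler_wpM2r.
  lra.
have rs : r = 4 * s by rewrite /s; lra.
set t := 139 / 125 * s in Es.
have t0 : 0 <= t by rewrite /t; lra.
have t1 : t <= 1 / 4 by rewrite /t /s; lra.
have Er : expR r <= (1 + t) ^+ 4.
  by rewrite E4; apply: lerXn2r; rewrite ?nnegrE ?expR_ge0 ?addr_ge0.
have P : (1 + t) ^+ 4 <= 1 + 6 * t.
  rewrite -subr_ge0 (_ : _ - _ = t * (2 - 6 * t - 4 * t ^+ 2 - t ^+ 3)); last by ring.
  have t2 : t ^+ 2 <= 1 / 16 by apply: le_trans (_ : (1/4) ^+ 2 <= _); [apply: lerXn2r; rewrite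
    ?nnegrE //; lra|lra].
  have t3 : t ^+ 3 <= 1 / 64 by apply: le_trans (_ : (1/4) ^+ 3 <= _); [apply: lerXn2r; rewrite
    ?nnegrE //; lra|lra].
  by apply: mulr_ge0 => //; lra.
have tE : t = 139 / 125 * s by []; clearbody t s; lra.
Qed.

Section LocalDist.
Variables (R : realType) (n : nat) (A : 'I_n -> {fset 'rV[R]_n}).
Variable rho : forall i, A i -> R.
Arguments rho : clear implicits.
Hypothesis A0 : forall i, A i != fset0.
Hypothesis rho0 : forall i a, 0 < rho i a.
Local Notation C := R[i].
Implicit Types (x y u w : 'cV[C]_n) (i : 'I_n) (f : system A).
Local Open Scope complex_scope.

Let dist_set x y w := [set r | exists y' z', [/\ same_point rho y y', same_point rho w z' &
                                 r = local_norm rho x (y' - z')]].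

Lemma same_point_refl y : same_point rho y y.
Proof. by rewrite -[X in same_point _ _ X]addr0; apply: period_same_point => //; exact:
  period0. Qed.

Let dist_set_lb x y w : lbound (dist_set x y w) 0.
Proof. by move=> _ [y' [z' [_ _ ->]]]; exact: local_norm_ge0. Qed.

Lemma local_dist_le x y w y' w' : same_point rho y y' -> same_point rho w w' ->
  local_dist rho x y w <= local_norm rho x (y' - w').
Proof.
move=> yy ww; apply: ge_inf; first by exists 0; exact: dist_set_lb.
by exists y', w'.
Qed.

(** Only the difference of the two representatives matters, so one translation by a period
    suffices. *)
Lemma local_dist_approx x y w (e : R) : local_dist rho x y w < e ->
  exists2 d, period A d & local_norm rho x (y + d - w) < e.
Proof.
move=> H; have [_ [y' [w' [yy ww ->]]] lt] : exists2 r, dist_set x y w r & r < e.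
  apply: (@inf_lt _ (dist_set x y w)) H.
  by exists (local_norm rho x (y - w)), y, w; split => //; exact: same_point_refl.
exists (y' - y - (w' - w)).
  by apply: periodB; exact: same_point_period yy || exact: same_point_period ww.
by rewrite (_ : _ - w = y' - w')//; apply/matrixP => i j; rewrite !mxE; ring.
Qed.

(** All [ell x b d] have the same exponential and are small, hence they are equal; their weighted
    mean is 0. *)
Lemma period_eq0 x d i (a : A i) : period A d ->
  (forall b : A i, modc (ell rho x b d) <= 4 / 10) -> ell rho x a d = 0.
Proof.
move=> pd small; have [c H] := pd i.
have lab (b : A i) : ell rho x b d = ell rho x a d.
  apply/eqP; rewrite -subr_eq0; apply/eqP/sub_cexp_eq0.
    by apply: (le_trans (modcB _ _)); have := small b; have := small a; lra.
  rewrite /ell !covecBl opprB addrA subrK cexpD cexpN !H mulfV//.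
  by rewrite -(H a) cexp_neq0.
rewrite -[LHS]mul1r -(rmorph1 (real_complex R)) -(sum_weight A0 rho0 i x) rmorph_sum mulr_suml.
rewrite -[RHS](sum_weight_ell A0 rho0 x i d).
by apply: eq_bigr => b _; rewrite (lab b).
Qed.

(** A closer pair of representatives would differ from the given one by a small period. All [ell]
    vanish on it, so it cannot change the norm. *)
Lemma local_dist_eq x y w N : nu_le rho x N -> 0 <= N -> N * local_norm rho x (y - w) <= 2 / 10 ->
  local_dist rho x y w = local_norm rho x (y - w).
Proof.
move=> nN N0 small; apply/le_anti/andP; split; first by apply: local_dist_le; exact:
  same_point_refl.
rewrite leNgt; apply/negP => /local_dist_approx[d pd lt].
have small' i (a : A i) : modc (ell rho x a d) <= 4 / 10.
  rewrite (_ : d = (y + d - w) - (y - w)); last by apply/matrixP => j k; rewrite !mxE; ring.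
  rewrite ellB; apply: (le_trans (modcB _ _)).
  have H u : N * local_norm rho x u <= 2 / 10 -> modc (ell rho x a u) <= 2 / 10.
    by apply: le_trans; apply: (le_trans (nN _ _ _)); rewrite ler_wpM2l// local_norm_i_le.
  have := H _ small; have := H (y + d - w) (le_trans (ler_wpM2l N0 (ltW lt)) small); lra.
move: lt; rewrite ltNge; apply/negP; rewrite negbK.
rewrite le_eqVlt; apply/orP; left; apply/eqP.
have E i (a : A i) : ell rho x a (y + d - w) = ell rho x a (y - w).
  by rewrite addrAC (ellD rho x a (y - w) d) (period_eq0 a pd) ?addr0//; exact: small'.
by congr Num.sqrt; apply: eq_bigr => i _; rewrite !local_norm_iE//; under eq_l2 do rewrite -E.
Qed.

End LocalDist.

(** * One Newton step *)

Section StepNumbers.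
Variable R : realType.
Implicit Types r E M : R.

(* the loss [E^5 b^2 / (1 - M c)] in the estimates of a change of center *)
Lemma recenter_loss (k M N n' c E b : R) : 0 <= N -> 0 <= n' -> 0 <= E -> M * c < 1 -> 0 <= M ->
    k * (1 - M * c) >= E ^+ 5 * b ^+ 2 ->
  2^-1 * (M * E * b / (1 - M * c)) * (E ^+ 3 * b * N) * (E * n') <= k * (2^-1 * M * N * n').
Proof.
move=> N0 n0 E0 c1 M0 H; set q := 1 - M * c in H *.
have q0 : 0 < q by rewrite subr_gt0.
rewrite (_ : 2^-1 * (M * E * b / q) * _ * _ = (2^-1 * M * N * n') * (E ^+ 5 * b ^+ 2 / q));
  last by field; rewrite gt_eqF.
rewrite mulrC; apply: ler_wpM2r; first by rewrite !mulr_ge0// invr_ge0.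
by rewrite ler_pdivrMr.
Qed.

Lemma expR_num r k e : 0 <= r -> r <= k -> k <= 2 / 10 -> 1 + k + 67 / 125 * k ^+ 2 <= e ->
  expR r <= e.
Proof.
move=> r0 rk k2 H; apply: le_trans (expR_le_quad r0 (le_trans rk k2)) _.
apply: le_trans H; have : r ^+ 2 <= k ^+ 2 by apply: lerXn2r; rewrite ?nnegrE// (le_trans r0).
lra.
Qed.

(** Expansion of [(1 + k + 67 / 125 * k ^+ 2) ^+ 2 - 2 * k]; the last coefficient rounds
    [(67 / 125) ^+ 2] up to 288/1000. *)
Lemma expR_sqr_num r k e : 0 <= r -> r <= k -> k <= 2 / 10 ->
  1 + k ^+ 2 * (2 + 72 / 1000 + 1072 / 1000 * k + 288 / 1000 * k ^+ 2) <= e ->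
  expR r ^+ 2 - 2 * r <= e.
Proof.
move=> r0 rk k2; apply: le_trans.
have E := expR_le_quad r0 (le_trans rk k2).
have : expR r ^+ 2 <= (1 + r + 67 / 125 * r ^+ 2) ^+ 2.
  by apply: lerXn2r; rewrite ?nnegrE ?expR_ge0// (le_trans _ E) ?expR_ge0.
have k0 := le_trans r0 rk.
have r2 : r ^+ 2 <= k ^+ 2 by apply: lerXn2r; rewrite ?nnegrE.
have r3 : r ^+ 3 <= k ^+ 3 by apply: lerXn2r; rewrite ?nnegrE.
have r4 : r ^+ 4 <= k ^+ 4 by apply: lerXn2r; rewrite ?nnegrE.
have p2 : 0 <= r ^+ 2 by exact: sqr_ge0.
have p4 : 0 <= k ^+ 4 by apply: exprn_ge0.
rewrite (_ : (1 + r + 67 / 125 * r ^+ 2) ^+ 2 = 1 + 2 * r + (259 / 125) * r ^+ 2 + 134 / 125 *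
  r ^+ 3 +
  (67 / 125) ^+ 2 * r ^+ 4); last by field.
rewrite (_ : 1 + k ^+ 2 * _ = 1 + (2 + 72 / 1000) * k ^+ 2 + 1072 / 1000 * k ^+ 3 + 288 / 1000
  * k ^+ 4); last by ring.
lra.
Qed.
End StepNumbers.

(** [r] bounds the change of center. It stays below 1/5 because [M * N * d = 2 * v <= 18 / 100] and
    [M * N * d'] is at most [268 / 125 * v ^+ 2]. The recentering loss will be 41/10, and
    [41 / 10 * (134 / 125) <= 9 / 2]. *)
Lemma newton_step_arith (R : realType) (M N d d' s r E eps v : R) : 1 <= M -> 1 <= N -> 0 <= d ->
    v = 2^-1 * M * N * d -> v <= 9 / 100 -> d' <= 134 / 125 * v * d -> 0 <= s -> s <= d + d' ->
    r = N * s -> (r <= 2 / 10 -> E <= 1 + r + 67 / 125 * r ^+ 2) -> 1 <= E -> eps = 67 / 125 *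
      r ^+ 2 ->
  [/\ r <= 1 / 5, M * (E - 1 + (E ^+ 2 - 1) * eps) <= 24 / 100 &
      41 / 10 * (2^-1 * M * N * d') <= 9 / 2 * v ^+ 2].
Proof.
move=> M1 N1 d0 vE v9 d'v s0 sd rE EE E1 epsE.
have MN : 0 <= M * N by apply: mulr_ge0; lra.
have v0 : 0 <= v by rewrite vE -mulrA -mulrA; apply: mulr_ge0; [lra|rewrite mulrA; exact:
  mulr_ge0].
have v2 : v ^+ 2 <= 9 / 100 * v by rewrite expr2 ler_wpM2r.
have MNd : M * N * d = 2 * v by rewrite vE; field.
have MNd' : M * N * d' <= 268 / 125 * v ^+ 2.
  have := ler_wpM2l MN d'v; rewrite (_ : M * N * (134 / 125 * v * d) = 134 / 125 * v * (M * N *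
    d)); last by ring.
  rewrite MNd; lra.
have Mr : M * r <= 1 / 5.
  by rewrite rE mulrA; apply: (le_trans (ler_wpM2l MN sd)); rewrite mulrDr MNd; lra.
have r0 : 0 <= r by rewrite rE mulr_ge0//; lra.
have rM : r <= M * r by rewrite -[leLHS]mul1r ler_wpM2r.
have r1 := le_trans rM Mr.
have M0 : 0 <= M by lra.
split; [exact: r1| |rewrite (_ : 2^-1 * M * N * d' = 2^-1 * (M * N * d')); last by ring]; last
  first.
  by have := sqr_ge0 v; lra.
have {}EE : E <= 1 + r + 67 / 125 * r ^+ 2 by apply: EE; lra.
clear -M0 Mr EE E1 epsE r0 r1.
have r2 : r ^+ 2 <= 1 / 5 * r by rewrite expr2 ler_wpM2r.
have E49 : E <= 49 / 40 by lra.
have E2 : E ^+ 2 <= 151 / 100.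
  apply: (@le_trans _ _ (49 / 40 * E)); last by lra.
  by rewrite expr2 ler_wpM2r; lra.
have E21 : 0 <= E ^+ 2 - 1 by rewrite subr_ge0; exact: exprn_ege1.
have eps0 : 0 <= eps by rewrite epsE; apply: mulr_ge0; [lra|exact: sqr_ge0].
have p : (E ^+ 2 - 1) * eps <= 51 / 100 * (67 / 125 * (1 / 5 * r)).
  by apply: ler_pM => //; lra.
have c : E - 1 + (E ^+ 2 - 1) * eps <= 6 / 5 * r by lra.
by have := ler_wpM2l M0 c; rewrite mulrCA; lra.
Qed.

Lemma step_loss (R : realType) (E q : R) : 1 <= E -> E <= 49 / 40 -> q <= 24 / 100 ->
  E ^+ 5 * (21 / 20) ^+ 2 <= 41 / 10 * (1 - q).
Proof.
move=> E1 E49 q24; have E0 : 0 <= E by lra.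
have E2 : E ^+ 2 <= 151 / 100.
  apply: (@le_trans _ _ (49 / 40 * E)); last by lra.
  by rewrite expr2 ler_wpM2r.
have E4 : E ^+ 4 <= 229 / 100.
  apply: (@le_trans _ _ (151 / 100 * E ^+ 2)); last by lra.
  by rewrite -[4%N]/(2 + 2)%N exprD ler_wpM2r// exprn_ge0.
have E5 : E ^+ 5 <= 281 / 100.
  apply: (@le_trans _ _ (229 / 100 * E)); last by lra.
  by rewrite exprSr ler_wpM2r.
lra.
Qed.

(** The loss from the zero to the starting point will be 9/4, and [9 / 4 * (1 / 25) = 9 / 100] is
    the level at which Newton steps are taken. *)
Lemma start_arith (R : realType) (M N d r E : R) : 1 <= M -> 1 <= N -> 0 <= d ->
    2^-1 * M * N * d <= 1 / 25 -> r = N * d -> (r <= 2 / 10 -> E <= 1 + r + 67 / 125 * r ^+ 2)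
      -> 1 <= E ->
  [/\ r <= 1 / 12, E <= 11 / 10 & M * (E - 1 + (E ^+ 2 - 1) * (E - 1)) <= 2 / 15].
Proof.
move=> M1 N1 d0 vE rE EE E1.
have r0 : 0 <= r by rewrite rE; apply: mulr_ge0; lra.
have Mr : M * r <= 2 / 25 by move: vE; rewrite rE -!mulrA; lra.
have rM : r <= M * r by rewrite -[leLHS]mul1r ler_wpM2r.
have {}EE : E <= 1 + r + 67 / 125 * r ^+ 2 by apply: EE; lra.
clear vE rE d0 N1.
have r2 : r ^+ 2 <= 2 / 25 * r by rewrite expr2 ler_wpM2r//; lra.
have E11 : E <= 11 / 10 by lra.
split; [lra|exact: E11|].
have E2 : E ^+ 2 <= 121 / 100.
  apply: (@le_trans _ _ (11 / 10 * E)); last by lra.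
  by rewrite expr2 ler_wpM2r; lra.
have e0 : 0 <= E - 1 by lra.
have e1 : E - 1 <= 21 / 20 * r by lra.
have c : E - 1 + (E ^+ 2 - 1) * (E - 1) <= 13 / 10 * r.
  have : E ^+ 2 * (E - 1) <= 121 / 100 * (E - 1) by rewrite ler_wpM2r.
  by rewrite mulrBl mul1r; lra.
have M0 : 0 <= M by lra.
by have := ler_wpM2l M0 c; rewrite mulrCA; lra.
Qed.

Lemma start_loss (R : realType) (E q : R) : 1 <= E -> E <= 11 / 10 -> q <= 2 / 15 ->
  E ^+ 5 * (21 / 20) ^+ 2 <= 9 / 4 * (1 - q).
Proof.
move=> E1 E11 q24; have E0 : 0 <= E by lra.
have E2 : E ^+ 2 <= 121 / 100.
  apply: (@le_trans _ _ (11 / 10 * E)); last by lra.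
  by rewrite expr2 ler_wpM2r.
have E4 : E ^+ 4 <= 147 / 100.
  apply: (@le_trans _ _ (121 / 100 * E ^+ 2)); last by lra.
  by rewrite -[4%N]/(2 + 2)%N exprD ler_wpM2r// exprn_ge0.
have E5 : E ^+ 5 <= 162 / 100.
  apply: (@le_trans _ _ (147 / 100 * E)); last by lra.
  by rewrite exprSr ler_wpM2r.
lra.
Qed.

Section NewtonStep.
Variables (R : realType) (n : nat) (A : 'I_n -> {fset 'rV[R]_n}).
Variable rho : forall i, A i -> R.
Arguments rho : clear implicits.
Hypothesis n0 : (0 < n)%N.
Hypothesis A0 : forall i, A i != fset0.
Hypothesis rho0 : forall i a, 0 < rho i a.
Variable f : system A.
Hypothesis f0 : forall i, f i != 0.
Local Notation C := R[i].
Implicit Types (x y z u w : 'cV[C]_n) (i : 'I_n).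
Local Open Scope complex_scope.

(* [M] and [N] stand for [mu] and [nu] but need only be upper bounds of them *)
Definition controlled x z M N v := [/\ [/\ DS_op rho f x \in unitmx, 1 <= M & 1 <= N],
  cond_le rho f x M, nu_le rho x N & 2^-1 * M * N * local_norm rho x (z - x) <= v].

Lemma ell_le_nu x N i (a : A i) u : 0 <= N -> nu_le rho x N ->
  modc (ell rho x a u) <= N * local_norm rho x u.
Proof. by move=> N0 nN; apply: (le_trans (nN _ _ _)); rewrite ler_wpM2l// local_norm_i_le. Qed.

Lemma controlled_recenter x y z M N r eps b k v :
    DS_op rho f x \in unitmx -> 1 <= M -> 1 <= N -> cond_le rho f x M -> nu_le rho x N ->
    (forall i (a : A i), modc (ell rho x a (y - x)) <= r) ->
    0 <= r -> 0 <= b -> expR r ^+ 2 - 2 * r <= b ^+ 2 -> 0 <= eps ->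
    (forall i, modc (rowsum rho f x (fun i a => cexp (ell rho x a (y - x))) i) <=
      eps * coords_norm (f i)) ->
    M * (expR r - 1 + (expR r ^+ 2 - 1) * eps) < 1 ->
    expR r ^+ 5 * b ^+ 2 <= k * (1 - M * (expR r - 1 + (expR r ^+ 2 - 1) * eps)) ->
    k * (2^-1 * M * N * local_norm rho x (z - y)) <= v ->
  exists M' N', controlled y z M' N' v.
Proof.
move=> D M1 N1 cM nN xyr r0 b0 Bb eps0 Seps q1 kH kv.
have M0 : 0 < M := lt_le_trans ltr01 M1.
have N0 : 0 <= N := le_trans ler01 N1.
have nd := nondegenerate_of_unit f0 D.
have ndy := nondegenerate_recenter A0 rho0 xyr b0 Bb nd.
have cM' := cond_recenter A0 rho0 xyr b0 Bb r0 f0 eps0 M0 Seps cM q1.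
have nN' := nu_recenter A0 rho0 xyr b0 Bb r0 N1 nN.
exists (M * expR r * b / (1 - M * (expR r - 1 + (expR r ^+ 2 - 1) * eps))),
  (expR r ^+ 3 * b * N); split; [|exact: cM'|exact: nN'|].
  split; [exact: unit_of_cond_le ndy cM'|exact: one_le_of_cond_le cM'|].
  apply: (one_le_of_nu_le A0 rho0 n0 ndy _ nN').
  by rewrite !mulr_ge0// exprn_ge0// expR_ge0.
apply: le_trans kv.
apply: le_trans (recenter_loss N0 (local_norm_ge0 rho x (z - y)) (expR_ge0 r) q1 (ltW M0) kH).
apply: ler_wpM2l; last exact: (local_norm_recenter A0 rho0 xyr).
rewrite !mulr_ge0 ?exprn_ge0 ?expR_ge0 ?invr_ge0//; [exact: ltW|].
by rewrite subr_ge0 ltW.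
Qed.

(* [f] vanishes at [x + s] to first order when [s] is the Newton increment *)
Lemma newton_residual x i (u := newton rho f x - x) : DS_op rho f x \in unitmx ->
  rowsum rho f x (fun i a => cexp (ell rho x a u)) i =
  rowsum rho f x (fun i a => cexp (ell rho x a u) - 1 - ell rho x a u) i.
Proof.
move=> D; rewrite 2!rowsumB -S_op0 -DS_opE.
suff -> : (DS_op rho f x *m u) i 0 = - S_op rho f x 0 i 0 by rewrite opprK subrK.
have -> : u = - (invmx (DS_op rho f x) *m S_op rho f x 0).
  by rewrite /u /newton addrC addrA addNr add0r.
by rewrite mulmxN mulKVmx// mxE.
Qed.

Lemma quad_residual x i u (r : R) : (forall a : A i, modc (ell rho x a u) <= r) -> r <= 2 / 10 ->
  0 <= r ->
  modc (rowsum rho f x (fun i a => cexp (ell rho x a u) - 1 - ell rho x a u) i) <=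
  67 / 125 * r * local_norm_i rho i x u * coords_norm (f i).
Proof.
move=> ur r2 r0; rewrite -ler_pdivrMr ?coords_norm_gt0//; apply: rowsum_le_norm => //.
  by apply: mulr_ge0 => //; lra.
move=> a; have l0 := modc_ge0 (ell rho x a u).
apply: (le_trans (cexp_bound2 _)); have := expR_le_quad l0 (le_trans (ur a) r2).
move: (ur a) l0; set l := modc _ => lr l0 H.
have : 67 / 125 * l ^+ 2 <= 67 / 125 * r * l.
  by rewrite expr2 mulrA ler_wpM2r// ler_wpM2l//; lra.
lra.
Qed.

Lemma newton_step x z M N v : solution_variety rho f z -> controlled x z M N v -> v <= 9 / 100 ->
  (exists M' N', controlled (newton rho f x) z M' N' (9 / 2 * v ^+ 2)) /\
  local_norm rho x (newton rho f x - z) <= 134 / 125 * v * local_norm rho x (z - x).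
Proof.
move=> fz [[D M1 N1] cM nN Hv] v9.
have d0 := local_norm_ge0 rho x (z - x).
set d := local_norm rho x (z - x) in Hv d0 *.
have N0 : 0 <= N by lra.
have M0 : 0 <= M by lra.
have v00 : 0 <= 2^-1 * M * N * d by rewrite !mulr_ge0 ?invr_ge0.
have Nd : N * d <= 2 * v.
  have : N * d <= M * (N * d) by rewrite -[leLHS]mul1r ler_wpM2r// mulr_ge0.
  by move: Hv; rewrite -!mulrA; lra.
have nc := newton_contraction f0 D fz cM nN M0 N0 (_ : N * d <= 2 / 10).
have {}nc : local_norm rho x (newton rho f x - z) <= 134 / 125 * (2^-1 * M * N * d) * d.
  rewrite (_ : _ * d = M * (67 / 125 * (N * d)) * d); last by field.
  by apply: nc; lra.
split; last first.
  by apply: (le_trans nc); apply: ler_wpM2r => //; apply: ler_wpM2l => //; lra.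
set d' := local_norm _ _ (_ - z) in nc *.
set s := local_norm rho x (newton rho f x - x).
have s0 : 0 <= s by exact: local_norm_ge0.
have sd : s <= d + d'.
  have -> : s = local_norm rho x ((z - x) + (newton rho f x - z)).
    by congr (local_norm _ _ _); rewrite [RHS]addrC addrA subrK.
  exact: local_normD.
have E1 : 1 <= expR (N * s) by rewrite -expR0 ler_expR mulr_ge0.
have [r1 cH kH] := newton_step_arith M1 N1 d0 erefl (le_trans Hv v9) nc s0 sd erefl
  (expR_le_quad (mulr_ge0 N0 s0)) E1 erefl.
have Ns0 : 0 <= N * s by exact: mulr_ge0.
have xyr i (a : A i) : modc (ell rho x a (newton rho f x - x)) <= N * s by exact: ell_le_nu.
have Ns2 : N * s <= 2 / 10 by lra.
(* At the Newton iterate the equations reduce to their quadratic remainder, which gives this [eps];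
   one factor [s] is enlarged to [N * s] by [1 <= N]. *)
apply: (@controlled_recenter x _ z M N (N * s) (67 / 125 * (N * s) ^+ 2) (21 / 20) (41 / 10))
  => //.
- by apply: (expR_sqr_num Ns0 r1); lra.
- by apply: mulr_ge0; [lra|exact: sqr_ge0].
- move=> i; rewrite newton_residual//; apply: le_trans (quad_residual _ Ns2 Ns0) _.
    by move=> a; exact: xyr.
  apply: ler_wpM2r; first exact: l2_ge0.
  rewrite (_ : 67 / 125 * (N * s) ^+ 2 = 67 / 125 * (N * s) * (N * s)); last by ring.
  apply: ler_wpM2l; first by apply: mulr_ge0 => //; lra.
  apply: (le_trans (local_norm_i_le rho i x _)); rewrite -/s -[leLHS]mul1r ler_wpM2r//.
- by apply: (le_lt_trans cH); lra.
- have e49 : expR (N * s) <= 49 / 40 by apply: (expR_num Ns0 r1); lra.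
  exact: (step_loss E1 e49 cH).
- rewrite local_norm_distC -/d'; apply: (le_trans kH).
  by apply: ler_wpM2l; [lra|apply: lerXn2r; rewrite ?nnegrE//; lra].
Qed.
End NewtonStep.

Section Start.
Variables (R : realType) (n : nat) (A : 'I_n -> {fset 'rV[R]_n}).
Variable rho : forall i, A i -> R.
Arguments rho : clear implicits.
Hypothesis n0 : (0 < n)%N.
Hypothesis A0 : forall i, A i != fset0.
Hypothesis rho0 : forall i a, 0 < rho i a.
Variable f : system A.
Hypothesis f0 : forall i, f i != 0.
Local Notation C := R[i].
Implicit Types (x y z u w : 'cV[C]_n) (i : 'I_n).
Local Open Scope complex_scope.
Lemma start_controlled x z M N : solution_variety rho f z -> controlled rho f z x M N (1 / 25) ->
  exists M' N', controlled rho f x z M' N' (9 / 100).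
Proof.
move=> fz [[D M1 N1] cM nN Hv].
have d0 := local_norm_ge0 rho z (x - z).
set d := local_norm rho z (x - z) in Hv d0 *.
have N0 : 0 <= N by lra.
have r0 : 0 <= N * d by exact: mulr_ge0.
have E1 : 1 <= expR (N * d) by rewrite -expR0 ler_expR.
have [r1 E11 cH] := start_arith M1 N1 d0 Hv erefl (expR_le_quad r0) E1.
have xyr i (a : A i) : modc (ell rho z a (x - z)) <= N * d by exact: ell_le_nu.
apply: (@controlled_recenter R n A rho n0 A0 rho0 f f0 z _ z M N (N * d) (expR (N * d) - 1) (21
  / 20) (9 / 4)) => //.
- by apply: (expR_sqr_num r0 r1); lra.
- by rewrite subr_ge0.
- move=> i; have := solution_S_op z fz i; rewrite subrr => S0.
  (* As [z] is a solution, the multiplier 1 gives the row 0 and only [cexp l - 1] is left; hence the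
     choice of [eps]. *)
  have -> : rowsum rho f z (fun i a => cexp (ell rho z a (x - z))) i =
      rowsum rho f z (fun i a => cexp (ell rho z a (x - z)) - 1) i.
    have S1 : rowsum rho f z (fun _ _ => 1) i = 0.
      rewrite -[RHS]S0; apply: eq_rowsum => a.
      by rewrite /ell covec0 cexp0.
    by rewrite rowsumB S1 subr0.
  apply: (le_trans (rowsum_le _ _ _ _ _)); apply: ler_wpM2r; first exact: l2_ge0.
  have [e0 eE] : 0 <= expR (N * d) - 1 /\ forall a : A i, modc (cexp (ell rho z a (x - z)) - 1)
    <= expR (N * d) - 1.
    split=> [|a]; first by rewrite subr_ge0.
    by apply: (le_trans (cexp_bound1 _)); rewrite lerD2r ler_expR.
  move: (expR (N * d) - 1) e0 eE => e e0 eE.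
  apply: le_of_sqr => //; rewrite sqr_l2 -[leRHS]mul1r -(sum_weight A0 rho0 i z) mulr_suml.
  apply: ler_sum => a _; rewrite exprMn sqr_modc_vv//.
  apply: ler_wpM2l; first by apply/ltW/weight_gt0.
  apply: lerXn2r; rewrite ?nnegrE ?modc_ge0//.
- by apply: (le_lt_trans cH); lra.
- exact: (start_loss E1 E11 cH).
- by move: Hv; rewrite local_norm_distC -/d; lra.
Qed.

End Start.

Section AbsolutelyContinuousFamilies.
Variable R : realType.
Local Notation mu := (@lebesgue_measure R).

Lemma ac_sum (I : finType) (a b : R) (g : I -> R -> R) : (forall i, ac a b (g i)) ->
  forall e, 0 < e -> exists2 d : R, 0 < d & forall s : seq (R * R),
    all (fun I => [&& a <= I.1, I.1 <= I.2 & I.2 <= b]) s ->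
    ordered_intervals s -> \sum_(I <- s) (I.2 - I.1) < d ->
    \sum_(J <- s) \sum_i `|g i J.2 - g i J.1| < e.
Proof.
move=> ag e e0; have n0 : 0 < e / #|I|.+1%:R by rewrite divr_gt0.
have /choice[d dP] : forall i, exists d : R, 0 < d /\ forall s : seq (R * R),
    all (fun I => [&& a <= I.1, I.1 <= I.2 & I.2 <= b]) s ->
    ordered_intervals s -> \sum_(I <- s) (I.2 - I.1) < d ->
    \sum_(J <- s) `|g i J.2 - g i J.1| < e / #|I|.+1%:R.
  by move=> i; have [d d0 H] := ag i _ n0; exists d.
exists (\big[Num.min/1]_i d i).
  by elim/big_ind: _ => // [x y x0 y0|i _]; [rewrite lt_min x0|have [] := dP i].
move=> s sab os sd; rewrite exchange_big/=.
apply: (@le_lt_trans _ _ (\sum_(i : I) e / #|I|.+1%:R)).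
  apply: ler_sum => i _; apply/ltW; have [_ H] := dP i; apply: H => //.
  by apply: (lt_le_trans sd); exact: bigmin_le_cond.
rewrite sumr_const -(mulr_natr (e / _)) mulrAC ltr_pdivrMr ?ltr0n//.
by rewrite ltr_pM2l// ltr_nat.
Qed.

Lemma ac_le_sum (I : finType) (a b K : R) (g : I -> R -> R) (h : R -> R) : 0 <= K ->
    (forall i, ac a b (g i)) ->
    (forall x y, a <= x -> x <= y -> y <= b -> `|h y - h x| <= K * \sum_i `|g i y - g i x|) ->
  ac a b h.
Proof.
move=> K0 ag hg e e0; have K1 : 0 < K + 1 by rewrite ltr_wpDl.
have [d d0 H] := ac_sum ag (divr_gt0 e0 K1).
exists d => // s sab os sd; have := H _ sab os sd.
rewrite ltr_pdivlMr//; apply: le_lt_trans; rewrite mulr_suml.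
rewrite big_seq [leRHS]big_seq; apply: ler_sum => J Js.
have /and3P[aI II Ib] := allP sab _ Js.
by rewrite (le_trans (hg _ _ aI II Ib))// mulrC ler_wpM2l ?sumr_ge0// lerDl.
Qed.

Lemma ac_continuous (a b : R) (g : R -> R) : ac a b g -> {within `[a, b], continuous g}.
Proof.
move=> ag; apply/subspace_continuousP => x xab; apply/cvgrPdist_lt => e e0.
have [d d0 H] := ac_unif_continuous ag e0.
rewrite /prop_near1 /within /=; apply/nbhs_normP; exists d => // y xy yab.
by apply: H; [move: xab|move: yab|exact: xy]; rewrite /= in_itv.
Qed.

(** The family [gs] allows the derivative of [g] to be bounded only at points where all path
    coordinates are differentiable, which is almost everywhere. *)
Lemma ac_le_integral_fam (I : finType) (gs : I -> R -> R) (a b : R) (g : R -> R) (G : R -> \bar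
  R) :
    a <= b -> ac a b g -> (forall i, ac a b (gs i)) ->
    (forall t, a < t -> t <= b -> (0 <= G t)%E) ->
    (forall t d, a < t < b -> (forall i, derivable (gs i) t 1) ->
      is_derive t (1 : R) g d -> (d%:E <= G t)%E) ->
  ((g b - g a)%:E <= \int[mu]_(t in `]a, b]) G t)%E.
Proof.
move=> ab ag ags G0 gG; have [phi iphi H] := ac_density ab ag.
have H1 := ac_derivable_ae ab iphi H.
have H2 : {ae mu, forall t, a < t < b -> forall i, derivable (gs i) t 1}.
  have : {ae mu, forall t, forall i, a < t < b -> derivable (gs i) t 1}.
    apply: filter_forall => i; have [psi ipsi K] := ac_density ab (ags i).
    have := ac_derivable_ae ab ipsi K; apply: filterS => //.
      exact: (ae_filter_ringOfSetsType mu).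
    by move=> t D /D[].
  apply: filterS; first exact: (ae_filter_ringOfSetsType mu).
  by move=> t D tab i; exact: D.
have [N [mN muN HN]] : {ae mu, forall t, a < t < b ->
    is_derive t (1 : R) g (phi t) /\ forall i, derivable (gs i) t 1}.
  apply: filterS2 H1 H2; first exact: (ae_filter_ringOfSetsType mu).
  by move=> t D D' tab; split; [exact: D|exact: D'].
have mab : measurable (`]a, b] : set (measurableTypeR R)) by exact: measurable_itv.
have mphi : measurable_fun (setT : set (measurableTypeR R)) phi.
  by apply/measurable_EFinP; exact: measurable_int iphi.
have [] := lebesgue_null_setU1 b mN muN; set M := N `|` _ => mM muM.
rewrite (H _ _ (lexx a) ab (lexx b)).
pose P := ((EFin \o phi)^\+)%E.
have mP : measurable_fun (setT : set (measurableTypeR R)) P.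
  by apply: measurable_funepos; exact/measurable_EFinP.
have P0 t : (0 <= P t)%E by exact: funepos_ge0.
(* [psi] is measurable, lies below [G] on []a, b]] and equals the positive part of the density
   almost everywhere, so monotonicity of the lower integral suffices to reach [G]. *)
pose psi t := (P t * (\1_(~` M) t)%:E)%E.
have psi0 t : (0 <= psi t)%E by rewrite mule_ge0// lee_fin.
have mpsi : measurable_fun (setT : set (measurableTypeR R)) psi.
  apply: emeasurable_funM => //; apply/measurable_EFinP.
  by apply: measurable_indic; exact: measurableC.
apply: (@le_trans _ _ (\int[mu]_(t in `]a, b]) P t)%E).
  rewrite integralE leeBlDr; last first.
    apply: integrable_fin_num => //; apply: integrable_funeneg => //.
    exact: integrableS iphi.
  by rewrite leeDl// integral_ge0// => t _; exact: funeneg_ge0.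
apply: (@le_trans _ _ (\int[mu]_(t in `]a, b]) psi t)%E).
  apply: ae_ge0_le_integral => //; [exact: measurable_funS mP|exact: measurable_funS mpsi|].
  exists M; split => // t /=; apply: contra_notP => Mt _.
  by rewrite /psi indicE mem_set// mule1.
apply: ge0_integral_mono => //.
  by move=> t /=; rewrite in_itv/= => /andP[at_ tb]; exact: G0.
move=> t /=; rewrite in_itv/= => /andP[at_ tb]; rewrite /psi indicE.
have [|] := boolP (t \in ~` M); last by rewrite mule0 => _; exact: G0.
rewrite inE mule1 /P funeposE ge_max G0// andbT => /not_orP[Nt /eqP tb'].
have tab : a < t < b by rewrite at_ lt_neqAle tb'.
have [D D'] : is_derive t (1 : R) g (phi t) /\ forall i, derivable (gs i) t 1.
  apply: contra_notP Nt => D; apply: HN => /= D'; apply/D/D'.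
  exact: tab.
exact: gG.
Qed.

End AbsolutelyContinuousFamilies.

Lemma l2_le_sum (R : realType) (I : finType) (F : I -> R) : (forall i, 0 <= F i) -> l2 F <=
  \sum_i F i.
Proof.
move=> F0; apply: le_of_sqr; first exact: sumr_ge0.
rewrite sqr_l2 expr2 mulr_suml; apply: ler_sum => i _; rewrite expr2.
by rewrite ler_wpM2l// (bigD1 i)//= lerDl sumr_ge0.
Qed.

(** One term [s * L / m] accounts for the change of the row, another for the change of its
    normalization. *)
Lemma normalized_row_lipschitz (R : realType) (F G : R[i]) (cf cg ch l L m s : R) :
    0 < m -> m <= cf -> 0 < cg -> cg <= cf + ch -> 0 <= ch -> ch <= s -> 0 <= l -> l <= L ->
    modc (F - G) <= l * ch -> modc G <= l * cg ->
  modc F / cf <= modc G / cg + 2 / m * s * L.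
Proof.
move=> m0 mcf cg0 cgf ch0 chs l0 lL FG Gl.
have cf0 : 0 < cf := lt_le_trans m0 mcf.
have lch : l * ch <= s * L by rewrite mulrC; apply: ler_pM.
have step : l * ch / cf <= s * L / m.
  have sL : 0 <= s * L by apply: mulr_ge0; [exact: le_trans ch0 chs|exact: le_trans l0 lL].
  apply: ler_pM => //; rewrite ?mulr_ge0// ?invr_ge0 ?(ltW cf0)//.
  by rewrite lef_pV2 ?posrE.
have Gc : modc G / cf <= modc G / cg + l * ch / cf.
  rewrite ler_pdivrMr// mulrDl divfK ?gt_eqF//.
  have q0 : 0 <= modc G / cg by rewrite divr_ge0 ?modc_ge0// ltW.
  have ql : modc G / cg <= l by rewrite ler_pdivrMr.
  have GE : modc G = modc G / cg * cg by rewrite divfK ?gt_eqF.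
  have : modc G / cg * cg <= modc G / cg * (cf + ch) by rewrite ler_wpM2l.
  rewrite -GE mulrDr; have : modc G / cg * ch <= l * ch by rewrite ler_wpM2r.
  lra.
have : modc F / cf <= modc G / cf + l * ch / cf.
  rewrite -mulrDl ler_pM2r ?invr_gt0//; apply: (le_trans (modc_le_distl F G)).
  by rewrite lerD2l.
rewrite (_ : 2 / m * s * L = s * L / m + s * L / m); last by field; rewrite gt_eqF.
lra.
Qed.

(** * The reciprocal condition number *)

Section InverseCondition.
Variables (R : realType) (n : nat) (A : 'I_n -> {fset 'rV[R]_n}).
Variable rho : forall i, A i -> R.
Arguments rho : clear implicits.
Hypothesis n0 : (0 < n)%N.
Hypothesis A0 : forall i, A i != fset0.
Hypothesis rho0 : forall i a, 0 < rho i a.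
Local Notation C := R[i].
Implicit Types (x y z u w : 'cV[C]_n) (i : 'I_n) (f g : system A).
Local Open Scope complex_scope.

(* the reciprocal of [mu], also meaningful when [DS_op f x] is singular *)
Definition inv_cond f x : R := inf [set dn rho f x w | w in [set w | local_norm rho x w = 1]].

Lemma dnZ f x c w : dn rho f x (c *: w) = modc c * dn rho f x w.
Proof.
rewrite /dn -l2Z ?modc_ge0//; apply: eq_l2 => i.
by rewrite -scalemxAr mxE modcM mulrA.
Qed.

Let lb0 f x : lbound [set dn rho f x w | w in [set w | local_norm rho x w = 1]] 0.
Proof. by move=> _ [w _ <-]; exact: dn_ge0. Qed.

Lemma unit_sphere_nonempty x : nondegenerate rho x -> exists w, local_norm rho x w = 1.
Proof.
move=> nd; have [u [i ui]] := nondegenerate_local_norm_gt0 n0 nd.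
have up : 0 < local_norm rho x u := lt_le_trans ui (local_norm_i_le _ _ _ _).
exists ((local_norm rho x u)^-1%:C *: u).
by rewrite local_normZ modc_real ger0_norm ?invr_ge0 ?local_norm_ge0// mulVf// gt_eqF.
Qed.

Lemma inv_cond_ge0 f x : nondegenerate rho x -> 0 <= inv_cond f x.
Proof.
move=> nd; have [w w1] := unit_sphere_nonempty nd.
by apply: lb_le_inf; [exists (dn rho f x w), w|exact: lb0].
Qed.

Lemma inv_cond_le f x w : inv_cond f x * local_norm rho x w <= dn rho f x w.
Proof.
have w0 := local_norm_ge0 rho x w.
have [->|wn] := eqVneq (local_norm rho x w) 0; first by rewrite mulr0; exact: dn_ge0.
have wp : 0 < local_norm rho x w by rewrite lt_neqAle eq_sym wn.
have cw : modc (local_norm rho x w)^-1%:C = (local_norm rho x w)^-1.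
  by rewrite modc_real ger0_norm// invr_ge0.
rewrite -ler_pdivlMr//; apply: ge_inf; first by exists 0; exact: lb0.
exists ((local_norm rho x w)^-1%:C *: w); first by rewrite /= local_normZ cw mulVf.
by rewrite dnZ cw mulrC.
Qed.

Lemma le_inv_cond f x k : nondegenerate rho x ->
  (forall w, k * local_norm rho x w <= dn rho f x w) -> k <= inv_cond f x.
Proof.
move=> nd H; have [w w1] := unit_sphere_nonempty nd.
apply: lb_le_inf; first by exists (dn rho f x w), w.
by move=> _ [u u1 <-]; have := H u; rewrite u1 mulr1.
Qed.

Lemma cond_le_inv_cond f x : 0 < inv_cond f x -> cond_le rho f x (inv_cond f x)^-1.
Proof. by move=> c0 w; rewrite mulrC ler_pdivlMr// mulrC inv_cond_le. Qed.

Lemma inv_cond_ge f x M : nondegenerate rho x -> 0 < M -> cond_le rho f x M ->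
  M^-1 <= inv_cond f x.
Proof.
by move=> nd M0 cM; apply: le_inv_cond => // w; rewrite mulrC ler_pdivrMr// mulrC.
Qed.

Lemma unit_of_inv_cond f x : nondegenerate rho x -> 0 < inv_cond f x ->
  DS_op rho f x \in unitmx.
Proof. by move=> nd c0; apply: unit_of_cond_le nd (cond_le_inv_cond c0). Qed.

Lemma mu_inv_cond f x : (forall i, f i != 0) -> DS_op rho f x \in unitmx ->
  0 < inv_cond f x /\ mu rho f x = ((inv_cond f x)^-1)%:E.
Proof.
move=> f0 D; have nd := nondegenerate_of_unit f0 D.
have [muE m0 cm min] := mu_spec f0 D.
have m1 := one_le_of_cond_le n0 f0 nd cm.
have mp : 0 < fine (mu rho f x) := lt_le_trans ltr01 m1.
have c0 : 0 < inv_cond f x by apply: lt_le_trans (inv_cond_ge nd mp cm); rewrite invr_gt0.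
split => //; rewrite muE; congr EFin; apply/le_anti/andP; split.
  by apply: min; [rewrite invr_ge0 ltW|exact: cond_le_inv_cond].
by rewrite -[leRHS]invrK lef_pV2 ?posrE ?invr_gt0//; exact: inv_cond_ge.
Qed.

Let rowsumBl f g x q i :
  rowsum rho (fun i => [ffun a => f i a - g i a] : coords A i) x q i =
  rowsum rho f x q i - rowsum rho g x q i.
Proof. by rewrite /rowsum -sumrB; apply: eq_bigr => a _; rewrite ffunE mulrBr. Qed.

Lemma dnE f x w : dn rho f x w =
  l2 (fun i => modc (rowsum rho f x (fun i a => ell rho x a w) i) / coords_norm (f i)).
Proof. by apply: eq_l2 => i; rewrite DS_opE. Qed.

Lemma coords_norm_dist i (g h : coords A i) :
  `|coords_norm g - coords_norm h| <= \sum_a modc (g a - h a).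
Proof.
have H (u v : coords A i) : coords_norm u <= coords_norm v + \sum_a modc (u a - v a).
  rewrite !coords_normE; apply: (@le_trans _ _ (l2 (fun a => modc (v a)) + l2 (fun a => modc (u
    a - v a)))).
    apply: l2_triangle => a; rewrite ger0_norm ?modc_ge0//.
    exact: modc_le_distl.
  by rewrite lerD2l; apply: l2_le_sum => a; exact: modc_ge0.
rewrite ler_norml; apply/andP; split.
  rewrite lerNl opprB lerBlDl; have := H h g; congr (_ <= _ + _).
  by apply: eq_bigr => a _; rewrite -modcN opprB.
by rewrite lerBlDl; exact: H.
Qed.

Lemma dn_lipschitz f g x w m : 0 < m -> (forall i, m <= coords_norm (f i)) ->
    (forall i, 0 < coords_norm (g i)) ->
  dn rho f x w <= dn rho g x w +
    2 / m * (\sum_i \sum_a modc (f i a - g i a)) * local_norm rho x w.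
Proof.
move=> m0 fm g0; pose h : system A := fun i => [ffun a => f i a - g i a].
have hE i : coords_norm (h i) <= \sum_a modc (f i a - g i a).
  rewrite coords_normE; apply: (le_trans (l2_le_sum _)); first by move=> a; exact: modc_ge0.
  by apply: ler_sum => a _; rewrite ffunE.
have fgh i : coords_norm (g i) <= coords_norm (f i) + coords_norm (h i).
  rewrite !coords_normE; apply: l2_triangle => a; rewrite ger0_norm ?modc_ge0// ffunE.
  exact: modc_le_distr.
have sum0 i : 0 <= \sum_a modc (f i a - g i a) by apply: sumr_ge0 => a _; exact: modc_ge0.
have L0 := local_norm_ge0 rho x w.
have c0 : 0 <= 2 / m by rewrite divr_ge0// ltW.
apply: (@le_trans _ _ (dn rho g x w + l2 (fun i => 2 / m * (\sum_a modc (f i a - g i a)) *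
  local_norm rho x w))).
  rewrite 2!dnE; apply: l2_triangle => i.
  rewrite ger0_norm ?divr_ge0 ?modc_ge0 ?l2_ge0//.
  have row_le (k : system A) : modc (rowsum rho k x (fun i a => ell rho x a w) i) <=
      local_norm_i rho i x w * coords_norm (k i).
    by rewrite local_norm_iE//; exact: rowsum_le.
  apply: (normalized_row_lipschitz m0 (fm i) (g0 i) (fgh i) (l2_ge0 _) (hE i)
    (local_norm_i_ge0 rho i x w) (local_norm_i_le rho i x w) _ (row_le g)).
  by rewrite -rowsumBl; exact: row_le.
rewrite lerD2l; apply: (le_trans (l2_le_sum _)); first by move=> i; apply: mulr_ge0 => //;
  apply: mulr_ge0; [exact: c0|exact: sum0].
by rewrite -mulr_suml -mulr_sumr.
Qed.

Lemma inv_cond_lipschitz f g x m : nondegenerate rho x -> 0 < m ->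
    (forall i, m <= coords_norm (f i)) -> (forall i, m <= coords_norm (g i)) ->
  `|inv_cond f x - inv_cond g x| <= 2 / m * \sum_i \sum_a modc (f i a - g i a).
Proof.
move=> nd m0 fm gm.
have H (u v : system A) : (forall i, m <= coords_norm (u i)) -> (forall i, m <= coords_norm (v
  i)) ->
    inv_cond v x <= inv_cond u x + 2 / m * \sum_i \sum_a modc (v i a - u i a).
  move=> um vm; rewrite -lerBlDr; apply: le_inv_cond => // w.
  rewrite mulrBl lerBlDr; apply: (le_trans (inv_cond_le v x w)).
  by apply: dn_lipschitz => // i; exact: lt_le_trans m0 _.
rewrite ler_norml; apply/andP; split; last by rewrite lerBlDl; exact: H.
rewrite lerNl opprB lerBlDl; have := H f g fm gm; congr (_ <= _ + _ * _).
by apply: eq_bigr => i _; apply: eq_bigr => a _; rewrite -modcN opprB.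
Qed.

End InverseCondition.

(** Between 9/100 and 181/2000 the function [v - 134 / 125 * v ^+ 2] exceeds 813/10000; the sign of
    the quadratic with these two roots makes the inequality linear. *)
Lemma gap_arith (R : realType) (v al : R) : 0 <= v -> v <= 181 / 20 / 100 -> v <= al + 134 /
  125 * v ^+ 2 ->
  al <= 813 / 100 / 100 -> v <= 9 / 100.
Proof.
move=> v0 v1 H al1; rewrite leNgt; apply/negP => v9.
have : (v - 9 / 100) * (v - 181 / 20 / 100) <= 0 by apply: mulr_ge0_le0; lra.
rewrite (_ : (v - 9 / 100) * (v - 181 / 20 / 100) = v ^+ 2 - 361 / 20 / 100 * v + 181 / 200 * 9
  / 1000); last by field.
lra.
Qed.

Lemma gap_arith_lt (R : realType) (v al : R) : 0 <= v -> v <= 3 / 40 -> al <= v + 134 / 125 * v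
  ^+ 2 ->
  al < 811 / 100 / 100.
Proof.
move=> v0 v1 H; have : v ^+ 2 <= 3 / 40 * v by rewrite expr2 ler_wpM2r.
lra.
Qed.

Section Gap.
Variables (R : realType) (n : nat) (A : 'I_n -> {fset 'rV[R]_n}).
Variable rho : forall i, A i -> R.
Arguments rho : clear implicits.
Hypothesis n0 : (0 < n)%N.
Hypothesis A0 : forall i, A i != fset0.
Hypothesis rho0 : forall i a, 0 < rho i a.
Variable alpha1 : R.
Hypotheses (alpha1_ge : 811 / 100 / 100 <= alpha1) (alpha1_le : alpha1 <= 813 / 100 / 100).
Local Notation C := R[i].
Implicit Types (x y z u w : 'cV[C]_n) (i : 'I_n) (f g : system A).

(** The quotient of this by [inv_cond f x] is what the thresholds bound. Kept apart, both parts stay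
    finite and absolutely continuous in [t] even where [DS_op] is singular. *)
Definition halfstep x z : R := 2^-1 * fine (nu rho x) * local_norm rho x (z - x).

Definition step_test f x : Prop :=
  (alpha1%:E <= (2^-1)%:E * mu rho f x * nu rho x * newton_step_norm rho f x)%E.

Lemma nu_facts x : nondegenerate rho x ->
  [/\ nu rho x = (fine (nu rho x))%:E, 1 <= fine (nu rho x) & nu_le rho x (fine (nu rho x))].
Proof.
move=> nd; have [nuE N0 nN _] := nu_spec A0 rho0 x n0; split => //.
exact: (one_le_of_nu_le A0 rho0 n0 nd N0 nN).
Qed.

Lemma halfstep_ge0 x z : nondegenerate rho x -> 0 <= halfstep x z.
Proof.
by move=> /nu_facts[_ N1 _]; rewrite /halfstep !mulr_ge0 ?invr_ge0 ?local_norm_ge0// (le_trans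
  ler01).
Qed.

Lemma unit_of_not_step_test f x : nondegenerate rho x -> ~ step_test f x ->
  DS_op rho f x \in unitmx.
Proof.
move=> nd; have [nuE N1 _] := nu_facts nd; apply: contra_notT => D.
rewrite /step_test /mu /newton_step_norm (negbTE D) nuE.
have -> : ((2^-1)%:E * +oo = +oo :> \bar R)%E by rewrite gt0_muley// lte_fin invr_gt0.
have -> : (+oo * (fine (nu rho x))%:E = +oo)%E.
  by rewrite gt0_mulye// lte_fin (lt_le_trans ltr01).
by rewrite mulyy leey.
Qed.

(** Triangle inequality in both directions: the Newton step and the distance to [z] differ by at
    most the error of the Newton iterate, which the contraction makes quadratic. The bound 181/2000
    also keeps the step small enough for [local_dist_eq]. *)
Lemma step_dist f x z : (forall i, f i != 0) -> DS_op rho f x \in unitmx ->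
    solution_variety rho f z -> halfstep x z <= 181 / 20 / 100 * inv_cond rho f x ->
  exists al, [/\ ((2^-1)%:E * mu rho f x * nu rho x * newton_step_norm rho f x = al%:E)%E,
    halfstep x z / inv_cond rho f x <= al + 134 / 125 * (halfstep x z / inv_cond rho f x) ^+ 2,
    al <= halfstep x z / inv_cond rho f x + 134 / 125 * (halfstep x z / inv_cond rho f x) ^+ 2 &
    local_dist rho x x (newton rho f x) = local_norm rho x (newton rho f x - x)].
Proof.
move=> f0 D fz small; have nd := nondegenerate_of_unit f0 D.
have [nuE N1 nN] := nu_facts nd; have [c0 muE] := mu_inv_cond n0 f0 D.
have h0 := halfstep_ge0 z nd.
have N0 : 0 <= fine (nu rho x) by exact: le_trans ler01 N1.
have cM := cond_le_inv_cond c0.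
have c1 : inv_cond rho f x <= 1.
  have := one_le_of_cond_le n0 f0 nd cM; by rewrite invf_ge1.
have ci0 : 0 <= (inv_cond rho f x)^-1 by rewrite invr_ge0 ltW.
have d0 := local_norm_ge0 rho x (z - x).
have Nd : fine (nu rho x) * local_norm rho x (z - x) <= 2 / 10.
  by move: small; rewrite /halfstep -mulrA; lra.
have nc := newton_contraction f0 D fz cM nN ci0 N0 Nd.
rewrite /newton_step_norm D muE nuE.
set c := inv_cond rho f x in c0 c1 ci0 cM muE small nc *.
set N := fine _ in nuE N1 nN N0 Nd nc *.
set d := local_norm rho x (z - x) in d0 Nd nc.
have hE : halfstep x z = 2^-1 * N * d by [].
set h := halfstep x z in h0 small hE *.
set d' := local_norm rho x (newton rho f x - z) in nc.
set s := local_norm rho x (newton rho f x - x).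
have s0 : 0 <= s by exact: local_norm_ge0.
have sd : s <= d + d'.
  have -> : s = local_norm rho x ((z - x) + (newton rho f x - z)).
    by congr (local_norm _ _ _); rewrite [RHS]addrC addrA subrK.
  exact: local_normD.
have ds : d <= s + d'.
  have -> : d = local_norm rho x ((newton rho f x - x) + (z - newton rho f x)).
    by congr (local_norm _ _ _); rewrite [RHS]addrC addrA subrK.
  by rewrite /d' local_norm_distC; exact: local_normD.
have v1 : h / c <= 181 / 20 / 100 by rewrite ler_pdivrMr.
have v0 : 0 <= h / c by rewrite divr_ge0// ltW.
have k : c^-1 * (2^-1 * N * d') <= 134 / 125 * (h / c) ^+ 2.
  have -> : 134 / 125 * (h / c) ^+ 2 = c^-1 * (2^-1 * N * (c^-1 * (67 / 125 * (N * d)) * d)).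
    by rewrite hE; field; rewrite gt_eqF.
  by apply: ler_wpM2l => //; apply: ler_wpM2l => //; rewrite mulr_ge0// invr_ge0.
have cN0 : 0 <= c^-1 * (2^-1 * N) by rewrite !mulr_ge0// invr_ge0.
have vE : h / c = c^-1 * (2^-1 * N) * d by rewrite hE; ring.
have d'v : d' <= 1 / 10 * d.
  apply: (le_trans nc); apply: ler_wpM2r => //.
  have -> : c^-1 * (67 / 125 * (N * d)) = 134 / 125 * (h / c) by rewrite hE; field; rewrite
    gt_eqF.
  lra.
have Ns : N * s <= 2 / 10.
  have Ns1 : N * s <= N * (11 / 10 * d) by rewrite ler_wpM2l//; lra.
  have Nd1 : N * d <= 181 / 10 / 100.
    by move: small; rewrite hE -mulrA; lra.
  by move: Ns1; rewrite mulrCA; lra.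
have sE : local_dist rho x (newton rho f x) x = s by apply: (local_dist_eq A0 rho0 nN N0).
have sE' : local_dist rho x x (newton rho f x) = s.
  rewrite /s local_norm_distC; apply: (local_dist_eq A0 rho0 nN N0).
  by rewrite local_norm_distC.
exists (c^-1 * (2^-1 * N) * s); split.
- by rewrite sE -!EFinM; congr EFin; ring.
- have : c^-1 * (2^-1 * N) * d <= c^-1 * (2^-1 * N) * (s + d') by rewrite ler_wpM2l.
  by rewrite mulrDr -vE; lra.
- have : c^-1 * (2^-1 * N) * s <= c^-1 * (2^-1 * N) * (d + d') by rewrite ler_wpM2l.
  by rewrite mulrDr -vE; lra.
- exact: sE'.
Qed.

Lemma step_test_gap f x z : (forall i, f i != 0) -> nondegenerate rho x -> ~ step_test f x ->
    solution_variety rho f z -> halfstep x z <= 181 / 20 / 100 * inv_cond rho f x ->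
  halfstep x z <= 9 / 100 * inv_cond rho f x.
Proof.
move=> f0 nd nt fz small; have D := unit_of_not_step_test nd nt.
have [c0 _] := mu_inv_cond n0 f0 D.
have [al [alE al1 _ _]] := step_dist f0 D fz small.
rewrite -ler_pdivrMr//; apply: (gap_arith (al := al)) => //.
- by rewrite divr_ge0 ?halfstep_ge0// ltW.
- by rewrite ler_pdivrMr.
- apply: le_trans alpha1_le; rewrite leNgt; apply/negP => al2; apply: nt.
  by rewrite /step_test alE lee_fin ltW.
Qed.

(** At [v = 3 / 40] the value [v + 134 / 125 * v ^+ 2] is below 811/10000. *)
Lemma not_step_test f x z : (forall i, f i != 0) -> DS_op rho f x \in unitmx ->
    solution_variety rho f z -> halfstep x z <= 3 / 40 * inv_cond rho f x ->
  ~ step_test f x.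
Proof.
move=> f0 D fz small; have [c0 _] := mu_inv_cond n0 f0 D.
have nd := nondegenerate_of_unit f0 D.
have small' : halfstep x z <= 181 / 20 / 100 * inv_cond rho f x.
  by apply: (le_trans small); rewrite ler_wpM2r ?ltW//; lra.
have [al [alE _ al1 _]] := step_dist f0 D fz small'.
rewrite /step_test alE lee_fin; apply/negP; rewrite -ltNge; apply: lt_le_trans alpha1_ge.
apply: gap_arith_lt al1; first by rewrite divr_ge0 ?halfstep_ge0// ltW.
by rewrite ler_pdivrMr.
Qed.

End Gap.

(** * Absolute continuity along the path *)

Section PathCoordinates.
Variables (R : realType) (n : nat) (A : 'I_n -> {fset 'rV[R]_n}).
Local Notation C := R[i].
Implicit Types (f : R -> system A) (z : R -> 'cV[C]_n).

(** One finite index set for all coordinates of [f] and [z], so that differentiability almost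
    everywhere is handled once for the whole path. *)
Definition coord_index : Type := ({i : 'I_n & A i} + 'I_n)%type.

Definition coord f z (p : coord_index) t : C :=
  match p with inl q => f t (tag q) (tagged q) | inr j => z t j 0 end.

Definition real_coord f z (p : coord_index + coord_index) t : R :=
  match p with
  | inl q => complex.Re (coord f z q t) | inr q => complex.Im (coord f z q t) end.

Lemma sum_sigma (F : forall i, A i -> R) :
  \sum_i \sum_(a : A i) F i a = \sum_(p : {i : 'I_n & A i}) F (tag p) (tagged p).
Proof. by rewrite sig_big_dep. Qed.

Lemma modc_le_real_coord f z s t q : modc (coord f z q t - coord f z q s) <=
  `|real_coord f z (inl q) t - real_coord f z (inl q) s| +
  `|real_coord f z (inr q) t - real_coord f z (inr q) s|.
Proof. by apply: (le_trans (modc_le_ReIm _)); rewrite /real_coord !raddfB. Qed.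

Lemma sum_modc_le f z s t :
  \sum_i \sum_(a : A i) modc (f t i a - f s i a) + \sum_j modc (z t j 0 - z s j 0) <=
  \sum_p `|real_coord f z p t - real_coord f z p s|.
Proof.
apply: (@le_trans _ _ (\sum_(q : coord_index) modc (coord f z q t - coord f z q s))).
  by rewrite (sum_sigma (fun i a => modc (f t i a - f s i a))) [leRHS]big_sumType.
apply: (le_trans (ler_sum _ (fun q _ => modc_le_real_coord f z s t q))).
by rewrite big_split [leRHS]big_sumType.
Qed.

Lemma ac_real_coord f z (a b : R) : rectifiable a b f z -> forall p, ac a b (real_coord f z p).
Proof.
move=> [rf rz]; have H (g : R -> C) : abs_continuous a b g ->
    ac a b (fun t => complex.Re (g t)) /\ ac a b (fun t => complex.Im (g t)).
  by move=> ag; split=> e e0; have [d d0 K] := ag e e0; exists d => // s sab os sd;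
    apply: le_lt_trans (K s sab os sd); apply: ler_sum => I _; rewrite -raddfB;
    [exact: Re_le_modc|exact: Im_le_modc].
by case=> -[[i u]|j] /=; [have [] := H _ (rf i u)|have [] := H _ (rz j)|have [] := H _ (rf i
  u)|have [] := H _ (rz j)].
Qed.

Lemma ac_path f z (a b K : R) (h : R -> R) : rectifiable a b f z -> 0 <= K ->
    (forall s t, a <= s -> s <= t -> t <= b -> `|h t - h s| <=
      K * (\sum_i \sum_(a : A i) modc (f t i a - f s i a) + \sum_j modc (z t j 0 - z s j 0))) ->
  ac a b h.
Proof.
move=> rfz K0 H; apply: (ac_le_sum K0 (ac_real_coord rfz)) => s t as_ st tb.
by apply: (le_trans (H _ _ as_ st tb)); rewrite ler_wpM2l// sum_modc_le.
Qed.

End PathCoordinates.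

Lemma norm_sub_le (R : realType) (a b c : R) : a <= b + c -> b <= a + c -> `|a - b| <= c.
Proof. by move=> ab ba; rewrite ler_norml; apply/andP; split; lra. Qed.

Section PathRegularity.
Variables (R : realType) (n : nat) (A : 'I_n -> {fset 'rV[R]_n}).
Variable rho : forall i, A i -> R.
Arguments rho : clear implicits.
Hypothesis n0 : (0 < n)%N.
Hypothesis A0 : forall i, A i != fset0.
Hypothesis rho0 : forall i a, 0 < rho i a.
Local Notation C := R[i].
Variables (T : R) (f : R -> system A) (z : R -> 'cV[C]_n).
Hypothesis T0 : 0 <= T.
Hypothesis rfz : rectifiable 0 T f z.
Hypothesis f0 : forall t, 0 <= t <= T -> forall i, f t i != 0.

Lemma local_norm_lipschitz x : exists2 K, 0 <= K &
  forall v, local_norm rho x v <= K * \sum_j modc (v j 0).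
Proof.
have [K K0 H] := mulmx_local_norm_bound rho x 1%:M; exists K => // v.
have := H v; rewrite mul1mx => Hv; apply: (le_trans Hv); apply: ler_wpM2l => //.
by apply: l2_le_sum => j; exact: modc_ge0.
Qed.

Lemma coords_norm_path_ac i : ac 0 T (fun t => coords_norm (f t i)).
Proof.
apply: (ac_path rfz ler01) => s t _ _ _; rewrite mul1r.
apply: (le_trans (coords_norm_dist _ _)); rewrite (bigD1 i)//= -addrA lerDl.
apply: addr_ge0; last by apply: sumr_ge0 => j _; exact: modc_ge0.
by apply: sumr_ge0 => j _; apply: sumr_ge0 => a _; exact: modc_ge0.
Qed.

(** Compactness: the norms are continuous and positive on [[0, T]]. The bound makes normalized rows
    Lipschitz in the coordinates of [f]. *)
Lemma coords_norm_path_lower : exists2 m, 0 < m &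
  forall t, 0 <= t <= T -> forall i, m <= coords_norm (f t i).
Proof.
have /choice[c cP] i : exists c, c \in `[0, T] /\
    forall t, t \in `[0, T] -> coords_norm (f c i) <= coords_norm (f t i).
  by have [c cT H] := EVT_min T0 (ac_continuous (coords_norm_path_ac i)); exists c.
exists (\big[Num.min/1]_i coords_norm (f (c i) i)).
  elim/big_ind: _ => // [u v u0 v0|i _]; first by rewrite lt_min u0.
  by apply: coords_norm_gt0; apply: f0; have [+ _] := cP i; rewrite in_itv.
move=> t tT i; apply: (@le_trans _ _ (coords_norm (f (c i) i))); last by apply: (proj2 (cP i));
  rewrite in_itv.
exact: bigmin_le_cond.
Qed.

Lemma inv_cond_path_ac x : nondegenerate rho x -> ac 0 T (fun t => inv_cond rho (f t) x).
Proof.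
move=> nd; have [m m0 fm] := coords_norm_path_lower.
have m20 : 0 <= 2 / m by rewrite divr_ge0// ltW.
apply: (ac_path rfz m20) => s t s0 st tT.
apply: (le_trans (inv_cond_lipschitz n0 nd m0 (fm t _) (fm s _))).
- by rewrite (le_trans s0 st).
- by rewrite s0 (le_trans st tT).
by rewrite ler_wpM2l// lerDl; apply: sumr_ge0 => j _; exact: modc_ge0.
Qed.

Lemma local_norm_path_ac x : ac 0 T (fun t => local_norm rho x (z t - x)).
Proof.
have [K K0 H] := local_norm_lipschitz x.
apply: (ac_path rfz K0) => s t s0 st tT.
apply: (@le_trans _ _ (local_norm rho x (z t - z s))); last first.
  apply: (le_trans (H _)); rewrite ler_wpM2l//.
  have -> : \sum_j modc ((z t - z s) j 0) = \sum_j modc (z t j 0 - z s j 0).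
    by apply: eq_bigr => j _; rewrite !mxE.
  rewrite lerDr.
  by apply: sumr_ge0 => j _; apply: sumr_ge0 => a _; exact: modc_ge0.
have tri u v : local_norm rho x (u - x) <= local_norm rho x (v - x) + local_norm rho x (u - v).
  rewrite (_ : u - x = (v - x) + (u - v)); first exact: local_normD.
  by rewrite [RHS]addrC addrA subrK.
apply: norm_sub_le; first exact: tri.
by apply: (le_trans (tri _ (z t))); rewrite lerD2l (local_norm_distC rho x (z s) (z t)).
Qed.

Lemma halfstep_path_ac x : nondegenerate rho x -> ac 0 T (fun t => halfstep rho x (z t)).
Proof.
move=> nd; have [_ N1 _] := nu_facts n0 A0 rho0 nd.
have K0 : 0 <= 2^-1 * fine (nu rho x) by rewrite mulr_ge0 ?invr_ge0// (le_trans ler01).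
apply: (ac_le K0 (local_norm_path_ac x)) => s t _ _ _.
by rewrite /halfstep -mulrBr normrM ger0_norm.
Qed.

End PathRegularity.

(** * Finiteness of the condition length *)

Lemma mul_conjc_modc (R : realType) (w : R[i]) : w * conjc w = real_complex R (modc w ^+ 2).
Proof.
rewrite sqr_modc; case: w => u v; apply/eqP; rewrite eq_complex /=.
by apply/andP; split; apply/eqP; ring.
Qed.

(** Compactness in near-covering form along the filter of large [K]: local bounds that persist for
    larger [K] become one global bound. *)
Lemma segment_uniform_bound (R : realType) (a b : R) (P : R -> R -> Prop) :
    (forall t0, a <= t0 <= b -> exists d K0, 0 < d /\
      forall t K, a <= t <= b -> `|t0 - t| < d -> K0 <= K -> P K t) ->
  exists K, forall t, a <= t <= b -> P K t.
Proof.
move=> H; have /compact_near_coveringP/near_covering_withinP := @segment_compact R a b.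
move=> /(_ R (pinfty_nbhs R) P _) []; last first.
  move=> K [_ HK]; exists (K + 1) => t tab; apply: (HK (K + 1)); first by rewrite ltrDl.
  by rewrite /= in_itv.
move=> t0; rewrite /= in_itv/= => /H[d [K0 [d0 HP]]].
exists (ball t0 d, [set K | K0 < K]) => /=.
  by split; [exact: nbhsx_ballx|exists K0; split => //; exact: num_real].
move=> [t K] [/= td KK]; rewrite in_itv/= => tab.
by apply: HP => //; exact: ltW.
Qed.

Section ConditionLength.
Variables (R : realType) (n : nat) (A : 'I_n -> {fset 'rV[R]_n}).
Variable rho : forall i, A i -> R.
Arguments rho : clear implicits.
Hypothesis n0 : (0 < n)%N.
Hypothesis A0 : forall i, A i != fset0.
Hypothesis rho0 : forall i a, 0 < rho i a.
Local Notation C := R[i].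
Variables (T : R) (f : R -> system A) (z : R -> 'cV[C]_n).
Hypothesis T0 : 0 <= T.
Hypothesis rfz : rectifiable 0 T f z.
Hypothesis f0 : forall t, 0 <= t <= T -> forall i, f t i != 0.
Hypothesis fz : forall t, 0 <= t <= T -> solution_variety rho (f t) (z t).
Hypothesis unitfz : forall t, 0 <= t <= T -> DS_op rho (f t) (z t) \in unitmx.

Let bounded K t := [/\ cond_le rho (f t) (z t) K, nu_le rho (z t) K &
  forall v, local_norm rho (z t) v <= K * \sum_j modc (v j 0)].

(** Bounds at [z t0] are carried to [z t] by a change of center, in place of continuity of mu and
    nu. *)
Lemma path_locally_bounded t0 : 0 <= t0 <= T -> exists d K0, 0 < d /\
  forall t K, 0 <= t <= T -> `|t0 - t| < d -> K0 <= K -> bounded K t.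
Proof.
move=> t0T; have D0 := unitfz t0T; have nd := nondegenerate_of_unit (f0 t0T) D0.
have [c0 _] := mu_inv_cond n0 (f0 t0T) D0.
have [nuE N1 nN] := nu_facts n0 A0 rho0 nd.
have [K K0 HK] := local_norm_lipschitz rho (z t0).
set c := inv_cond rho (f t0) (z t0) in c0.
set N := fine _ in nuE N1 nN.
have N0 : 0 < N := lt_le_trans ltr01 N1.
(* Near [t0] the reciprocal condition number stays above [c / 2], so [cond_le] holds with [M] at
   [z t0]; [M * r <= 1 / 4] will keep the denominator of [cond_recenter] positive. *)
pose M := 2 / c; have M0 : 0 < M by rewrite divr_gt0.
pose r := Num.min (1 / 10) (1 / 4 / M).
have r0 : 0 < r by rewrite lt_min !divr_gt0.
have r1 : r <= 1 / 10 by rewrite ge_min lexx.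
have Mr : M * r <= 1 / 4 by rewrite mulrC -ler_pdivlMr// ge_min lexx orbT.
have [d1 d10 H1] := ac_unif_continuous (inv_cond_path_ac n0 T0 rfz f0 nd) (divr_gt0 c0 (ltr0n R
  2)).
have [d2 d20 H2] := ac_unif_continuous (local_norm_path_ac rho rfz (z t0)) (divr_gt0 r0 N0).
pose E := expR r.
have q1 : M * (E - 1 + (E ^+ 2 - 1) * 0) < 1.
  have r2 : r ^+ 2 <= 1 / 10 * r by rewrite expr2 ler_wpM2r// ltW.
  have Er : E - 1 <= 11 / 10 * r.
    have := expR_le_quad (ltW r0) (_ : r <= 2 / 10); rewrite -/E => EE.
    have {}EE : E <= 1 + r + 67 / 125 * r ^+ 2 by apply: EE; lra.
    lra.
  rewrite mulr0 addr0; have := ler_wpM2l (ltW M0) Er; rewrite mulrCA; lra.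
exists (Num.min d1 d2), (Num.max (M * E * (21 / 20) / (1 - M * (E - 1 + (E ^+ 2 - 1) * 0)))
  (Num.max (E ^+ 3 * (21 / 20) * N) (E * K))).
split; first by rewrite lt_min d10.
move=> t L tT; rewrite lt_min !ge_max => /andP[td1 td2] /andP[L1 /andP[L2 L3]].
have cM : cond_le rho (f t) (z t0) M.
  move=> w; have ct := H1 _ _ t0T tT td1.
  have : M^-1 <= inv_cond rho (f t) (z t0).
    by rewrite invf_div; move: ct; rewrite ltr_norml => /andP[_]; rewrite -/c; lra.
  move=> /(ler_wpM2r (local_norm_ge0 rho (z t0) w)) h.
  have := le_trans h (inv_cond_le rho (f t) (z t0) w).
  by rewrite ler_pdivrMl.
have xyr i (a : A i) : modc (ell rho (z t0) a (z t - z t0)) <= r.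
  apply: (le_trans (ell_le_nu _ _ (ltW N0) nN)).
  have := H2 _ _ t0T tT td2; rewrite subrr local_norm0 sub0r normrN ger0_norm ?local_norm_ge0//.
  by rewrite ltr_pdivlMr// mulrC => /ltW.
have Bb : E ^+ 2 - 2 * r <= (21 / 20) ^+ 2.
  by apply: (expR_sqr_num (ltW r0) r1); lra.
have b0 : (0 : R) <= 21 / 20 by lra.
split.
- have cM' := cond_recenter A0 rho0 xyr b0 Bb (ltW r0) (f0 tT) (lexx 0) M0 _ cM q1.
  move=> w; apply: (le_trans (cM' _ w)); last by rewrite ler_wpM2r ?dn_ge0.
  by move=> i; rewrite mul0r (solution_S_op (z t0) (fz tT)) modc0.
- move=> i a u; apply: (le_trans (nu_recenter A0 rho0 xyr b0 Bb (ltW r0) N1 nN a u)).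
  by rewrite ler_wpM2r ?local_norm_i_ge0.
- move=> v; apply: (le_trans (local_norm_recenter A0 rho0 xyr v)).
  apply: (@le_trans _ _ (E * K * \sum_j modc (v j 0))).
    by rewrite -mulrA ler_wpM2l ?expR_ge0.
  by apply: ler_wpM2r => //; apply: sumr_ge0 => j _; exact: modc_ge0.
Qed.

Lemma path_bounded : exists2 K, 0 <= K & forall t, 0 <= t <= T ->
  [/\ (mu rho (f t) (z t) <= K%:E)%E, (nu rho (z t) <= K%:E)%E &
   forall v, local_norm rho (z t) v <= K * \sum_j modc (v j 0)].
Proof.
have [K HK] := segment_uniform_bound path_locally_bounded.
have K1 t : 0 <= t <= T -> 0 <= K.
  move=> tT; have [cK _ _] := HK t tT.
  have nd := nondegenerate_of_unit (f0 tT) (unitfz tT).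
  exact: le_trans ler01 (one_le_of_cond_le n0 (f0 tT) nd cK).
exists K; first by apply: (K1 0); rewrite lexx.
move=> t tT; have K0 := K1 t tT; have [cK nK HvK] := HK t tT.
have [-> _ _ minm] := mu_spec (f0 tT) (unitfz tT).
have [-> _ _ minn] := nu_spec A0 rho0 (z t) n0.
by split=> //; rewrite lee_fin; [exact: minm|exact: minn].
Qed.

(** The orthogonal part of [g] is bounded crudely by twice [g], as only integrability is at
    stake. *)
Lemma fubini_study_le i (h g : coords A i) : h != 0 ->
  fubini_study h g <= 2 / coords_norm h * \sum_a modc (g a).
Proof.
move=> h0; have hp := coords_norm_gt0 h0; have hn : coords_norm h != 0 by rewrite gt_eqF.
have hh : hermitian h h = (coords_norm h ^+ 2)%:C%C.
  rewrite coords_normE sqr_l2 rmorph_sum; apply: eq_bigr => a _.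
  exact: mul_conjc_modc.
have gh : modc (hermitian g h) <= coords_norm g * coords_norm h.
  apply: (le_trans (l2_modc_CS _ _)); rewrite !coords_normE.
  by rewrite (_ : l2 (fun a => modc (conjc (h a))) = l2 (fun a => modc (h a)))//; apply: eq_l2
    => a; rewrite modc_conj.
have gs : coords_norm g <= \sum_a modc (g a).
  by rewrite coords_normE; apply: l2_le_sum => a; exact: modc_ge0.
rewrite /fubini_study ler_pdivrMr// mulrAC divfK//.
apply: (@le_trans _ _ (2 * coords_norm g)); last by rewrite ler_wpM2l.
rewrite mulr_natl mulr2n !coords_normE.
apply: (@le_trans _ _ (l2 (fun a => modc (g a)) + l2 (fun a => coords_norm g / coords_norm h *
  modc (h a)))).
  apply: l2_triangle => a; rewrite ger0_norm ?modc_ge0// ffunE.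
  apply: (le_trans (modcB _ _)); rewrite lerD2l modcM ler_wpM2r ?modc_ge0//.
  rewrite hh modcM modcV modc_real ger0_norm ?sqr_ge0//.
  by rewrite ler_pdivrMr ?exprn_gt0// expr2 mulrA divfK.
by rewrite l2Z ?divr_ge0 ?l2_ge0// -!coords_normE divfK.
Qed.

Lemma velocity_le t (d : coord_index A + coord_index A -> R) :
    (forall p, is_derive t (1 : R) (real_coord f z p) (d p)) ->
  \sum_i \sum_(a : A i) modc (system_velocity f t i a) + \sum_j modc (point_velocity z t j 0) <=
  \sum_p `|d p|.
Proof.
move=> D; pose F (q : coord_index A) := velocity (coord f z q) t.
have HF q : modc (F q) <= `|d (inl q)| + `|d (inr q)|.
  apply: (le_trans (modc_le_ReIm _)); rewrite /F /velocity /= !derive1E.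
  have e1 := @derive_val _ _ _ _ _ _ _ (D (inl q)).
  have e2 := @derive_val _ _ _ _ _ _ _ (D (inr q)).
  by rewrite -e1 -e2.
apply: (@le_trans _ _ (\sum_q modc (F q))).
  rewrite (sum_sigma (fun i a => modc (system_velocity f t i a))) [leRHS]big_sumType le_eqVlt;
    apply/orP; left; apply/eqP.
  congr (_ + _).
    by apply: eq_bigr => q _; rewrite ffunE.
  by apply: eq_bigr => q _; rewrite mxE.
apply: (le_trans (ler_sum _ (fun q _ => HF q))).
by rewrite big_split [leRHS]big_sumType.
Qed.

Lemma sqrt_sqr_le (a b : R) : 0 <= a -> 0 <= b -> Num.sqrt (a ^+ 2 + b ^+ 2) <= a + b.
Proof.
move=> a0 b0; apply: le_of_sqr; first exact: addr_ge0.
rewrite sqr_sqrtr ?addr_ge0 ?sqr_ge0// -subr_ge0 (_ : _ - _ = 2 * (a * b)); last by ring.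
by rewrite !mulr_ge0.
Qed.

Let speed t := Num.sqrt (FS_norm (f t) (system_velocity f t) ^+ 2 +
  local_norm rho (z t) (point_velocity z t) ^+ 2).

Lemma mu_ge0 t : 0 <= t <= T -> (0 <= mu rho (f t) (z t))%E.
Proof. by move=> tT; have [-> m0 _ _] := mu_spec (f0 tT) (unitfz tT); rewrite lee_fin. Qed.

Lemma nu_ge0 x : (0 <= nu rho x)%E.
Proof. by have [-> N0 _ _] := nu_spec A0 rho0 x n0; rewrite lee_fin. Qed.

Lemma condition_integrand_ge0 t : 0 <= t <= T ->
  (0 <= mu rho (f t) (z t) * nu rho (z t) * (speed t)%:E)%E.
Proof.
by move=> tT; rewrite !mule_ge0 ?mu_ge0 ?nu_ge0// lee_fin sqrtr_ge0.
Qed.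

(** mu, nu and the norms are bounded along the path, so the integrand is at most a constant times
    the sum of the absolute coordinate derivatives. *)
Lemma condition_length_lty : (condition_length rho f z 0 T < +oo)%E.
Proof.
have [K K0 HK] := path_bounded; have [m m0 fm] := coords_norm_path_lower T0 rfz f0.
have C0 : 0 <= K * K * (2 / m + K) by rewrite !mulr_ge0 ?addr_ge0 ?divr_ge0// ltW.
apply: (ac_integral_lty T0 C0 (ac_real_coord rfz)); first exact: condition_integrand_ge0.
move=> t d /andP[t0 tT] D; have tT' : 0 <= t <= T by rewrite !ltW.
have [muK nuK HvK] := HK t tT'.
apply: (@le_trans _ _ (K%:E * K%:E * (speed t)%:E)%E).
  rewrite lee_wpmul2r ?lee_fin ?sqrtr_ge0//.
  by apply: lee_pmul => //; [exact: mu_ge0|exact: nu_ge0].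
rewrite -!EFinM lee_fin -[leRHS]mulrA ler_wpM2l ?mulr_ge0//.
have := velocity_le D; set s1 := \sum_i _; set s2 := \sum_j _ => s12.
have s20 : 0 <= s2 by apply: sumr_ge0 => j _; exact: modc_ge0.
have s10 : 0 <= s1 by apply: sumr_ge0 => j _; apply: sumr_ge0 => a _; exact: modc_ge0.
have Fs : FS_norm (f t) (system_velocity f t) <= 2 / m * s1.
  rewrite /FS_norm -/(l2 _) /s1 mulr_sumr; apply: (le_trans (l2_le_sum _)).
    by move=> i; rewrite divr_ge0 ?l2_ge0.
  apply: ler_sum => i _; apply: (le_trans (fubini_study_le _ (f0 tT' i))).
  apply: ler_wpM2r; first by apply: sumr_ge0 => a _; exact: modc_ge0.
  apply: ler_wpM2l => //; rewrite lef_pV2 ?posrE//; first exact: fm.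
  exact: coords_norm_gt0 (f0 tT' i).
apply: (le_trans (sqrt_sqr_le (sqrtr_ge0 _) (local_norm_ge0 _ _ _))).
apply: (le_trans (lerD Fs (HvK _))); rewrite -/s2.
apply: (@le_trans _ _ ((2 / m + K) * (s1 + s2))).
  have m20 : 0 <= 2 / m by rewrite divr_ge0// ltW.
  rewrite -subr_ge0 (_ : _ - _ = 2 / m * s2 + K * s1); last by ring.
  by apply: addr_ge0; apply: mulr_ge0.
by rewrite ler_wpM2l// addr_ge0// divr_ge0// ltW.
Qed.

End ConditionLength.

(** * Derivatives along the path *)

Section ComplexPathDerivative.
Variable R : realType.
Local Notation C := R[i].
Implicit Types (t : R).

Lemma is_derive_bigsum (I : finType) t (g : I -> R -> R) (d : I -> R) :
    (forall i, is_derive t (1 : R) (g i) (d i)) ->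
  is_derive t (1 : R) (fun s => \sum_i g i s) (\sum_i d i).
Proof.
move=> gd; rewrite [X in is_derive _ _ X _](_ : _ = \sum_i g i); last first.
  by apply/funext => s; rewrite fct_sumE.
by elim/big_ind2: _ => // [|? ? ? ?]; [exact: is_derive_cst|exact: is_deriveD].
Qed.

Definition is_cderive (g : R -> C) t (v : C) :=
  is_derive t (1 : R) (fun s => complex.Re (g s)) (complex.Re v) /\
  is_derive t (1 : R) (fun s => complex.Im (g s)) (complex.Im v).

Lemma is_deriveMr t (g : R -> R) (k d : R) : is_derive t (1 : R) g d ->
  is_derive t (1 : R) (fun s => k * g s) (k * d).
Proof. by move=> gd; exact: (@is_deriveZ _ _ _ g k t 1 d gd). Qed.

Lemma is_cderiveMl (g : R -> C) t v (q : C) : is_cderive g t v -> is_cderive (fun s => q * g s)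
  t (q * v).
Proof.
case: q v => q1 q2 [v1 v2] [/= D1 D2]; split => /=.
  rewrite [X in is_derive _ _ X _](_ : _ = (fun s => q1 * complex.Re (g s)) - (fun s => q2 *
    complex.Im (g s))).
    by apply: is_deriveB; exact: is_deriveMr.
  by apply/funext => s; transitivity (q1 * complex.Re (g s) - q2 * complex.Im (g s)); [case: (g
    s)|].
rewrite [X in is_derive _ _ X _](_ : _ = (fun s => q1 * complex.Im (g s)) + (fun s => q2 *
  complex.Re (g s))).
  by apply: is_deriveD; exact: is_deriveMr.
by apply/funext => s; transitivity (q1 * complex.Im (g s) + q2 * complex.Re (g s)); [case: (g
  s)|].
Qed.

Lemma is_cderive_sum (I : finType) t (q : I -> C) (g : I -> R -> C) (v : I -> C) :
    (forall i, is_cderive (g i) t (v i)) ->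
  is_cderive (fun s => \sum_i q i * g i s) t (\sum_i q i * v i).
Proof.
move=> gv; split.
  rewrite raddf_sum [X in is_derive _ _ X _](_ : _ = fun s => \sum_i complex.Re (q i * g i s)).
    by apply: is_derive_bigsum => i; have [] := is_cderiveMl (q i) (gv i).
  by apply/funext => s; rewrite raddf_sum.
rewrite raddf_sum [X in is_derive _ _ X _](_ : _ = fun s => \sum_i complex.Im (q i * g i s)).
  by apply: is_derive_bigsum => i; have [] := is_cderiveMl (q i) (gv i).
by apply/funext => s; rewrite raddf_sum.
Qed.

Lemma is_derive_sqr_modc (g : R -> C) t v : is_cderive g t v ->
  is_derive t (1 : R) (fun s => modc (g s) ^+ 2) (2 * complex.Re (conjc (g t) * v)).
Proof.
move=> [D1 D2].
have := is_deriveD (is_deriveM D1 D1) (is_deriveM D2 D2).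
rewrite [X in is_derive _ _ X _](_ : _ = fun s => modc (g s) ^+ 2); last first.
  by apply/funext => s; rewrite sqr_modc !expr2.
move=> D; apply: (is_derive_eq D); rewrite /GRing.scale /=.
case: (g t) => a b; case: v {D1 D2 D} => c d /=; ring.
Qed.

Lemma is_derive_quotient (P Q : R -> R) t p q : Q t != 0 ->
    is_derive t (1 : R) P p -> is_derive t (1 : R) Q q ->
  is_derive t (1 : R) (fun s => P s / Q s) ((p * Q t - P t * q) / Q t ^+ 2).
Proof.
move=> Q0 Pp Qq; have := is_deriveM Pp (is_deriveV Q0 Qq).
rewrite [X in is_derive _ _ X _](_ : _ = fun s => P s / Q s)//.
move=> D; apply: (is_derive_eq D); rewrite /GRing.scale /=.
rewrite expr2 invfM; field; exact: Q0.
Qed.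

End ComplexPathDerivative.

Section RowDerivative.
Variables (R : realType) (n : nat) (A : 'I_n -> {fset 'rV[R]_n}) (i : 'I_n).
Local Notation C := R[i].
Implicit Types (h : R -> coords A i) (v : coords A i) (q : A i -> C).

Lemma hermitian_self (h : coords A i) : hermitian h h = real_complex R (coords_norm h ^+ 2).
Proof.
rewrite coords_normE sqr_l2 rmorph_sum; apply: eq_bigr => a _; exact: mul_conjc_modc.
Qed.

Lemma row_derive_identity (F F' k : C) (Q : R) : Q != 0 ->
  (2 * complex.Re (conjc F * F') * Q - modc F ^+ 2 * (2 * (Q * complex.Re k))) / Q ^+ 2 =
  2 * complex.Re (conjc F * (F' - k * F)) / Q.
Proof.
move=> Q0; rewrite sqr_modc; case: F => a b; case: F' => c d; case: k => u w /=.
by field.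
Qed.

(** With [k] the coefficient of the projection of [v] on [h t], the quotient rule replaces [v] by
    [v - k h]: normalization removes the component along [h], and the rest is measured by
    [fubini_study]. The square is taken because a modulus may fail to be differentiable at 0. *)
Lemma row_derive h v q t : h t != 0 -> (forall a, is_cderive (fun s => h s a) t (v a)) ->
  exists2 D, is_derive t (1 : R) (fun s => (modc (\sum_a q a * h s a) / coords_norm (h s)) ^+
    2) D &
   `|D| <= 2 * (modc (\sum_a q a * h t a) / coords_norm (h t) *
     (l2 (fun a => modc (q a)) * fubini_study (h t) v)).
Proof.
move=> h0 hv; have hp := coords_norm_gt0 h0.
have QE s : coords_norm (h s) ^+ 2 = \sum_a modc (h s a) ^+ 2 by rewrite coords_normE sqr_l2.
have Q0 : \sum_a modc (h t a) ^+ 2 != 0 by rewrite -QE expf_neq0// gt_eqF.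
have DF := is_derive_sqr_modc (is_cderive_sum q hv).
have DQ := is_derive_bigsum (fun a => is_derive_sqr_modc (hv a)).
have := is_derive_quotient Q0 DF DQ.
rewrite [X in is_derive _ _ X _](_ : _ = fun s => (modc (\sum_a q a * h s a) / coords_norm (h
  s)) ^+ 2); last first.
  by apply/funext => s; rewrite expr_div_n QE.
set k := hermitian v (h t) / hermitian (h t) (h t).
have kE : \sum_a 2 * complex.Re (conjc (h t a) * v a) =
    2 * ((\sum_a modc (h t a) ^+ 2) * complex.Re k).
  have -> : \sum_a 2 * complex.Re (conjc (h t a) * v a) = 2 * complex.Re (hermitian v (h t)).
    rewrite -mulr_sumr /hermitian raddf_sum; congr (_ * _).
    by apply: eq_bigr => a _; rewrite mulrC.
  congr (_ * _); rewrite /k hermitian_self QE.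
  have QC0 : real_complex R (\sum_a modc (h t a) ^+ 2) != 0.
    by rewrite -modc_eq0 modc_real normr_eq0.
  rewrite -{1}[hermitian v (h t)](divfK QC0); move: (hermitian v (h t) / _) => w.
  by case: w => a b /=; rewrite mulr0 subr0 mulrC.
rewrite kE row_derive_identity// => D.
eexists; first exact: D.
have -> : \sum_a q a * v a - k * \sum_a q a * h t a =
    \sum_a q a * [ffun a => v a - k * h t a] a.
  by rewrite mulr_sumr -sumrB; apply: eq_bigr => a _; rewrite ffunE; ring.
set g := [ffun _ => _].
have qg : modc (\sum_a q a * g a) <= l2 (fun a => modc (q a)) * coords_norm g.
  by rewrite coords_normE; exact: l2_modc_CS.
have Qi0 : 0 <= (coords_norm (h t) ^+ 2)^-1 by rewrite invr_ge0 sqr_ge0.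
rewrite -QE -mulrA normrM normrM (ger0_norm (ler0n R 2)) (ger0_norm Qi0).
rewrite ler_pM2l// ler_pdivrMr ?exprn_gt0//.
apply: (le_trans (Re_le_modc _)); rewrite modcM modc_conj.
rewrite /fubini_study -/k -/g.
rewrite (_ : _ / _ * _ * _ ^+ 2 = modc (\sum_a q a * h t a) * (l2 (fun a => modc (q a)) *
  coords_norm g)).
  by rewrite ler_wpM2l ?modc_ge0.
by field; rewrite gt_eqF.
Qed.

End RowDerivative.

Section SegmentDerivatives.
Variables (R : realType) (n : nat) (A : 'I_n -> {fset 'rV[R]_n}).
Variable rho : forall i, A i -> R.
Arguments rho : clear implicits.
Hypothesis A0 : forall i, A i != fset0.
Hypothesis rho0 : forall i a, 0 < rho i a.
Local Notation C := R[i].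
Variables (f : R -> system A) (z : R -> 'cV[C]_n).

Lemma is_cderive_velocity (g : R -> C) t : derivable (fun s => complex.Re (g s) : R^o) t 1 ->
  derivable (fun s => complex.Im (g s) : R^o) t 1 -> is_cderive g t (velocity g t).
Proof. by move=> D1 D2; split; rewrite /= derive1E; exact: DeriveDef. Qed.

Lemma is_cderive_coord t q : (forall p, derivable (real_coord f z p) t 1) ->
  is_cderive (coord f z q) t (velocity (coord f z q) t).
Proof.
by move=> D; apply: is_cderive_velocity; [exact: (D (inl q))|exact: (D (inr q))].
Qed.

Lemma dn_derive x w t : (forall i, f t i != 0) ->
    (forall p, derivable (real_coord f z p) t 1) ->
  exists2 D, is_derive t (1 : R) (fun s => dn rho (f s) x w ^+ 2) D &
    `|D| <= 2 * (dn rho (f t) x w * (local_norm rho x w * FS_norm (f t) (system_velocity f t))).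
Proof.
move=> f0 D.
pose q i (a : A i) := vv rho x a * ell rho x a w.
have rowE s i : rowsum rho (f s) x (fun i a => ell rho x a w) i = \sum_a q i a * f s i a.
  by [].
have dn2E s : dn rho (f s) x w ^+ 2 = \sum_i (modc (\sum_a q i a * f s i a) / coords_norm (f s
  i)) ^+ 2.
  by rewrite dnE sqr_l2.
have hv i a : is_cderive (fun s => f s i a) t (system_velocity f t i a).
  by rewrite ffunE; exact: (is_cderive_coord (inl (Tagged (fun i => A i) a)) D).
have /choice[d dP] i : exists d, is_derive t (1 : R)
    (fun s => (modc (\sum_a q i a * f s i a) / coords_norm (f s i)) ^+ 2) d /\
    `|d| <= 2 * (modc (\sum_a q i a * f t i a) / coords_norm (f t i) *
     (l2 (fun a => modc (q i a)) * fubini_study (f t i) (system_velocity f t i))).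
  by have [d d1 d2] := row_derive (q i) (f0 i) (hv i); exists d.
exists (\sum_i d i).
  rewrite [X in is_derive _ _ X _](_ : _ = fun s => \sum_i (modc (\sum_a q i a * f s i a) /
    coords_norm (f s i)) ^+ 2).
    by apply: is_derive_bigsum => i; have [] := dP i.
  by apply/funext => s; exact: dn2E.
have qE i : l2 (fun a => modc (q i a)) = local_norm_i rho i x w.
  by rewrite local_norm_iE//; apply: eq_l2 => a; rewrite modcM.
apply: (le_trans (ler_norm_sum _ _ _)).
apply: (@le_trans _ _ (2 * \sum_i (modc (\sum_a q i a * f t i a) / coords_norm (f t i) *
  (local_norm_i rho i x w * fubini_study (f t i) (system_velocity f t i))))).
  by rewrite mulr_sumr; apply: ler_sum => i _; have [_] := dP i; rewrite qE.
rewrite ler_wpM2l//; apply: (le_trans (l2_CS _ _)).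
have -> : l2 (fun i => modc (\sum_a q i a * f t i a) / coords_norm (f t i)) = dn rho (f t) x w.
  by rewrite dnE.
rewrite ler_wpM2l ?dn_ge0// -[leRHS]l2Z ?local_norm_ge0//; apply: l2_le => i.
have F0 : 0 <= fubini_study (f t i) (system_velocity f t i) by rewrite divr_ge0 ?l2_ge0.
rewrite ger0_norm; last by apply: mulr_ge0; [exact: local_norm_i_ge0|exact: F0].
by apply: ler_wpM2r => //; exact: local_norm_i_le.
Qed.

End SegmentDerivatives.

(** [q] contains [63 / 20 = 63 / 50 * (5 / 2)], the product of the losses in the norm and in mu nu
    between the center and the path. *)
Lemma move_arith (R : realType) (d q N K e F Zx Zz P ct cb k S : R) : 0 < d -> 0 < q -> 0 <= N
  -> 0 <= K ->
    K = N / (d * q) -> e = K * F -> F <= d * Zx -> Zx <= 63 / 50 * Zz -> N <= ct * (5 / 2 * P) ->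
    ct <= k * cb -> q = 63 / 20 * k * cb -> 0 <= P -> 0 <= Zz -> Zz <= S ->
  e <= P * S.
Proof.
move=> d0 q0 N0 K0 KE -> Fd ZZ NP ck qE P0 Z0 ZS.
apply: (@le_trans _ _ (P * Zz)); last by rewrite ler_wpM2l.
apply: (@le_trans _ _ (K * (d * (63 / 50 * Zz)))).
  apply: ler_wpM2l => //; apply: (le_trans Fd); rewrite ler_wpM2l// ltW//.
have -> : K * (d * (63 / 50 * Zz)) = N * (63 / 50) / q * Zz.
  by rewrite KE; field; rewrite !gt_eqF.
apply: ler_wpM2r => //; rewrite ler_pdivrMr//.
have : N <= k * cb * (5 / 2 * P).
  by apply: (le_trans NP); apply: ler_wpM2r => //; apply: mulr_ge0 => //; lra.
rewrite qE (_ : P * (63 / 20 * k * cb) = 63 / 50 * (k * cb * (5 / 2 * P))); last by field.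
lra.
Qed.

(** The choice of 59: [21 / 20 * (1 / 25) + 2^-1 * (63 / 20) * (21 / 20) / 59] is about 0.0700,
    below [29 / 400 = 0.0725]. *)
Lemma short_step_arith (R : realType) (N db da m ca cb k : R) : 0 <= N -> db <= da + m ->
    2^-1 * N * da <= 1 / 25 * ca -> ca <= k * cb -> k <= 21 / 20 -> 0 < cb ->
    N * m <= 63 / 20 * k * cb * (1 / 59) ->
  2^-1 * N * db <= 29 / 400 * cb.
Proof.
move=> N0 dd Hda ck k1 cb0 Nm.
have H : N * db <= N * (da + m) by rewrite ler_wpM2l.
have kcb : k * cb <= 21 / 20 * cb by rewrite ler_wpM2r// ltW.
have Hda' : 2^-1 * (N * da) <= 1 / 25 * ca by rewrite mulrA.
have Nm' : N * m <= 63 / 20 * (1 / 59) * (k * cb).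
  by rewrite (_ : _ * (k * cb) = 63 / 20 * k * cb * (1 / 59)); [exact: Nm|ring].
rewrite -mulrA; rewrite mulrDr in H; lra.
Qed.

(** The losses are 152/100 for [M] and 164/100 for [N]; their product is below 5/2. *)
Lemma recenter_ratio_arith (R : realType) (M N M' N' r E : R) : 1 <= M -> 0 <= N -> 0 <= M' ->
  0 <= N' ->
    0 <= r -> M * r <= 18 / 100 -> E <= 1 + r + 67 / 125 * r ^+ 2 -> 1 <= E ->
    M <= E * (21 / 20) * M' * (1 + M * (E - 1)) -> N <= (E + E ^+ 2 - 1) * N' ->
  M * N <= 5 / 2 * (M' * N') /\ E <= 6 / 5.
Proof.
move=> M1 N0 M'0 N'0 r0 Mr EE E1 MM NN.
have r1 : r <= 18 / 100 by apply: le_trans Mr; rewrite -[leLHS]mul1r ler_wpM2r.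
have r2 : r ^+ 2 <= 18 / 100 * r by rewrite expr2 ler_wpM2r.
have E65 : E <= 6 / 5 by lra.
split; last exact: E65.
have ME : M * (E - 1) <= 1 / 5.
  apply: (@le_trans _ _ (M * (11 / 10 * r))); last by rewrite mulrCA; lra.
  by apply: ler_wpM2l; lra.
have E0 : 0 <= E by lra.
have ME0 : 0 <= M * (E - 1) by apply: mulr_ge0; lra.
have M1' : M <= 152 / 100 * M'.
  apply: (le_trans MM).
  have -> : E * (21 / 20) * M' * (1 + M * (E - 1)) = E * (1 + M * (E - 1)) * (21 / 20 * M') by
    ring.
  have : E * (1 + M * (E - 1)) <= 6 / 5 * (6 / 5) by apply: ler_pM; lra.
  have m0 : 0 <= 21 / 20 * M' by apply: mulr_ge0; lra.
  by move=> /(ler_wpM2r m0); lra.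
have N1' : N <= 164 / 100 * N'.
  apply: (le_trans NN); apply: ler_wpM2r => //.
  have : E ^+ 2 <= 6 / 5 * (6 / 5) by rewrite expr2; apply: ler_pM; lra.
  lra.
have M0 : 0 <= M by lra.
have := ler_pM M0 N0 M1' N1'.
have : 0 <= M' * N' by exact: mulr_ge0.
rewrite (_ : 152 / 100 * M' * (164 / 100 * N') = 152 / 100 * (164 / 100) * (M' * N')); last by
  ring.
lra.
Qed.

(** * One step of the homotopy *)

Section Segment.
Variables (R : realType) (n : nat) (A : 'I_n -> {fset 'rV[R]_n}).
Variable rho : forall i, A i -> R.
Arguments rho : clear implicits.
Hypothesis n0 : (0 < n)%N.
Hypothesis A0 : forall i, A i != fset0.
Hypothesis rho0 : forall i a, 0 < rho i a.
Local Notation C := R[i].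

Lemma controlled_ratio_aux (f : system A) (x z : 'cV[C]_n) (M N M' N' : R) :
    (forall i, f i != 0) -> solution_variety rho f z ->
    1 <= M -> cond_le rho f x M -> (forall L, 0 < L -> cond_le rho f x L -> M <= L) ->
    1 <= N -> nu_le rho x N -> (forall L, 0 <= L -> nu_le rho x L -> N <= L) ->
    1 <= M' -> cond_le rho f z M' -> 1 <= N' -> nu_le rho z N' ->
    2^-1 * N * local_norm rho x (z - x) <= 9 / 100 / M ->
  M * N <= 5 / 2 * (M' * N') /\
  forall u, local_norm rho x u <= 63 / 50 * local_norm rho z u.
Proof.
move=> f0 fz M1 cM minM N1 nN minN M'1 cM' N'1 nN' small.
have M'0 : 0 <= M' by lra.
have N0 : 0 <= N by lra.
have N'0 : 0 <= N' by lra.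
have M0 : 0 < M by lra.
have dd0 := local_norm_ge0 rho x (z - x).
pose r := N * local_norm rho x (z - x).
have r0 : 0 <= r by exact: mulr_ge0.
have Mr : M * r <= 18 / 100.
  rewrite mulrC -ler_pdivlMr//; move: small; rewrite -mulrA -/r; lra.
have rM : r <= 18 / 100 by apply: le_trans Mr; rewrite -[leLHS]mul1r ler_wpM2r.
have E1 : 1 <= expR r by rewrite -expR0 ler_expR.
have EE : expR r <= 1 + r + 67 / 125 * r ^+ 2 by apply: expR_le_quad => //; lra.
have b0 : (0 : R) <= 21 / 20 by lra.
have Bb : expR r ^+ 2 - 2 * r <= (21 / 20) ^+ 2 by apply: (expR_sqr_num r0 rM); lra.
have xyr i (a : A i) : modc (ell rho x a (z - x)) <= r by exact: ell_le_nu.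
have cx := cond_recenterV A0 rho0 xyr b0 Bb r0 f0 fz M'0 cM cM'.
have e0 : 0 <= expR r - 1 by lra.
have X0 : 0 < expR r * (21 / 20) * M' * (1 + M * (expR r - 1)).
  have e1 : 0 < expR r by lra.
  have m1 : 0 < M' by lra.
  have m2 : 0 < 1 + M * (expR r - 1) by have := mulr_ge0 (ltW M0) e0; lra.
  by apply: mulr_gt0 => //; apply: mulr_gt0 => //; apply: mulr_gt0 => //; lra.
have MM : M <= expR r * (21 / 20) * M' * (1 + M * (expR r - 1)).
  exact: minM.
have NN : N <= (expR r + expR r ^+ 2 - 1) * N'.
  apply: minN; last exact: (nu_recenterV A0 rho0 xyr r0 N'1 nN').
  by apply: mulr_ge0 => //; have := sqr_ge0 (expR r); lra.
have [MN E65] := recenter_ratio_arith M1 N0 M'0 N'0 r0 Mr EE E1 MM NN.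
split; first exact: MN.
move=> u; apply: (le_trans (local_norm_recenterb A0 rho0 xyr b0 Bb u)).
by apply: ler_wpM2r; [exact: local_norm_ge0|lra].
Qed.

(** Links the fixed center [x] with the integrand at the moving zero: a factor 5/2 for mu nu and
    63/50 for the norm. *)
Lemma controlled_ratio (f : system A) (x z : 'cV[C]_n) : (forall i, f i != 0) ->
    solution_variety rho f z ->
    DS_op rho f z \in unitmx -> nondegenerate rho x -> 0 < inv_cond rho f x ->
    halfstep rho x z <= 9 / 100 * inv_cond rho f x ->
  fine (nu rho x) <= inv_cond rho f x * (5 / 2 * (fine (mu rho f z) * fine (nu rho z))) /\
  forall u, local_norm rho x u <= 63 / 50 * local_norm rho z u.
Proof.
move=> f0 fz Dz nd c0 small.
have [_ N1 nN] := nu_facts n0 A0 rho0 nd.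
have [_ M'0 cM' _] := mu_spec f0 Dz.
have ndz := nondegenerate_of_unit f0 Dz.
have [_ N'1 nN'] := nu_facts n0 A0 rho0 ndz.
have cM := cond_le_inv_cond c0.
have M1 := one_le_of_cond_le n0 f0 nd cM.
have [_ _ _ minN] := nu_spec A0 rho0 x n0.
have M'1 := one_le_of_cond_le n0 f0 ndz cM'.
have minM (L : R) : 0 < L -> cond_le rho f x L -> (inv_cond rho f x)^-1 <= L.
  move=> L0 cL; rewrite -[leRHS]invrK lef_pV2 ?posrE ?invr_gt0//.
  exact: inv_cond_ge.
have small' : 2^-1 * fine (nu rho x) * local_norm rho x (z - x) <= 9 / 100 / (inv_cond rho f
  x)^-1.
  by rewrite invrK.
have [MN H] := controlled_ratio_aux f0 fz M1 cM minM N1 nN minN M'1 cM' N'1 nN' small'.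
by split; [move: MN; rewrite mulrC ler_pdivrMr// [leRHS]mulrC|exact: H].
Qed.

(* The real inner product of [d] and [u] for the local norm. Being linear in
   [u], it can be differentiated along the path where [local_norm] cannot. *)
Definition local_form (x d u : 'cV[C]_n) : R := \sum_i complex.Re
  (\sum_(a : A i) (conjc (vv rho x a * ell rho x a d) * vv rho x a) * ell rho x a u).

Lemma local_formB x d u w : local_form x d (u - w) = local_form x d u - local_form x d w.
Proof.
rewrite /local_form -sumrB; apply: eq_bigr => i _; rewrite -raddfB; congr complex.Re.
by rewrite -sumrB; apply: eq_bigr => a _; rewrite ellB mulrBr.
Qed.

Lemma local_form_le x d u : `|local_form x d u| <= local_norm rho x d * local_norm rho x u.
Proof.
apply: (le_trans (ler_norm_sum _ _ _)); apply: le_trans (l2_CS _ _); apply: ler_sum => i _.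
apply: (le_trans (Re_le_modc _)); rewrite 2!local_norm_iE//.
under eq_bigr do rewrite -mulrA.
apply: (le_trans (l2_modc_CS _ _)).
rewrite le_eqVlt; apply/orP; left; apply/eqP; congr (_ * _); apply: eq_l2 => a.
  by rewrite modc_conj modcM.
by rewrite modcM.
Qed.

Lemma local_form_self x d : local_form x d d = local_norm rho x d ^+ 2.
Proof.
rewrite local_normE sqr_l2; apply: eq_bigr => i _; rewrite local_norm_iE// sqr_l2 raddf_sum.
apply: eq_bigr => a _; rewrite -mulrA mulrC mul_conjc_modc /= modcM//.
Qed.

Lemma local_form_derive x d (z : R -> 'cV[C]_n) t : (forall j, is_cderive (fun s => z s j 0) t
    (point_velocity z t j 0)) ->
  is_derive t (1 : R) (fun s => local_form x d (z s)) (local_form x d (point_velocity z t)).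
Proof.
move=> zD; apply: is_derive_bigsum => i.
suff [] : is_cderive (fun s => \sum_(a : A i) (conjc (vv rho x a * ell rho x a d) * vv rho x a)
  * ell rho x a (z s)) t
   (\sum_(a : A i) (conjc (vv rho x a * ell rho x a d) * vv rho x a) * ell rho x a
     (point_velocity z t)) by [].
apply: is_cderive_sum => a; rewrite /ell /covec.
by apply: is_cderive_sum => j; exact: zD.
Qed.

Lemma derive_neg_ln (g : R -> R) (t D d : R) : 0 < g t -> is_derive t (1 : R) g D ->
  is_derive t (1 : R) (fun s => - (5^-1 * ln (g s))) d -> d = - (5^-1 * ((g t)^-1 * D)).
Proof.
move=> g0 gD gd; have lD := @is_derive1_comp _ (@ln R) g t _ _ (is_derive1_ln g0) gD.
have gd' := is_deriveN (is_deriveMr 5^-1 lD).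
have e1 := @derive_val _ _ _ _ _ _ _ gd; have e2 := @derive_val _ _ _ _ _ _ _ gd'.
by rewrite -e1 -e2.
Qed.

Lemma le_expR_ln (u v l : R) : 0 < u -> 0 < v ->
  - (5^-1 * ln (v ^+ 2)) - (- (5^-1 * ln (u ^+ 2))) <= l -> u <= expR (5 / 2 * l) * v.
Proof.
move=> u0 v0; rewrite !lnXn// => H.
rewrite -[leLHS]lnK ?posrE// -[X in _ * X]lnK ?posrE// -expRD ler_expR.
move: H; rewrite (mulr2n (ln v)) (mulr2n (ln u)); lra.
Qed.

Lemma dist_sqr_le (u v L : R) : 0 <= u -> u <= L -> 0 <= v -> v <= L ->
  `|u ^+ 2 - v ^+ 2| <= 2 * L * `|u - v|.
Proof.
move=> u0 uL v0 vL; rewrite subr_sqr normrM mulrC; apply: ler_wpM2r => //.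
rewrite ger0_norm; lra.
Qed.

(** The factor 1/5 normalizes the derivative: it is at most [2 / 5 * F / c], and [c^-1 <= 5 / 2 * P]
    because [1 <= N]. *)
Lemma decay_arith (D y W F c N P S d : R) : 0 < y -> `|D| <= 2 * (y * (W * F)) ->
    d = - (5^-1 * ((y ^+ 2)^-1 * D)) -> c * W <= y -> 0 < c -> 1 <= N -> N <= c * (5 / 2 * P) ->
    0 <= F -> F <= S -> d <= P * S.
Proof.
move=> y0 DF -> cW c0 N1 NP F0 FS.
have y20 : 0 < y ^+ 2 by rewrite exprn_gt0.
have P0 : 0 <= P.
  rewrite leNgt; apply/negP => P0; have : c * (5 / 2 * P) < 0 by rewrite pmulr_rlt0//; lra.
  lra.
apply: (@le_trans _ _ (P * F)); last by rewrite ler_wpM2l.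
apply: (@le_trans _ _ (5^-1 * ((y ^+ 2)^-1 * `|D|))).
  rewrite -mulrN ler_wpM2l ?invr_ge0// -mulrN ler_wpM2l ?invr_ge0 ?(ltW y20)//.
  by rewrite -normrN ler_norm.
apply: (@le_trans _ _ (5^-1 * ((y ^+ 2)^-1 * (2 * (y * (W * F)))))).
  by rewrite ler_wpM2l ?invr_ge0// ler_wpM2l ?invr_ge0 ?(ltW y20).
have -> : 5^-1 * ((y ^+ 2)^-1 * (2 * (y * (W * F)))) = 2 / 5 * (W / y) * F.
  by field; rewrite gt_eqF.
apply: ler_wpM2r => //.
have Wy : W / y <= c^-1 by rewrite ler_pdivrMr// mulrC ler_pdivlMr// mulrC.
have cP : c^-1 <= 5 / 2 * P by rewrite -[leLHS]mulr1 ler_pdivrMl//; exact: le_trans N1 NP.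
lra.
Qed.

Lemma ln_lipschitz (k y y' : R) : 0 < k -> k <= y -> k <= y' -> `|ln y' - ln y| <= k^-1 * `|y'
  - y|.
Proof.
move=> k0; wlog yy : y y' / y <= y'.
  move=> W ky ky'; have [yy|/ltW yy] := leP y y'; first exact: W.
  by rewrite distrC (distrC y'); apply: W.
move=> ky ky'; have y0 := lt_le_trans k0 ky; have y'0 := lt_le_trans k0 ky'.
rewrite !ger0_norm ?subr_ge0// ?ler_ln ?posrE//.
rewrite -ln_div ?posrE//.
have q0 : 0 < y' / y by rewrite divr_gt0.
apply: (@le_trans _ _ (y' / y - 1)).
  have := @expR_ge1Dx R (ln (y' / y)); rewrite lnK ?posrE//; lra.
have -> : y' / y - 1 = y^-1 * (y' - y) by field; rewrite gt_eqF.
by rewrite ler_wpM2r ?subr_ge0// lef_pV2 ?posrE.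
Qed.

Variables (T : R) (f : R -> system A) (z : R -> 'cV[C]_n).
Hypothesis T0 : 0 <= T.
Hypothesis rfz : rectifiable 0 T f z.
Hypothesis f0 : forall t, 0 <= t <= T -> forall i, f t i != 0.
Hypothesis fz : forall t, 0 <= t <= T -> solution_variety rho (f t) (z t).
Hypothesis unitfz : forall t, 0 <= t <= T -> DS_op rho (f t) (z t) \in unitmx.

Lemma dn_path_ac x w : ac 0 T (fun t => dn rho (f t) x w).
Proof.
have [m m0 fm] := coords_norm_path_lower T0 rfz f0.
have L0 := local_norm_ge0 rho x w.
have K0 : 0 <= 2 / m * local_norm rho x w by apply: mulr_ge0 => //; rewrite divr_ge0// ltW.
have H s t : 0 <= s <= T -> 0 <= t <= T -> dn rho (f t) x w <= dn rho (f s) x w +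
    2 / m * local_norm rho x w * \sum_i \sum_a modc (f t i a - f s i a).
  move=> sT tT; rewrite mulrAC; apply: dn_lipschitz => //; first exact: fm.
  by move=> i; apply: coords_norm_gt0; exact: f0.
apply: (ac_path rfz K0) => s t s0 st tT.
have sT : 0 <= s <= T by rewrite s0 (le_trans st).
have tT' : 0 <= t <= T by rewrite (le_trans s0 st).
apply: (@le_trans _ _ (2 / m * local_norm rho x w * \sum_i \sum_a modc (f t i a - f s i a)));
  last first.
  by rewrite ler_wpM2l// lerDl; apply: sumr_ge0 => j _; exact: modc_ge0.
apply: norm_sub_le; first exact: H.
apply: (le_trans (H _ _ tT' sT)); rewrite lerD2l ler_wpM2l//.
by apply: ler_sum => i _; apply: ler_sum => a _; rewrite -modcN opprB.
Qed.

Let G t : \bar R := (mu rho (f t) (z t) * nu rho (z t) *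
  (Num.sqrt (FS_norm (f t) (system_velocity f t) ^+ 2 +
    local_norm rho (z t) (point_velocity z t) ^+ 2))%:E)%E.

Let G_fine t : 0 <= t <= T -> G t = (fine (mu rho (f t) (z t)) * fine (nu rho (z t)) *
  (Num.sqrt (FS_norm (f t) (system_velocity f t) ^+ 2 +
    local_norm rho (z t) (point_velocity z t) ^+ 2)))%:E.
Proof.
move=> tT; rewrite /G; have [-> _ _ _] := mu_spec (f0 tT) (unitfz tT).
by have [-> _ _ _] := nu_spec A0 rho0 (z t) n0; rewrite -!EFinM.
Qed.

Let G_ge0 t : 0 <= t <= T -> (0 <= G t)%E.
Proof. by move=> tT; exact: (condition_integrand_ge0 n0 A0 rho0 f0 unitfz tT). Qed.

Section FixedCenter.
Variables (x : 'cV[C]_n) (a b : R).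
Hypothesis nd : nondegenerate rho x.
Hypotheses (a0 : 0 <= a) (ab : a <= b) (bT : b <= T).
Hypothesis c0 : forall t, a <= t <= b -> 0 < inv_cond rho (f t) x.
Hypothesis small : forall t, a <= t <= b -> halfstep rho x (z t) <= 9 / 100 * inv_cond rho (f
  t) x.

Let tT t : a <= t <= b -> 0 <= t <= T.
Proof. by move=> /andP[at_ tb]; rewrite (le_trans a0 at_) (le_trans tb bT). Qed.

(** On [[a, b]] the positive continuous [inv_cond] has a positive minimum, which keeps [dn] away
    from 0, where the logarithm is not Lipschitz. *)
Lemma ln_dn_ac w : 0 < local_norm rho x w -> ac a b (fun t => - (5^-1 * ln (dn rho (f t) x w ^+
  2))).
Proof.
move=> w0; have acd := ac_subitv a0 bT (dn_path_ac x w).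
have [c cab cmin] := EVT_min ab (ac_continuous (ac_subitv a0 bT (inv_cond_path_ac n0 T0 rfz f0
  nd))).
have k0 : 0 < inv_cond rho (f c) x by apply: c0; move: cab; rewrite in_itv.
pose k := inv_cond rho (f c) x * local_norm rho x w; have kp : 0 < k by exact: mulr_gt0.
have kd t : a <= t <= b -> k <= dn rho (f t) x w.
  move=> tab; apply: le_trans (inv_cond_le rho (f t) x w); rewrite ler_wpM2r ?(ltW w0)//.
  by apply: cmin; rewrite in_itv.
have dl t : a <= t <= b -> dn rho (f t) x w <= local_norm rho x w.
  by move=> tab; apply: dn_le; exact: f0 (tT tab).
have K0 : 0 <= (k ^+ 2)^-1 * (2 * local_norm rho x w).
  by rewrite mulr_ge0 ?invr_ge0 ?sqr_ge0// mulr_ge0// ltW.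
apply: (ac_le K0 acd) => s t as_ st tb.
have sab : a <= s <= b by rewrite as_ (le_trans st).
have tab : a <= t <= b by rewrite (le_trans as_ st).
rewrite -opprD normrN -mulrBr normrM ger0_norm ?invr_ge0//.
have k20 : 0 < k ^+ 2 by rewrite exprn_gt0.
have ksq u : a <= u <= b -> k ^+ 2 <= dn rho (f u) x w ^+ 2.
  by move=> uab; apply: lerXn2r; rewrite ?nnegrE ?dn_ge0 ?(ltW kp)// kd.
have := ln_lipschitz k20 (ksq s sab) (ksq t tab) => H.
apply: (@le_trans _ _ (`|ln (dn rho (f t) x w ^+ 2) - ln (dn rho (f s) x w ^+ 2)|)).
  by rewrite ler_piMl// invf_le1// ler1n.
apply: (le_trans H); rewrite -[leRHS]mulrA ler_wpM2l ?invr_ge0 ?(ltW k20)//.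
exact: (dist_sqr_le (dn_ge0 _ _ _ _) (dl t tab) (dn_ge0 _ _ _ _) (dl s sab)).
Qed.

(** With the direction [w] fixed, [dn] is differentiated instead of the infimum [inv_cond]; the
    infimum is taken afterwards. *)
Lemma inv_cond_decay (l : R) : (\int[lebesgue_measure]_(t in `]a, b]) G t <= l%:E)%E ->
  forall w, dn rho (f a) x w <= expR (5 / 2 * l) * dn rho (f b) x w.
Proof.
move=> Ll w; have [w0|] := ltP 0 (local_norm rho x w); last first.
  move=> w0; have -> : w = 0 by apply: nd; apply/le_anti; rewrite w0 local_norm_ge0.
  have z0 s : dn rho (f s) x 0 = 0.
    by have := dnZ rho (f s) x 0 0; rewrite scale0r modc0 mul0r.
  by rewrite !z0 mulr0.
have dp t : a <= t <= b -> 0 < dn rho (f t) x w.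
  by move=> tab; apply: lt_le_trans (inv_cond_le rho (f t) x w); rewrite mulr_gt0 ?c0.
have aab : a <= a <= b by rewrite lexx. have bab : a <= b <= b by rewrite lexx ab.
apply: (le_expR_ln (dp a aab) (dp b bab)); rewrite -lee_fin.
apply: le_trans Ll.
apply: (ac_le_integral_fam ab (ln_dn_ac w0) (fun p => ac_subitv a0 bT (ac_real_coord rfz p))).
  by move=> t at_ tb; apply: G_ge0; apply: tT; rewrite ltW.
move=> t d /andP[at_ tb] Df gd.
have tab : a <= t <= b by rewrite !ltW.
rewrite G_fine ?tT// lee_fin.
have [D DE Dle] := dn_derive rho x w (f0 (tT tab)) Df.
have d20 : 0 < dn rho (f t) x w ^+ 2 by rewrite exprn_gt0 ?dp.
have dE := @derive_neg_ln (fun s => dn rho (f s) x w ^+ 2) t D d d20 DE gd.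
have [Nle _] := controlled_ratio (f0 (tT tab)) (fz (tT tab)) (unitfz (tT tab)) nd (c0 tab)
  (small tab).
have [_ N1 _] := nu_facts n0 A0 rho0 nd.
apply: (decay_arith (dp t tab) Dle dE (inv_cond_le rho (f t) x w) (c0 tab) N1 Nle).
- exact: sqrtr_ge0.
- by rewrite -[leLHS]ger0_norm ?sqrtr_ge0// -sqrtr_sqr ler_wsqrtr// lerDl sqr_ge0.
Qed.

Lemma inv_cond_decay_le (l : R) : (\int[lebesgue_measure]_(t in `]a, b]) G t <= l%:E)%E ->
  inv_cond rho (f a) x <= expR (5 / 2 * l) * inv_cond rho (f b) x.
Proof.
move=> Ll; rewrite -ler_pdivrMl ?expR_gt0//; apply: le_inv_cond => // w.
rewrite -[leLHS]mulrA ler_pdivrMl ?expR_gt0//.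
exact: le_trans (inv_cond_le _ _ _ _) (inv_cond_decay Ll w).
Qed.

Let ab_refl_r : a <= b <= b. Proof. by rewrite ab lexx. Qed.

(** Paired with the total displacement [d], the form [local_form x d] changes by the squared norm of
    [d] over the piece, while Cauchy-Schwarz bounds its derivative by the norm of [d] times the
    speed. *)
Lemma halfstep_move (l k : R) : 0 < k ->
    (forall t, a <= t <= b -> inv_cond rho (f t) x <= k * inv_cond rho (f b) x) ->
    (\int[lebesgue_measure]_(t in `]a, b]) G t <= l%:E)%E ->
  fine (nu rho x) * local_norm rho x (z b - z a) <= 63 / 20 * k * inv_cond rho (f b) x * l.
Proof.
move=> k0 kc Ll; set d := z b - z a.
have cb := c0 ab_refl_r.
have l0 : 0 <= l.
  rewrite -lee_fin; apply: le_trans Ll; apply: integral_ge0 => t /=.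
  by rewrite in_itv/= => /andP[at_ tb]; apply: G_ge0; apply: tT; rewrite ltW.
have [_ N1 _] := nu_facts n0 A0 rho0 nd.
have N0 : 0 <= fine (nu rho x) by exact: le_trans ler01 N1.
have [dn0|d0] := leP (local_norm rho x d) 0.
  apply: (@le_trans _ _ 0); first by apply: mulr_ge0_le0.
  by apply: mulr_ge0 => //; apply: mulr_ge0; [apply: mulr_ge0; [lra|exact: ltW]|exact: ltW].
pose q := 63 / 20 * k * inv_cond rho (f b) x.
have q0 : 0 < q by apply: mulr_gt0 => //; apply: mulr_gt0 => //; lra.
(* [K] scales the form so that its derivative is at most the integrand. *)
pose K := fine (nu rho x) / (local_norm rho x d * q).
have K0 : 0 <= K by rewrite divr_ge0// mulr_ge0// ltW.
have acg : ac a b (fun t => K * local_form x d (z t)).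
  have [B B0 HB] := local_norm_lipschitz rho x.
  apply: (ac_subitv a0 bT); apply: (ac_path (K := K * (local_norm rho x d * B)) rfz).
    by apply: mulr_ge0 => //; apply: mulr_ge0 => //; exact: ltW.
  move=> s t s0 st tT'; rewrite -mulrBr -local_formB normrM (ger0_norm K0) -[leRHS]mulrA.
  apply: ler_wpM2l => //; apply: (le_trans (local_form_le _ _ _)); rewrite -[leRHS]mulrA.
  apply: ler_wpM2l; first exact: ltW.
  apply: (le_trans (HB _)); apply: ler_wpM2l => //.
  have -> : \sum_j modc ((z t - z s) j 0) = \sum_j modc (z t j 0 - z s j 0).
    by apply: eq_bigr => j _; rewrite !mxE.
  by rewrite lerDr; apply: sumr_ge0 => i _; apply: sumr_ge0 => ? _; exact: modc_ge0.
have FTC := ac_le_integral_fam (G := G) ab acg (fun p => ac_subitv a0 bT (ac_real_coord rfz p)).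
have {}FTC : (K * local_form x d (z b) - K * local_form x d (z a)) <= l.
  rewrite -lee_fin; apply: le_trans Ll; apply: FTC.
    by move=> t at_ tb; apply: G_ge0; apply: tT; rewrite ltW.
  move=> t e /andP[at_ tb] Df gd.
  have tab : a <= t <= b by rewrite !ltW.
  rewrite G_fine ?tT// lee_fin.
  have zD j : is_cderive (fun s => z s j 0) t (point_velocity z t j 0).
    by rewrite mxE; exact: (is_cderive_coord (inr j) Df).
  have gd' := is_deriveMr K (local_form_derive x d zD).
  have eE : e = K * local_form x d (point_velocity z t).
    by rewrite -(@derive_val _ _ _ _ _ _ _ gd) -(@derive_val _ _ _ _ _ _ _ gd').
  have [Nle zle] := controlled_ratio (f0 (tT tab)) (fz (tT tab)) (unitfz (tT tab)) nd (c0 tab)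
    (small tab).
  have [_ M'0 _ _] := mu_spec (f0 (tT tab)) (unitfz (tT tab)).
  have [_ N'0 _ _] := nu_spec A0 rho0 (z t) n0.
  have form := le_trans (ler_norm _) (local_form_le x d (point_velocity z t)).
  apply: (move_arith d0 q0 N0 K0 erefl eE form (zle _) Nle (kc t tab) erefl (mulr_ge0 M'0 N'0)).
  - exact: local_norm_ge0.
  - by rewrite -[leLHS]ger0_norm ?local_norm_ge0// -sqrtr_sqr ler_wsqrtr// lerDr sqr_ge0.
move: FTC; rewrite -mulrBr -local_formB -/d local_form_self /K -/q.
have -> : fine (nu rho x) / (local_norm rho x d * q) * local_norm rho x d ^+ 2 =
    fine (nu rho x) * local_norm rho x d / q by field; rewrite !gt_eqF.
by rewrite ler_pdivrMr// [leRHS]mulrC.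
Qed.

End FixedCenter.
Variable alpha1 : R.
Hypotheses (alpha1_ge : 811 / 100 / 100 <= alpha1) (alpha1_le : alpha1 <= 813 / 100 / 100).

Lemma ac_le0_closed (a b : R) (g : R -> R) : a < b -> ac a b g ->
  (forall t, a <= t < b -> g t <= 0) -> g b <= 0.
Proof.
move=> ab ag H; rewrite leNgt; apply/negP => gb.
have [d d0 Hd] := ac_unif_continuous ag gb.
pose s := Num.max a (b - d / 2).
have sb : s < b by rewrite gt_max ab ltrBlDr ltrDl divr_gt0.
have as_ : a <= s by rewrite le_max lexx.
have := Hd b s (_ : a <= b <= b) (_ : a <= s <= b) _.
rewrite (ltW ab) lexx as_ (ltW sb) => /(_ isT isT).
have bsd : `|b - s| < d.
  rewrite ger0_norm ?subr_ge0 ?(ltW sb)//.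
  have : b - d / 2 <= s by rewrite le_max lexx orbT.
  lra.
move=> /(_ bsd); have := H s; rewrite as_ sb => /(_ isT).
by rewrite ltr_norml => gs /andP[_]; lra.
Qed.

Section Step.
Variables (x : 'cV[C]_n) (a b : R).
Hypothesis nd : nondegenerate rho x.
Hypotheses (a0 : 0 <= a) (ab : a <= b) (bT : b <= T).
Hypothesis ca : 0 < inv_cond rho (f a) x.
Hypothesis ha : halfstep rho x (z a) <= 1 / 25 * inv_cond rho (f a) x.
Hypothesis nt : forall t, a < t < b -> ~ step_test rho alpha1 (f t) x.

Let gap_ac (k : R) : 0 <= k -> ac a b (fun t => halfstep rho x (z t) - k * inv_cond rho (f t) x).
Proof.
move=> k0; apply: (ac_subitv a0 bT); apply: acD.
  exact: (halfstep_path_ac n0 A0 rho0 rfz nd).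
apply: acN; apply: (ac_le k0 (inv_cond_path_ac n0 T0 rfz f0 nd)) => s t _ _ _.
by rewrite -mulrBr normrM (ger0_norm k0).
Qed.

Let tT t : a <= t <= b -> 0 <= t <= T.
Proof. by move=> /andP[at_ tb]; rewrite (le_trans a0 at_) (le_trans tb bT). Qed.

Let before_b t : a <= t < b ->
  0 < inv_cond rho (f t) x /\ halfstep rho x (z t) <= 9 / 100 * inv_cond rho (f t) x.
Proof.
(* The step test is only assumed to fail after [a]; at [a] itself the initial bound [ha] decides. *)
move=> /andP[]; rewrite le_eqVlt => /orP[/eqP <- _|at_ tb].
  by split => //; apply: (le_trans ha); rewrite ler_wpM2r ?(ltW ca)//; lra.
have pos s : a < s < b -> 0 < inv_cond rho (f s) x.
  move=> sab; have sT : 0 <= s <= T by apply: tT; move: sab => /andP[/ltW -> /ltW ->].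
  have D := unit_of_not_step_test n0 A0 rho0 nd (nt sab).
  by have [] := mu_inv_cond n0 (f0 sT) D.
have gap s : a < s < b -> halfstep rho x (z s) <= 181 / 20 / 100 * inv_cond rho (f s) x ->
    halfstep rho x (z s) <= 9 / 100 * inv_cond rho (f s) x.
  move=> sab; have sT : 0 <= s <= T by apply: tT; move: sab => /andP[/ltW -> /ltW ->].
  exact: (step_test_gap n0 A0 rho0 alpha1_le (f0 sT) nd (nt sab) (fz sT)).
have tab : a < t < b by rewrite at_.
split; first exact: pos.
have [|big] := leP (halfstep rho x (z t)) (181 / 20 / 100 * inv_cond rho (f t) x); first exact:
  gap.
(* The level 361/4000 lies strictly inside the gap between 9/100 and 181/2000, and a continuous path
   that passes the gap must meet it. *)
exfalso; pose k : R := 361 / 40 / 100.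
have k0 : 0 <= k by rewrite /k; lra.
have cont := ac_continuous (ac_subitv (lexx a) (ltW tb) (gap_ac k0)).
have ga : halfstep rho x (z a) - k * inv_cond rho (f a) x <= 0.
  by rewrite subr_le0; apply: (le_trans ha); rewrite ler_wpM2r ?(ltW ca)// /k; lra.
have gt : 0 <= halfstep rho x (z t) - k * inv_cond rho (f t) x.
  rewrite subr_ge0; apply: le_trans (ltW big); rewrite ler_wpM2r ?(ltW (pos t tab))// /k; lra.
have [|s sat gs0] := IVT (v := 0) (ltW at_) cont.
  by rewrite ge_min ga le_max gt orbT.
move: sat; rewrite in_itv/= => /andP[as_ st].
have sE : halfstep rho x (z s) = k * inv_cond rho (f s) x by apply/eqP; rewrite -subr_eq0;
  apply/eqP.
move: as_; rewrite le_eqVlt => /orP[/eqP sa|as_].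
  move: ha; rewrite sa sE leNgt => /negP; apply; rewrite ltr_pM2r ?/k; first lra.
  by rewrite -sa.
have sab : a < s < b by rewrite as_ (le_lt_trans st).
have := gap s sab; rewrite sE => /(_ _); rewrite ler_pM2r ?pos//.
rewrite (ler_pM2r (pos s sab)) /k => H; have : 361 / 40 / 100 <= 9 / 100 :> R by apply: H; lra.
lra.
Qed.

Lemma step_controlled t : a <= t <= b ->
  0 < inv_cond rho (f t) x /\ halfstep rho x (z t) <= 9 / 100 * inv_cond rho (f t) x.
Proof.
move=> /andP[at_]; rewrite le_eqVlt => /orP[/eqP tb|tb]; last by apply: before_b; rewrite at_.
subst t; move: at_; rewrite le_eqVlt => /orP[/eqP <-|ab'].
  by split => //; apply: (le_trans ha); rewrite ler_wpM2r ?(ltW ca)//; lra.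
have bT' : 0 <= b <= T by apply: tT; rewrite lexx ab.
have hb : halfstep rho x (z b) <= 9 / 100 * inv_cond rho (f b) x.
  rewrite -subr_le0; have k0 : (0 : R) <= 9 / 100 by lra.
  apply: (ac_le0_closed ab' (gap_ac k0)) => t tab; rewrite subr_le0.
  by have [] := before_b tab.
split => //; have [_ N1 _] := nu_facts n0 A0 rho0 nd.
(* At [b] the test may be met, so [DS_op] might be singular at [x]. If [inv_cond] were 0, the bound
   [hb] would force [z b = x], where [DS_op] is invertible. *)
rewrite lt_neqAle inv_cond_ge0// andbT; apply/negP => /eqP c0'.
move: hb; rewrite -c0' mulr0 /halfstep => hb.
have d0 : local_norm rho x (z b - x) = 0.
  apply/le_anti; rewrite local_norm_ge0 andbT leNgt; apply/negP => dp.
  by move: hb; apply/negP; rewrite -ltNge; apply: mulr_gt0 => //; lra.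
have zx : z b = x by apply/eqP; rewrite -subr_eq0; apply/eqP/nd.
have D := unitfz bT'; rewrite zx in D.
by have [] := mu_inv_cond n0 (f0 bT') D; rewrite -c0' ltxx.
Qed.

Lemma short_step : (\int[lebesgue_measure]_(t in `]a, b]) G t <= (1 / 59)%:E)%E ->
  halfstep rho x (z b) <= 29 / 400 * inv_cond rho (f b) x.
Proof.
move=> Ll; have cpos t : a <= t <= b -> 0 < inv_cond rho (f t) x by move/step_controlled => [].
have csmall t : a <= t <= b -> halfstep rho x (z t) <= 9 / 100 * inv_cond rho (f t) x.
  by move/step_controlled => [].
pose k := expR (5 / 2 * (1 / 59)) : R.
have kc t : a <= t <= b -> inv_cond rho (f t) x <= k * inv_cond rho (f b) x.
  move=> /andP[at_ tb]; apply: (inv_cond_decay_le nd (le_trans a0 at_) tb bT).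
  - by move=> s /andP[ts sb]; apply: cpos; rewrite (le_trans at_ ts).
  - by move=> s /andP[ts sb]; apply: csmall; rewrite (le_trans at_ ts).
  - apply: le_trans Ll; apply: ge0_integral_mono => //.
    + by move=> s /=; rewrite !in_itv/= => /andP[ts ->]; rewrite (le_lt_trans at_ ts).
    + move=> s /=; rewrite in_itv/= => /andP[ts sb]; apply: G_ge0; apply: tT.
      by rewrite (le_trans at_ (ltW ts)).
    + by move=> s /=; rewrite in_itv/= => /andP[ts sb]; apply: G_ge0; apply: tT; rewrite (ltW ts).
have mv := halfstep_move nd a0 ab bT cpos csmall (expR_gt0 _) kc Ll.
have bab : a <= b <= b by rewrite ab lexx.
have aab : a <= a <= b by rewrite ab lexx.
have k1 : k <= 21 / 20 by apply: (expR_num (k := 1 / 23)); lra.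
have tri : local_norm rho x (z b - x) <= local_norm rho x (z a - x) + local_norm rho x (z b - z
  a).
  rewrite (_ : z b - x = (z a - x) + (z b - z a)); first exact: local_normD.
  by rewrite [RHS]addrC addrA subrK.
have [_ N1 _] := nu_facts n0 A0 rho0 nd.
exact: (short_step_arith (le_trans ler01 N1) tri ha (kc a aab) k1 (cpos b bab) mv).
Qed.

End Step.
End Segment.

(** The two squares are those of the real and imaginary parts of [l / 2 + l ^+ 2 / 6 - k] for [l]
    with parts [a] and [b]. The cross term [- a * (k - s / 6)] is largest at [a = - p]. *)
Lemma kernel_polynomial_bound (R : realType) (M a b : R) (k := 1 / 91 : R) :
    1 <= M -> M <= 6 / 5 -> M ^+ 2 * (a ^+ 2 + b ^+ 2) <= (18 / 100) ^+ 2 ->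
  M ^+ 2 * ((a / 2 + (a ^+ 2 - b ^+ 2) / 6 - k) ^+ 2 + (b / 2 + a * b / 3) ^+ 2) <= (13 / 125)
    ^+ 2.
Proof.
move=> M1 M65 Ms; set s := a ^+ 2 + b ^+ 2 in Ms.
have s0 : 0 <= s by rewrite addr_ge0 ?sqr_ge0.
have M0 : 0 <= M by lra.
have M2 : M ^+ 2 <= 36 / 25.
  by rewrite expr2; apply: (@le_trans _ _ (6 / 5 * (6 / 5))); [apply: ler_pM|lra].
have M20 : 0 <= M ^+ 2 by exact: sqr_ge0.
have M21 : 1 <= M ^+ 2 by exact: exprn_ege1.
have sM : s <= M ^+ 2 * s by rewrite -[leLHS]mul1r ler_wpM2r.
have s1 : s <= 33 / 10 / 100 by lra.
have k0 : 0 < k by rewrite /k; lra.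
have QE : (a / 2 + (a ^+ 2 - b ^+ 2) / 6 - k) ^+ 2 + (b / 2 + a * b / 3) ^+ 2 =
    s / 4 + s ^+ 2 / 36 + k ^+ 2 + k * s / 3 - a * (k - s / 6) - 2 * k / 3 * a ^+ 2.
  by rewrite /s; field.
pose p := Num.sqrt s.
have p0 : 0 <= p by exact: sqrtr_ge0.
have p2 : p ^+ 2 = s by rewrite sqr_sqrtr.
have ap : `|a| <= p by rewrite -sqrtr_sqr ler_wsqrtr// lerDl sqr_ge0.
have cross : - a * (k - s / 6) <= p * k.
  have ks : 0 <= k - s / 6 by rewrite /k; lra.
  apply: (@le_trans _ _ (p * (k - s / 6))); last by rewrite ler_wpM2l//; lra.
  by rewrite ler_wpM2r// (le_trans _ ap)// -normrN ler_norm.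
have a2 : 0 <= 2 * k / 3 * a ^+ 2 by apply: mulr_ge0; [lra|exact: sqr_ge0].
have Mp : M * p <= 18 / 100.
  by apply: le_of_sqr; [lra|rewrite exprMn p2].
have Q : (a / 2 + (a ^+ 2 - b ^+ 2) / 6 - k) ^+ 2 + (b / 2 + a * b / 3) ^+ 2 <=
    s / 4 + s ^+ 2 / 36 + k ^+ 2 + k * s / 3 + p * k.
  by rewrite QE; move: cross; rewrite mulNr; lra.
apply: (le_trans (ler_wpM2l M20 Q)).
have -> : M ^+ 2 * (s / 4 + s ^+ 2 / 36 + k ^+ 2 + k * s / 3 + p * k) =
   (M ^+ 2 * s) * (1 / 4 + s / 36 + k / 3) + M ^+ 2 * k ^+ 2 + M * (M * p) * k by field.
have t1 : (M ^+ 2 * s) * (1 / 4 + s / 36 + k / 3) <= (18 / 100) ^+ 2 * (1 / 4 + 33 / 36 / 10 /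
  100 + k / 3).
  by apply: ler_pM => //; [exact: mulr_ge0|rewrite /k; lra|lra].
have t2 : M ^+ 2 * k ^+ 2 <= 36 / 25 * k ^+ 2 by rewrite ler_wpM2r ?sqr_ge0.
have t3 : M * (M * p) * k <= 6 / 5 * (18 / 100) * k.
  rewrite ler_wpM2r ?(ltW k0)//; apply: ler_pM => //; exact: mulr_ge0.
move: t1 t2 t3; rewrite /k; lra.
Qed.

(** Division by [l] leaves [q] and a remainder of third order; [M * modc q <= 13 / 125] leaves room
    for it below 21/200. *)
Lemma kernel_bound (R : realType) (M : R) (l : R[i]) : 1 <= M -> M <= 6 / 5 ->
    M * modc l <= 18 / 100 ->
  M * modc (cexp l - 1 - l - real_complex R (1 / 91) * l) <= 21 / 200 * modc l.
Proof.
move=> M1 M65 Ml; have M0 : 0 <= M by lra.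
have l0 := modc_ge0 l.
have l1 : modc l <= 18 / 100 by apply: le_trans Ml; rewrite -[leLHS]mul1r ler_wpM2r.
pose q := l / 2 + l ^+ 2 / 6 - real_complex R (1 / 91).
have split : cexp l - 1 - l - real_complex R (1 / 91) * l =
    l * q + (cexp l - 1 - l - l ^+ 2 / 2 - l ^+ 3 / 6) by rewrite /q; field.
have rem : modc (cexp l - 1 - l - l ^+ 2 / 2 - l ^+ 3 / 6) <= 9 / 200 * modc l ^+ 4.
  have l29 : modc l <= 29 / 100 by lra.
  have T4 := expR_le_taylor4 l0 l29.
  by apply: (le_trans (cexp_bound4 l)); move: T4; lra.
have qM : M * modc q <= 13 / 125.
  apply: le_of_sqr; first by lra.
  rewrite exprMn sqr_modc.
  have sl : M ^+ 2 * (complex.Re l ^+ 2 + complex.Im l ^+ 2) <= (18 / 100) ^+ 2.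
    rewrite -sqr_modc -exprMn; apply: lerXn2r => //; rewrite nnegrE; first exact: mulr_ge0.
    by lra.
  have := kernel_polynomial_bound M1 M65 sl.
  congr (_ * (_ ^+ 2 + _ ^+ 2) <= _).
    by rewrite /q; case: (l) => u v /=; field.
  by rewrite /q; case: (l) => u v /=; field.
rewrite split; apply: (@le_trans _ _ (M * (modc l * modc q + 9 / 200 * modc l ^+ 4))).
  by apply: ler_wpM2l => //; apply: (le_trans (modcD _ _)); rewrite modcM lerD2l.
have -> : M * (modc l * modc q + 9 / 200 * modc l ^+ 4) =
    modc l * (M * modc q + 9 / 200 * (M * modc l) * modc l ^+ 2) by ring.
rewrite [leRHS]mulrC; apply: ler_wpM2l => //.
have l2 : modc l ^+ 2 <= 18 / 100 * (18 / 100) by rewrite expr2; apply: ler_pM.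
have : 9 / 200 * (M * modc l) * modc l ^+ 2 <= 9 / 200 * (18 / 100) * (18 / 100 * (18 / 100)).
  apply: ler_pM => //; [apply: mulr_ge0; [lra|exact: mulr_ge0]|exact: sqr_ge0|].
  by rewrite ler_wpM2l//; lra.
lra.
Qed.

(** 111/10000 is just below [92 / 91 ^+ 2], the squared radius in [apollonius] for [d] of norm 1. *)
Lemma ball_arith (R : realType) (d : R) : (21 / 200 * d) ^+ 2 <= 111 / 100 / 100 * d ^+ 2.
Proof. by rewrite exprMn; have := sqr_ge0 d; move: (d ^+ 2) => u u0; lra. Qed.

(** The choice of 92: [64 * (1198 / 1000) ^+ 2 < 92]. *)
Lemma final_ratio_arith (R : realType) (E e s : R) : 0 <= E -> E <= 1198 / 10 / 100 -> 0 <= e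
  -> 0 <= s ->
  e ^+ 2 <= 1 / 92 * s ^+ 2 -> E * e <= 1 / 8 * s.
Proof.
move=> E0 E1 e0 s0 es; apply: le_of_sqr; first by apply: mulr_ge0 => //; lra.
have E2 : E ^+ 2 <= 1436 / 10 / 100.
  rewrite expr2; apply: (@le_trans _ _ (1198 / 10 / 100 * (1198 / 10 / 100))); last by lra.
  exact: ler_pM.
have : E ^+ 2 * e ^+ 2 <= 1436 / 10 / 100 * (1 / 92 * s ^+ 2).
  by apply: ler_pM => //; exact: sqr_ge0.
rewrite !exprMn; have := sqr_ge0 s.
move: (s ^+ 2) (E ^+ 2 * e ^+ 2) => u v u0 vu; lra.
Qed.

(** * Convergence at the end of the path *)

Section FinalConvergence.
Variables (R : realType) (n : nat) (A : 'I_n -> {fset 'rV[R]_n}).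
Variable rho : forall i, A i -> R.
Arguments rho : clear implicits.
Hypothesis n0 : (0 < n)%N.
Hypothesis A0 : forall i, A i != fset0.
Hypothesis rho0 : forall i a, 0 < rho i a.
Variable f : system A.
Hypothesis f0 : forall i, f i != 0.
Local Notation C := R[i].
Implicit Types (x y z u w : 'cV[C]_n) (i : 'I_n).
Local Open Scope complex_scope.

Let sqr_local_norm x u : local_norm rho x u ^+ 2 =
  \sum_i \sum_(a : A i) weight rho x a * modc (ell rho x a u) ^+ 2.
Proof.
rewrite local_normE sqr_l2; apply: eq_bigr => i _; rewrite sqr_sqrtr//.
by apply: sumr_ge0 => a _; rewrite mulr_ge0 ?sqr_ge0// ltW// weight_gt0.
Qed.

(* the points whose distances to [d] and to the origin have ratio at most
   [1 / sqrt 92] form a ball centered at [92/91 d] *)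
Lemma apollonius x (s d : 'cV[C]_n) :
    local_norm rho x (s - d - (1 / 91)%:C *: d) ^+ 2 <= 111 / 100 / 100 * local_norm rho x d ^+
      2 ->
  local_norm rho x (s - d) ^+ 2 <= 1 / 92 * local_norm rho x s ^+ 2.
Proof.
have E : 91 / 92 * local_norm rho x (s - d - (1 / 91)%:C *: d) ^+ 2 =
    local_norm rho x (s - d) ^+ 2 - 1 / 92 * local_norm rho x s ^+ 2 +
    1 / 91 * local_norm rho x d ^+ 2.
  rewrite !sqr_local_norm !mulr_sumr -sumrB -big_split; apply: eq_bigr => i _ /=.
  rewrite !mulr_sumr -sumrB -big_split; apply: eq_bigr => a _ /=.
  rewrite (ellB rho x a (s - d)) (ellB rho x a s d) ellZ; move: (weight rho x a) (ell rho x a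
    s) (ell rho x a d) => p.
  case=> s1 s2 [d1 d2]; rewrite !sqr_modc /=; field => //.
move=> H; have d0 : 0 <= local_norm rho x d ^+ 2 by exact: sqr_ge0.
move: E H d0; move: (local_norm rho x (s - d) ^+ 2) (local_norm rho x s ^+ 2).
move: (local_norm rho x d ^+ 2) (local_norm rho x _ ^+ 2) => u v w y; lra.
Qed.

Lemma DS_newton_sub x z i (k : C) : DS_op rho f x \in unitmx -> solution_variety rho f z ->
  (DS_op rho f x *m (newton rho f x - z - k *: (z - x))) i 0 =
  rowsum rho f x (fun i a => cexp (ell rho x a (z - x)) - 1 - ell rho x a (z - x) -
    k * ell rho x a (z - x)) i.
Proof.
move=> D fz.
have -> : newton rho f x - z - k *: (z - x) =
    - (invmx (DS_op rho f x) *m S_op rho f x 0) - (z - x) - k *: (z - x).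
  by congr (_ - _); rewrite /newton opprB addrA [- _ + x]addrC.
rewrite 2!mulmxBr mulmxN mulKVmx// -scalemxAr.
rewrite 3!rowsumB (solution_S_op x fz) sub0r (rowsumZ rho f x (fun=> k) (fun i a => ell rho x a
  (z - x))) -S_op0 -DS_opE.
by rewrite !mxE.
Qed.

Lemma first_newton_error x z M N : solution_variety rho f z -> controlled rho f x z M N (9 /
  100) ->
  local_norm rho z (newton rho f x - z) <= 1 / 8 * local_norm rho x (newton rho f x - x).
Proof.
move=> fz ctl; have [_ nc] := newton_step n0 A0 rho0 f0 fz ctl (lexx _).
move: ctl => [[D M1 N1] cM nN Hv].
have d0 := local_norm_ge0 rho x (z - x).
set d := local_norm rho x (z - x) in Hv nc d0.
have N0 : 0 <= N by lra.
have M0 : 0 <= M by lra.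
have r0 : 0 <= N * d by exact: mulr_ge0.
have Mr : M * (N * d) <= 18 / 100 by move: Hv; rewrite -!mulrA; lra.
have rM : N * d <= M * (N * d) by rewrite -[leLHS]mul1r ler_wpM2r.
have xyr i (a : A i) : modc (ell rho x a (z - x)) <= N * d by exact: ell_le_nu.
have Ez := local_norm_recenter A0 rho0 xyr (newton rho f x - z).
apply: (le_trans Ez); set s := local_norm rho x (newton rho f x - x).
set e := local_norm rho x (newton rho f x - z) in nc Ez *.
have e0 : 0 <= e by exact: local_norm_ge0.
have ds : d <= s + e.
  have -> : d = local_norm rho x ((newton rho f x - x) + (z - newton rho f x)).
    by congr (local_norm _ _ _); rewrite [RHS]addrC addrA subrK.
  by rewrite /e (local_norm_distC rho x (newton rho f x) z); exact: local_normD.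
(* If [M] exceeds 6/5, [expR (N * d)] is small enough for the plain contraction and the triangle
   inequality. Otherwise these just miss 1/8 and the ball estimate takes over. *)
have [M65|M65] := leP M (6 / 5); last first.
  have r1 : N * d <= 15 / 100.
    have : 6 / 5 * (N * d) <= M * (N * d) by rewrite ler_wpM2r// ltW.
    lra.
  have E1 : expR (N * d) <= 1163 / 10 / 100 by apply: (expR_num r0 r1); lra.
  apply: (@le_trans _ _ (1163 / 10 / 100 * e)); first by rewrite ler_wpM2r.
  lra.
have r1 : N * d <= 18 / 100 by lra.
have E1 : expR (N * d) <= 1198 / 10 / 100 by apply: (expR_num r0 r1); lra.
have s0 : 0 <= s by exact: local_norm_ge0.
have es : e ^+ 2 <= 1 / 92 * s ^+ 2.
  have -> : e = local_norm rho x ((newton rho f x - x) - (z - x)).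
    by congr (local_norm _ _ _); rewrite opprB addrA subrK.
  apply: apollonius.
  have -> : newton rho f x - x - (z - x) - (1 / 91)%:C *: (z - x) =
      newton rho f x - z - (1 / 91)%:C *: (z - x).
    by congr (_ - _); rewrite opprB addrA subrK.
  have B0 : 0 <= 21 / 200 / M by apply: divr_ge0 => //; lra.
  have le1 : local_norm rho x (newton rho f x - z - (1 / 91)%:C *: (z - x)) <= 21 / 200 * d.
    apply: (le_trans (cM _)).
    have -> : dn rho f x (newton rho f x - z - (1 / 91)%:C *: (z - x)) =
        l2 (fun i => modc (rowsum rho f x (fun i a => cexp (ell rho x a (z - x)) - 1 -
          ell rho x a (z - x) - (1 / 91)%:C * ell rho x a (z - x)) i) / coords_norm (f i)).
      by apply: eq_l2 => i; rewrite DS_newton_sub.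
    have -> : 21 / 200 * d = M * (21 / 200 / M * d) by field; rewrite gt_eqF//; lra.
    apply: ler_wpM2l => //; apply: l2_rowsum_le_norm => // i a.
    rewrite mulrAC ler_pdivlMr; last by lra.
    rewrite mulrC; apply: kernel_bound => //.
    by apply: le_trans Mr; rewrite ler_wpM2l.
  apply: (@le_trans _ _ ((21 / 200 * d) ^+ 2)).
    by apply: lerXn2r; rewrite ?nnegrE ?local_norm_ge0 ?mulr_ge0//; lra.
  exact: ball_arith.
exact: final_ratio_arith (expR_ge0 _) E1 e0 s0 es.
Qed.

End FinalConvergence.

Lemma next_error_arith (R : realType) (E v ex ez e e' : R) : 0 <= E -> E <= 11 / 10 -> 0 <= v ->
    0 <= ex -> 0 <= ez -> e <= 134 / 125 * v * ex -> e' <= E * e -> ex <= E * (21 / 20) * ez ->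
  e' <= 3 / 2 * v * ez.
Proof.
move=> E0 E1 v0 ex0 ez0 He He' Hex.
have Hex' : ex <= 1155 / 10 / 100 * ez.
  by apply: (le_trans Hex); rewrite ler_wpM2r//; lra.
have vex : v * ex <= v * (1155 / 10 / 100 * ez) by rewrite ler_wpM2l.
have vz : 0 <= v * ez by exact: mulr_ge0.
have He2 : E * e <= E * (134 / 125 * (v * ex)) by rewrite ler_wpM2l// mulrA.
have : E * (134 / 125 * (v * ex)) <= 11 / 10 * (134 / 125 * (v * (1155 / 10 / 100 * ez))).
  apply: ler_pM => //; first by apply: mulr_ge0; [lra|exact: mulr_ge0].
  lra.
rewrite (mulrCA v) -[leRHS]mulrA; lra.
Qed.

(** The factor 2/9 turns [9 / 2 * v ^+ 2] into a pure squaring, and 1/5 is the starting value since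
    [(9 / 2 * (9 / 100)) ^+ 2 < 1 / 5]. *)
Lemma fifth_pow (R : realType) (k : nat) (v := 2 / 9 * (1 / 5) ^+ (2 ^ k)%N : R) :
  [/\ v <= 2 / 45, v <= 9 / 100, 0 <= 3 / 2 * v & 3 / 2 * v <= 2 ^- (2 ^ k)%N].
Proof.
have q0 : 0 <= 1 / 5 :> R by lra.
have q1 : 1 / 5 <= 1 :> R by lra.
have h0 : 0 <= 2^-1 :> R by lra.
have qh : 1 / 5 <= 2^-1 :> R by lra.
have p0 : 0 <= (1 / 5 : R) ^+ (2 ^ k)%N by exact: exprn_ge0.
have p5 : (1 / 5 : R) ^+ (2 ^ k)%N <= 1 / 5.
  by rewrite -[leRHS]expr1; apply: ler_wiXn2l => //; rewrite expn_gt0.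
have p2 : (1 / 5 : R) ^+ (2 ^ k)%N <= 2 ^- (2 ^ k)%N by rewrite -exprVn; apply: lerXn2r.
rewrite /v; move: (_ ^+ _) (_ ^- _) p0 p5 p2 => p h p0 p5 p2; split; lra.
Qed.

Section NewtonIterates.
Variables (R : realType) (n : nat) (A : 'I_n -> {fset 'rV[R]_n}).
Variable rho : forall i, A i -> R.
Arguments rho : clear implicits.
Hypothesis n0 : (0 < n)%N.
Hypothesis A0 : forall i, A i != fset0.
Hypothesis rho0 : forall i a, 0 < rho i a.
Variable f : system A.
Hypothesis f0 : forall i, f i != 0.
Local Notation C := R[i].
Implicit Types (x y z u w : 'cV[C]_n).

(** [controlled] with the exact mu and nu, so that the thresholds refer to [x] and the current
    system alone. *)
Definition approximates x z v :=
  DS_op rho f x \in unitmx /\ halfstep rho x z <= v * inv_cond rho f x.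

Lemma approximates_controlled x z v : approximates x z v ->
  controlled rho f x z (inv_cond rho f x)^-1 (fine (nu rho x)) v.
Proof.
move=> [D hv]; have [c0 _] := mu_inv_cond n0 f0 D.
have nd := nondegenerate_of_unit f0 D; have [_ N1 nN] := nu_facts n0 A0 rho0 nd.
have cM := cond_le_inv_cond c0.
split=> //; first by split=> //; exact: one_le_of_cond_le cM.
rewrite -(ler_pM2r c0); apply: le_trans hv; rewrite /halfstep.
by rewrite le_eqVlt; apply/orP; left; apply/eqP; field; rewrite gt_eqF.
Qed.

Lemma controlled_approximates x z M N v : controlled rho f x z M N v -> approximates x z v.
Proof.
move=> [[D M1 N1] cM nN Hv]; split=> //; have [c0 _] := mu_inv_cond n0 f0 D.
have nd := nondegenerate_of_unit f0 D.
have [_ _ _ minN] := nu_spec A0 rho0 x n0.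
have M0 : 0 < M by lra.
have N0 : 0 <= N by lra.
have Mc := inv_cond_ge n0 nd M0 cM.
have d0 := local_norm_ge0 rho x (z - x).
have v0 : 0 <= v by apply: le_trans Hv; rewrite !mulr_ge0// ?invr_ge0// ltW.
apply: (@le_trans _ _ (2^-1 * N * local_norm rho x (z - x))).
  by rewrite /halfstep ler_wpM2r// ler_wpM2l ?invr_ge0// minN.
apply: (@le_trans _ _ (v * M^-1)); last by rewrite ler_wpM2l.
by rewrite ler_pdivlMr//; apply: le_trans Hv; rewrite le_eqVlt; apply/orP; left; apply/eqP; ring.
Qed.

Lemma approximates_le x z v v' : v <= v' -> approximates x z v -> approximates x z v'.
Proof.
move=> vv [D H]; split=> //; apply: (le_trans H); have [c0 _] := mu_inv_cond n0 f0 D.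
by rewrite ler_wpM2r// ltW.
Qed.

Lemma newton_approximates x z v : solution_variety rho f z -> v <= 9 / 100 ->
  approximates x z v -> approximates (newton rho f x) z (9 / 2 * v ^+ 2).
Proof.
move=> fz v9 /approximates_controlled ctl.
have [[M [N ctl']] _] := newton_step n0 A0 rho0 f0 fz ctl v9.
exact: controlled_approximates ctl'.
Qed.

(** [newton_step] measures in the norm at [x]; both errors are moved to the norm at the fixed [z],
    so that successive ratios multiply. *)
Lemma next_newton_error x z M N v : solution_variety rho f z -> controlled rho f x z M N v ->
    v <= 2 / 45 ->
  local_norm rho z (newton rho f x - z) <= 3 / 2 * v * local_norm rho z (x - z).
Proof.
move=> fz ctl v45; have v9 : v <= 9 / 100 by lra.
have [_ nc] := newton_step n0 A0 rho0 f0 fz ctl v9.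
move: ctl => [[D M1 N1] cM nN Hv].
have d0 := local_norm_ge0 rho x (z - x).
have N0 : 0 <= N by lra.
have r0 : 0 <= N * local_norm rho x (z - x) by exact: mulr_ge0.
have xyr i (a : A i) : modc (ell rho x a (z - x)) <= N * local_norm rho x (z - x).
  exact: ell_le_nu.
have r1 : N * local_norm rho x (z - x) <= 1 / 11.
  apply: (@le_trans _ _ (M * (N * local_norm rho x (z - x)))).
    by rewrite -[leLHS]mul1r ler_wpM2r.
  by move: Hv; rewrite -!mulrA; lra.
have v0 : 0 <= v by apply: le_trans Hv; rewrite !mulr_ge0// ?invr_ge0//; lra.
have E1 : expR (N * local_norm rho x (z - x)) <= 11 / 10 by apply: (expR_num r0 r1); lra.
have b0 : (0 : R) <= 21 / 20 by lra.
have Bb : expR (N * local_norm rho x (z - x)) ^+ 2 - 2 * (N * local_norm rho x (z - x)) <= (21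
  / 20) ^+ 2.
  by apply: (expR_sqr_num r0 r1); lra.
have Ez := local_norm_recenter A0 rho0 xyr (newton rho f x - z).
have Ex := local_norm_recenterb A0 rho0 xyr b0 Bb (x - z).
rewrite (local_norm_distC rho x z x) in nc r0 E1 Ez Ex.
exact: (next_error_arith (expR_ge0 _) E1 v0 (local_norm_ge0 _ _ _) (local_norm_ge0 _ _ _) nc Ez
  Ex).
Qed.

Lemma iterates_approximate x z k : solution_variety rho f z -> approximates x z (9 / 100) ->
  approximates (iter k.+1 (newton rho f) x) z (2 / 9 * (1 / 5) ^+ (2 ^ k)%N).
Proof.
move=> fz ax; elim: k => [|k IH].
  by apply: approximates_le (newton_approximates fz (lexx _) ax); rewrite expn0 expr1; lra.
have [v45 v9 v0 v2] := fifth_pow R k.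
have := newton_approximates fz _ IH; rewrite iterS => H.
apply: approximates_le (H _); last exact: v9.
rewrite expnS mulnC exprM; move: (_ ^+ (2 ^ k)%N) => q; rewrite le_eqVlt; apply/orP; left;
  apply/eqP.
by field.
Qed.

(** Only the first step compares an error with the first increment. Afterwards exponents add:
    [2 ^ k + (2 ^ k + 2) = 2 ^ k.+1 + 2]. *)
Lemma iterates_error x z k : solution_variety rho f z -> approximates x z (9 / 100) ->
  local_norm rho z (iter k.+1 (newton rho f) x - z) <=
    2 ^- (2 ^ k + 2)%N * local_norm rho x (newton rho f x - x).
Proof.
move=> fz ax; have s0 := local_norm_ge0 rho x (newton rho f x - x).
elim: k => [|k IH].
  apply: (le_trans (first_newton_error n0 A0 rho0 f0 fz (approximates_controlled ax))).
  by rewrite ler_wpM2r// expn0; lra.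
have ak := iterates_approximate k fz ax.
have [v45 v9 v0 v2] := fifth_pow R k.
rewrite iterS; apply: (le_trans (next_newton_error fz (approximates_controlled ak) v45)).
have e0 := local_norm_ge0 rho z (iter k.+1 (newton rho f) x - z).
apply: (@le_trans _ _ (2 ^- (2 ^ k)%N * (2 ^- (2 ^ k + 2)%N * local_norm rho x (newton rho f x
  - x)))).
  exact: ler_pM.
rewrite mulrA -invfM -exprD; rewrite le_eqVlt; apply/orP; left; apply/eqP.
by congr (_^-1 * _); congr (_ ^+ _); rewrite expnS mul2n -addnn addnA.
Qed.

End NewtonIterates.

Lemma short_arith (R : realType) (h h' c c' : R) : 0 < c -> h <= 29 / 400 * c ->
    `|c - c'| < c / 100 / 10 -> `|h - h'| < c / 100 / 10 ->
  0 < c' /\ h' <= 3 / 40 * c'.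
Proof.
rewrite !ltr_norml => c0 H /andP[c1 c2] /andP[h1 h2].
have cc : 99 / 100 * c <= c' by lra.
split; lra.
Qed.

Lemma succ_le_ceil (R : realType) (u : R) (k : nat) : k%:R < u -> k.+1%:Z <= Num.ceil u.
Proof. by move=> ku; rewrite -addn1 PoszD lezD1 ceil_gt_int. Qed.

(** * The whole path *)

Section Homotopy.
Variables (R : realType) (n : nat) (A : 'I_n -> {fset 'rV[R]_n}).
Variable rho : forall i, A i -> R.
Arguments rho : clear implicits.
Hypothesis n0 : (0 < n)%N.
Hypothesis A0 : forall i, A i != fset0.
Hypothesis rho0 : forall i a, 0 < rho i a.
Local Notation C := R[i].
Variables (T : R) (f : R -> system A) (z : R -> 'cV[C]_n).
Hypothesis T0 : 0 <= T.
Hypothesis rfz : rectifiable 0 T f z.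
Hypothesis f0 : forall t, 0 <= t <= T -> forall i, f t i != 0.
Hypothesis fz : forall t, 0 <= t <= T -> solution_variety rho (f t) (z t).
Hypothesis unitfz : forall t, 0 <= t <= T -> DS_op rho (f t) (z t) \in unitmx.
Variable alpha1 : R.
Hypotheses (alpha1_ge : 811 / 100 / 100 <= alpha1) (alpha1_le : alpha1 <= 813 / 100 / 100).

Local Notation approximates t x v := (approximates rho (f t) x (z t) v).

Let G t : \bar R := (mu rho (f t) (z t) * nu rho (z t) *
  (Num.sqrt (FS_norm (f t) (system_velocity f t) ^+ 2 +
    local_norm rho (z t) (point_velocity z t) ^+ 2))%:E)%E.

Let G_ge0 t : 0 <= t <= T -> (0 <= G t)%E.
Proof. by move=> tT; exact: (condition_integrand_ge0 n0 A0 rho0 f0 unitfz tT). Qed.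

Definition exceeding a x : set (\bar R) :=
  [set s%:E | s in [set s : R | (a < s <= T)%R /\ step_test rho alpha1 (f s) x]].

(** If the test is never met the infimum is [+oo], and the minimum with [T] keeps the time
    finite. *)
Definition next_time a x : R := fine (mine T%:E (ereal_inf (exceeding a x))).

Lemma next_timeE a x : a <= T -> (next_time a x)%:E = mine T%:E (ereal_inf (exceeding a x)).
Proof.
move=> aT; rewrite /next_time fineK//.
have lb : (a%:E <= ereal_inf (exceeding a x))%E.
  by apply: le_ereal_inf_tmp => _ [s [/andP[as_ _] _] <-]; rewrite lee_fin ltW.
rewrite fin_numElt (lt_le_trans (ltNyr a)) ?le_min ?lee_fin ?aT//=.
by rewrite gt_min ltry.
Qed.

Lemma next_time_itv a x : a <= T -> a <= next_time a x <= T.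
Proof.
move=> aT; rewrite -!lee_fin next_timeE// ge_min lexx /= andbT le_min lee_fin aT /=.
by apply: le_ereal_inf_tmp => _ [s [/andP[as_ _] _] <-]; rewrite lee_fin ltW.
Qed.

Lemma before_next_time a x s : a <= T -> a < s < next_time a x -> ~ step_test rho alpha1 (f s) x.
Proof.
move=> aT /andP[as_ sb] ts; have := next_time_itv x aT => /andP[_ bT].
have : (ereal_inf (exceeding a x) <= s%:E)%E.
  apply: ereal_inf_lbound; exists s => //; split=> //.
  by rewrite as_ (le_trans (ltW sb)).
move: sb; rewrite -lte_fin next_timeE// lt_min => /andP[_] H /(lt_le_trans H).
by rewrite ltxx.
Qed.

Section OneStep.
Variables (a : R) (x : 'cV[C]_n).
Hypothesis aT : 0 <= a <= T.
Hypothesis ax : approximates a x (1 / 25).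
Let b := next_time a x.

Let aT' : a <= T. Proof. by case/andP: aT. Qed.

Let a0 : 0 <= a. Proof. by case/andP: aT. Qed.

Let ab : a <= b. Proof. by have /andP[] := next_time_itv x aT'. Qed.

Let bT : b <= T. Proof. by have /andP[] := next_time_itv x aT'. Qed.

Let nd : nondegenerate rho x. Proof. exact: nondegenerate_of_unit (f0 aT) ax.1. Qed.

Let ca : 0 < inv_cond rho (f a) x. Proof. by have [] := mu_inv_cond n0 (f0 aT) ax.1. Qed.

Let nt : forall t, a < t < b -> ~ step_test rho alpha1 (f t) x.
Proof. by move=> t; exact: before_next_time. Qed.

Let bab : a <= b <= b. Proof. by rewrite ab lexx. Qed.

Let b0T : 0 <= b <= T. Proof. by rewrite (le_trans a0 ab) bT. Qed.

Lemma next_approximates : approximates b x (9 / 100).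
Proof.
have [cb hb] := step_controlled n0 A0 rho0 T0 rfz f0 fz unitfz alpha1_le nd a0 ab bT ca ax.2 nt
  bab.
by split=> //; exact: unit_of_inv_cond.
Qed.

Lemma next_time_long : b < T -> ((1 / 59)%:E < \int[lebesgue_measure]_(t in `]a, b]) G t)%E.
Proof.
move=> bltT; rewrite ltNge; apply/negP => short.
have hb := short_step n0 A0 rho0 T0 rfz f0 fz unitfz alpha1_le nd a0 ab bT ca ax.2 nt short.
have [cb _] := step_controlled n0 A0 rho0 T0 rfz f0 fz unitfz alpha1_le nd a0 ab bT ca ax.2 nt
  bab.
have e0 : 0 < inv_cond rho (f b) x / 100 / 10 by do 2 apply: divr_gt0 => //.
have [d1 d10 H1] := ac_unif_continuous (halfstep_path_ac n0 A0 rho0 rfz nd) e0.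
have [d2 d20 H2] := ac_unif_continuous (inv_cond_path_ac n0 T0 rfz f0 nd) e0.
pose d := Num.min d1 d2.
have d0 : 0 < d by rewrite lt_min d10.
have infE : ereal_inf (exceeding a x) = b%:E.
  have := next_timeE x aT'; rewrite -/b => bE.
  have : (b%:E < T%:E)%E by rewrite lte_fin.
  rewrite bE minEle; case: ifPn => //; by rewrite ltxx.
(* The infimum need not be attained, so a time [s] that meets the test is taken within [d] of [b];
   the bound 29/400 at [b] degrades at most to 3/40 at [s]. *)
have [|_ [s [/andP[as_ sT] ts] <-]] := @ereal_inf_lt _ (exceeding a x) (b + d)%:E.
  by rewrite infE lte_fin ltrDl.
rewrite lte_fin => sd.
have bs : b <= s.
  by rewrite -lee_fin -infE; apply: ereal_inf_lbound; exists s => //; split=> //; rewrite as_.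
have sT' : 0 <= s <= T by rewrite (le_trans a0 (ltW as_)).
have bsd : `|b - s| < d by rewrite distrC ger0_norm ?subr_ge0// ltrBlDl.
have := H1 b s b0T sT' _; have := H2 b s b0T sT' _.
move: bsd; rewrite lt_min => /andP[b1 b2] /(_ b2) Hc /(_ b1) Hh.
have [cs hs] := short_arith cb hb Hc Hh.
exact: (not_step_test n0 A0 rho0 alpha1_ge (f0 sT') (unit_of_inv_cond nd cs) (fz sT') hs ts).
Qed.

End OneStep.

Lemma lt_integral_adjacent (b c c1 c2 : R) : 0 <= b -> b <= c -> c <= T ->
    (c1%:E < \int[lebesgue_measure]_(s in `]0%R, b]) G s)%E ->
    (c2%:E < \int[lebesgue_measure]_(s in `]b, c]) G s)%E ->
  ((c1 + c2)%:E < \int[lebesgue_measure]_(s in `]0%R, c]) G s)%E.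
Proof.
move=> b0 bc cT; apply: lt_integral_setU.
- by move=> s /=; rewrite !in_itv/= => /andP[-> /le_trans]; apply.
- by move=> s /=; rewrite !in_itv/= => /andP[ts ->]; rewrite (le_lt_trans b0 ts).
- apply/seteqP; split => // s [] /=; rewrite !in_itv/= => /andP[_ st] /andP[ts _].
  by move: (lt_le_trans ts st); rewrite ltxx.
- move=> s /=; rewrite in_itv/= => /andP[s0 st]; apply: G_ge0.
  by rewrite ltW//= (le_trans st).
Qed.

Variable x0 : 'cV[C]_n.
Hypothesis start : approximates 0 x0 (9 / 100).

Definition advance (p : 'cV[C]_n * R) : 'cV[C]_n * R :=
  (newton rho (f p.2) p.1, next_time p.2 (newton rho (f p.2) p.1)).

Let x k := (iter k advance (x0, 0)).1.
Let t k := (iter k advance (x0, 0)).2.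

Lemma newton_recentered a y : 0 <= a <= T -> approximates a y (9 / 100) ->
  approximates a (newton rho (f a) y) (1 / 25).
Proof.
move=> aT ay; apply: (approximates_le n0 (f0 aT) _ (newton_approximates n0 A0 rho0 (f0 aT) (fz
  aT) (lexx _) ay)).
lra.
Qed.

Lemma homotopy_invariant k : 0 <= t k <= T /\ approximates (t k) (x k) (9 / 100).
Proof.
elim: k => [|k [tT tx]]; first by split; [rewrite lexx|exact: start].
have ax := newton_recentered tT tx.
have := next_time_itv (x k.+1) (proj2 (andP tT)) => /andP[tk tkT].
split; last exact: next_approximates tT ax.
by rewrite (le_trans (proj1 (andP tT)) tk).
Qed.

Lemma time_nondecreasing k : t k <= t k.+1.
Proof.
have [tT _] := homotopy_invariant k.
by have := next_time_itv (x k.+1) (proj2 (andP tT)) => /andP[].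
Qed.

(** A step is complete when it ends before [T]; only such steps are counted, not the truncated last
    one. *)
Lemma length_before k : t k.+1 < T ->
  ((k.+1%:R / 59)%:E < \int[lebesgue_measure]_(s in `]0%R, t k.+1]) G s)%E.
Proof.
elim: k => [|k IH] tk.
  have [tT tx] := homotopy_invariant 0.
  exact: (next_time_long tT (newton_recentered tT tx) tk).
have tk' : t k.+1 < T := le_lt_trans (time_nondecreasing k.+1) tk.
have [tT tx] := homotopy_invariant k.+1.
have L2 := next_time_long tT (newton_recentered tT tx) tk.
have -> : k.+2%:R / 59 = k.+1%:R / 59 + 1 / 59 :> R by rewrite -addn1 natrD mulrDl.
have t0 : 0 <= t k.+1 by case/andP: tT.
exact: lt_integral_adjacent t0 (time_nondecreasing k.+1) (ltW tk) (IH tk') L2.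
Qed.

Let L := condition_length rho f z 0 T.

Lemma condition_length_ge0 : (0 <= L)%E.
Proof. by apply: integral_ge0 => s /=; rewrite in_itv/=; exact: G_ge0. Qed.

Lemma length_bound k : t k.+1 < T -> k.+1%:R < 59 * fine L.
Proof.
move=> tk; have Lfin : L = (fine L)%:E.
  rewrite fineK// fin_numElt (lt_le_trans _ condition_length_ge0)//=.
  exact: (condition_length_lty n0 A0 rho0 T0 rfz f0 fz unitfz).
have : ((k.+1%:R / 59)%:E < L)%E.
  apply: (lt_le_trans (length_before tk)); apply: ge0_integral_mono.
  - by move=> s /=; rewrite !in_itv/= => /andP[/ltW -> /le_trans]; apply; exact: ltW.
  - move=> s /=; rewrite in_itv/= => /andP[s0 st]; apply: G_ge0.
    by rewrite ltW//= (le_trans st)// ltW.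
  - by move=> s /=; rewrite in_itv/=; exact: G_ge0.
  - by [].
by rewrite {1}Lfin lte_fin ltr_pdivrMr ?ltr0n// mulrC.
Qed.

Lemma homotopy_ends : exists N, t N = T /\
  (N%:Z <= Num.ceil (59 * fine L) \/ [/\ 0 < T, L = 0%E & N = 1%N]).
Proof.
have L0 : 0 <= fine L by apply: fine_ge0; exact: condition_length_ge0.
have tle k : t k <= T by have [/andP[]] := homotopy_invariant k.
have exN : exists N, t N == T.
  have [m mL] : exists m : nat, 59 * fine L <= m%:R.
    by exists (Num.bound (59 * fine L)); rewrite ltW// archi_boundP// mulr_ge0.
  exists m.+1; rewrite eq_le tle /= leNgt; apply/negP => /length_bound mL'.
  by have := lt_le_trans mL' mL; rewrite ltr_nat ltnNge leqnSn.
have [N /eqP tN minN] := ex_minnP exN; exists N; split => //.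
have before k : (k < N)%N -> t k < T.
  move=> kN; rewrite lt_neqAle tle andbT; apply/negP => /minN.
  by rewrite leqNgt kN.
(* By minimality the step before the last ends below [T], which for at least two steps gives
   [N - 1 < 59 L] and hence the ceiling bound. A single step has no complete step before it, so the
   bound then rests on [0 < L]. *)
case: N tN before {minN} => [|[|N]] tN before.
- by left; rewrite ceil_ge0 (lt_le_trans (ltrN10 R))// mulr_ge0.
- have T0' : 0 < T by exact: before 0%N _.
  have [Lp|L0'] := ltP 0 (fine L).
    by left; apply: succ_le_ceil; rewrite mulr_gt0.
  right; split => //; have Lfin : L = (fine L)%:E.
    rewrite fineK// fin_numElt (lt_le_trans _ condition_length_ge0)//=.
    exact: (condition_length_lty n0 A0 rho0 T0 rfz f0 fz unitfz).
  by rewrite Lfin; congr EFin; apply/le_anti; rewrite L0' L0.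
- by left; apply: succ_le_ceil; exact: length_bound (before N.+1 (ltnSn _)).
Qed.

Lemma homotopy_correct : exists (x : nat -> 'cV[C]_n) (t : nat -> R),
  [/\ x 0%N = x0, t 0%N = 0,
    forall k, [/\ DS_op rho (f (t k)) (x k) \in unitmx,
      x k.+1 = newton rho (f (t k)) (x k) &
      (t k.+1)%:E = mine T%:E (ereal_inf (exceeding (t k) (x k.+1)))] &
    exists N, [/\ t N = T,
      N%:Z <= Num.ceil (59 * fine L) \/ [/\ 0 < T, L = 0%E & N = 1%N] &
      exists y : nat -> 'cV[C]_n, [/\ y 0%N = x N,
        forall k, DS_op rho (f T) (y k) \in unitmx /\ y k.+1 = newton rho (f T) (y k) &
        forall k, (1 <= k)%N -> local_norm rho (z T) (y k - z T) <=
          2 ^- (2 ^ k.-1 + 2)%N * local_dist rho (y 0%N) (y 0%N) (y 1%N)]]].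
Proof.
exists x, t; split => // [k|].
  have [tT [D _]] := homotopy_invariant k; split => //.
  by apply: next_timeE; case/andP: tT.
have [N [tN HN]] := homotopy_ends; exists N; split => //.
have [tT tx] := homotopy_invariant N; rewrite tN in tT tx.
exists (fun k => iter k (newton rho (f T)) (x N)); split => // [k|[//|k] _].
  split => //; case: k => [|k]; first exact: tx.1.
  by have [] := iterates_approximate n0 A0 rho0 (f0 tT) k (fz tT) tx.
have small : halfstep rho (x N) (z T) <= 181 / 20 / 100 * inv_cond rho (f T) (x N).
  apply: (le_trans tx.2); have [c0 _] := mu_inv_cond n0 (f0 tT) tx.1.
  by rewrite ler_wpM2r ?(ltW c0)//; lra.
have [_ [_ _ _ dE]] := step_dist n0 A0 rho0 (f0 tT) tx.1 (fz tT) small.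
rewrite [local_dist _ _ _ _]dE.
exact: (iterates_error n0 A0 rho0 (f0 tT) k (fz tT) tx).
Qed.

End Homotopy.

(** * Translation of the path *)

Section PathTranslation.
Variables (R : realType) (n : nat) (A : 'I_n -> {fset 'rV[R]_n}).
Variable rho : forall i, A i -> R.
Arguments rho : clear implicits.
Local Notation C := R[i].
Variables (f : R -> system A) (z : R -> 'cV[C]_n) (w : 'cV[C]_n).

Lemma derive1_addr (g : R -> R^o) (k t : R) : derive1 (fun s => g s + k : R^o) t = derive1 g t.
Proof.
rewrite /derive1; set F := (X in lim (X @ _)); set G := (X in _ = lim (X @ _)).
by rewrite (_ : F = G)//; apply/funext => h; rewrite /F /G opprD addrACA subrr addr0.
Qed.

Lemma point_velocity_addr t : point_velocity (fun s => z s + w) t = point_velocity z t.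
Proof.
apply/matrixP => j k; rewrite !mxE /velocity.
rewrite -(derive1_addr (fun s => complex.Re (z s j 0)) (complex.Re (w j 0))).
rewrite -(derive1_addr (fun s => complex.Im (z s j 0)) (complex.Im (w j 0))).
by congr (derive1 _ t +i* derive1 _ t)%C; apply/funext => s; rewrite mxE raddfD.
Qed.

Lemma rectifiable_addr (a b : R) : rectifiable a b f z -> rectifiable a b f (fun s => z s + w).
Proof.
move=> [rf rz]; split=> // j e e0; have [d d0 H] := rz j e e0; exists d => // s sab os sd.
apply: le_lt_trans (H s sab os sd); apply: ler_sum => I _.
by rewrite !mxE opprD addrACA subrr addr0.
Qed.

End PathTranslation.

Theorem theoremB (R : realType) :
  exists alpha1 u1 : R,
  [/\ 81 / 1000 + 239 / 1000 ^+ 2 + 483 / 1000 ^+ 3 <= alpha1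
        < 81 / 1000 + 239 / 1000 ^+ 2 + 484 / 1000 ^+ 3,
      39 / 1000 + 745 / 1000 ^+ 2 + 185 / 1000 ^+ 3 <= u1
        < 39 / 1000 + 745 / 1000 ^+ 2 + 186 / 1000 ^+ 3
    & forall (n : nat) (A : 'I_n -> {fset 'rV[R]_n}) (rho : forall i, A i -> R)
        (T : R) (f : R -> system A) (z : R -> 'cV[R[i]]_n) (x0 : 'cV[R[i]]_n),
      (0 < n)%N ->
      (forall i, A i != fset0) ->
      (forall i (a : A i), 0 < rho i a) ->
      0 <= T ->
      rectifiable 0 T f z ->
      (forall t : R, 0 <= t <= T ->
        [/\ forall i, f t i != 0,
            solution_variety rho (f t) (z t)
          & ~ Sigma' rho (f t) (z t)]) ->
      ((2^-1)%:E * mu rho (f 0%R) (z 0%R) * nu rho (z 0%R)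
         * (local_dist rho (z 0%R) (z 0%R) x0)%:E <= u1%:E)%E ->
      exists (x : nat -> 'cV[R[i]]_n) (t : nat -> R),
      [/\ x 0%N = x0,
          t 0%N = 0,
          forall k : nat,
            [/\ DS_op rho (f (t k)) (x k) \in unitmx,
                x k.+1 = newton rho (f (t k)) (x k)
              & ((t k.+1)%:E = mine T%:E (ereal_inf
                  [set s%:E | s in [set s : R | (t k < s <= T)%R /\
                    alpha1%:E <= (2^-1)%:E * mu rho (f s) (x k.+1)
                                  * nu rho (x k.+1)
                                  * newton_step_norm rho (f s) (x k.+1)]]))%E]
        & exists N : nat,
          [/\ t N = T,
              (* The second alternative is the degenerate case of a constant
                 path over a nontrivial interval, where one step is needed. *)
              N%:Z <= Num.ceil (59 * fine (condition_length rho f z 0 T))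
              \/ [/\ 0 < T, condition_length rho f z 0 T = 0%E & N = 1%N]
            & exists y : nat -> 'cV[R[i]]_n,
              [/\ y 0%N = x N,
                  forall k : nat,
                    DS_op rho (f T) (y k) \in unitmx /\
                    y k.+1 = newton rho (f T) (y k)
                & forall k : nat, (1 <= k)%N ->
                    local_dist rho (z T) (y k) (z T)
                      <= 2 ^- (2 ^ k.-1 + 2)%N
                         * local_dist rho (y 0%N) (y 0%N) (y 1%N)]]]].
Proof.
(* Any number with the prescribed digits serves; the argument uses only that it lies between
   811/10000 and 813/10000. *)
have [al [al1 al2 al3]] : exists al : R, [/\ 81 / 1000 + 239 / 1000 ^+ 2 + 483 / 1000 ^+ 3 <= al
    < 81 / 1000 + 239 / 1000 ^+ 2 + 484 / 1000 ^+ 3, 811 / 100 / 100 <= al & al <= 813 / 100 /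
      100].
  by exists (81 / 1000 + 239 / 1000 ^+ 2 + 483 / 1000 ^+ 3); split; [apply/andP; split|..]; lra.
have [u1 [u11 u12]] : exists u1 : R, 39 / 1000 + 745 / 1000 ^+ 2 + 185 / 1000 ^+ 3 <= u1
    < 39 / 1000 + 745 / 1000 ^+ 2 + 186 / 1000 ^+ 3 /\ u1 < 1 / 25.
  by exists (39 / 1000 + 745 / 1000 ^+ 2 + 185 / 1000 ^+ 3); split; [apply/andP; split|]; lra.
exists al, u1; split; [exact: al1|exact: u11|].
move=> n A rho T f z x0 n0 A0 rho0 T0 rfz path start.
have f0 t : 0 <= t <= T -> forall i, f t i != 0 by move=> /path[].
have fz t : 0 <= t <= T -> solution_variety rho (f t) (z t) by move=> /path[].
have unitfz t : 0 <= t <= T -> DS_op rho (f t) (z t) \in unitmx.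
  by move=> tT; have [f0t fzt nS] := path t tT; exact: (unit_of_not_Sigma' A0 rho0 n0 f0t fzt nS).
have zT : 0 <= (0 : R) <= T by apply/andP.
have [M [N [M1 N1 cM nN MN]]] : exists M N : R, [/\ 1 <= M, 1 <= N,
    cond_le rho (f 0) (z 0) M, nu_le rho (z 0) N &
    2^-1 * M * N * local_dist rho (z 0) (z 0) x0 <= u1].
  have [muE M0 cM _] := mu_spec (f0 0 zT) (unitfz 0 zT).
  have nd := nondegenerate_of_unit (f0 0 zT) (unitfz 0 zT).
  have [nuE N1 nN] := nu_facts n0 A0 rho0 nd.
  exists (fine (mu rho (f 0) (z 0))), (fine (nu rho (z 0))); split => //.
    exact: one_le_of_cond_le n0 (f0 0 zT) nd cM.
  by move: start; rewrite muE nuE -!EFinM lee_fin.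
have M0 : 0 < M := lt_le_trans ltr01 M1.
have N0 : 0 < N := lt_le_trans ltr01 N1.
have k0 : 0 < 2^-1 * M * N by rewrite !mulr_gt0// invr_gt0.
(* The infimum over representatives need not be attained; the strict inequality [u1 < 1 / 25] yields
   a period that brings [z 0] close enough to [x0]. *)
have [w pw small] : exists2 w, period A w &
    2^-1 * M * N * local_norm rho (z 0) (z 0 + w - x0) <= 1 / 25.
  have [|w pw H] := @local_dist_approx _ _ _ rho A0 rho0 (z 0) (z 0) x0 (1 / 25 / (2^-1 * M * N)).
    by rewrite ltr_pdivlMr// mulrC; exact: le_lt_trans MN u12.
  by exists w => //; rewrite mulrC -ler_pdivlMr// ltW.
pose z' t := z t + w.
have fz' t : 0 <= t <= T -> solution_variety rho (f t) (z' t).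
  by move=> tT; exact: solution_period pw (fz t tT).
have unitfz' t : 0 <= t <= T -> DS_op rho (f t) (z' t) \in unitmx.
  by move=> tT; exact: (unit_period A0 rho0 (f0 t tT) pw (unitfz t tT)).
have ctl : controlled rho (f 0) (z' 0) x0 M N (1 / 25).
  split; [split => //; exact: unitfz'|exact/(cond_le_period A0 rho0 (f 0) (z 0) M
    pw)|exact/(nu_le_period A0 rho0 (z 0) N pw)|].
  by rewrite (local_norm_period A0 rho0 (z 0) _ pw) local_norm_distC.
have [M' [N' ctl']] := start_controlled n0 A0 rho0 (f0 0 zT) (fz' 0 zT) ctl.
have ap := controlled_approximates n0 A0 rho0 (f0 0 zT) ctl'.
have [x [t [x0E t0E rec [K [tK HK [y [y0 yrec yerr]]]]]]] :=
  homotopy_correct n0 A0 rho0 T0 (rectifiable_addr w rfz) f0 fz' unitfz' al2 al3 ap.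
exists x, t; split; [exact: x0E|exact: t0E|exact: rec|exists K; split; [exact: tK| |exists y;
  split; [exact: y0|exact: yrec|]]].
  suff <- : condition_length rho f z' 0 T = condition_length rho f z 0 T by exact: HK.
  apply: eq_integral => s; rewrite inE /= in_itv/= => sT.
  rewrite (mu_period A0 rho0 (f0 s sT) pw (unitfz s sT)) (nu_period A0 rho0 (z s) n0 pw).
  by rewrite point_velocity_addr (local_norm_period A0 rho0 (z s) _ pw).
(* The error bound concerns the translated endpoint, which represents the same point of the quotient
   and has the same local norm. *)
move=> k k1; apply: le_trans (yerr k k1).
rewrite (local_norm_period A0 rho0 (z T) _ pw).
apply: local_dist_le; first exact: same_point_refl.
exact: period_same_point.
Qed.
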